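(* Let $M$ be a smooth $4$-dimensional manifold with a smooth pseudo-Riemannian metric $g$. (1) If $(M,g,J_+)$ is a para-Hermitian manifold with $g$ of signature $(2,2)$, then there is a unique para-Kähler--Weyl connection on $(M,g,J_+)$, i.e. a unique Weyl connection $\nabla$ for $g$ with $\nabla J_+=0$, and its associated $1$-form is $\phi=\frac12 J_+\delta\Omega_+$. (2) If $(M,g,J_-)$ is a pseudo-Hermitian manifold with $g$ of signature $(2,2)$, then there is a unique Kähler--Weyl connection on $(M,g,J_-)$, i.e. a unique Weyl connection $\nabla$ for $g$ with $\nabla J_-=0$, and its associated $1$-form is $\phi=-\frac12 J_-\delta\Omega_-$. (3) If $(M,g,J_-)$ is a Hermitian manifold with $g$ of signature $(0,4)$ (i.e. positive definite), then there is a unique Kähler--Weyl connection on $(M,g,J_-)$, i.e. a unique Weyl connection $\nabla$ for $g$ with $\nabla J_-=0$, and its associated $1$-form is $\phi=-\frac12 J_-\delta\Omega_-$.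
   Context: Weyl connections: a connection $\nabla$ on $TM$ is a Weyl connection for $g$ if it is torsion free and $\nabla g=-2\phi\otimes g$ for some smooth $1$-form $\phi$, called the associated $1$-form. Given $\phi$, there is exactly one such connection, namely $\nabla^\phi_xy=\nabla^g_xy+\phi(x)y+\phi(y)x-g(x,y)\phi^{\#}$, where $\nabla^g$ is the Levi-Civita connection and $\phi^{\#}$ is the $g$-dual vector field of $\phi$. Para-Hermitian: $(M,g,J_+)$ is para-Hermitian if $\dim M=2\bar m$, $g$ has neutral signature $(\bar m,\bar m)$, $J_+$ is a smooth endomorphism of $TM$ with $J_+^2=\operatorname{Id}$ and $J_+^*g=-g$ (i.e. $g(J_+x,J_+y)=-g(x,y)$), and $J_+$ is integrable: the tensor $N_{J_+}(x,y)=[x,y]-J_+[J_+x,y]-J_+[x,J_+y]+[J_+x,J_+y]$ vanishes; equivalently, near each point there are local coordinates $(u^1,\dots,u^{\bar m},v^1,\dots,v^{\bar m})$ with $J_+\partial_{u_i}=\partial_{v_i}$ and $J_+\partial_{v_i}=\partial_{u_i}$. Pseudo-Hermitian: $(M,g,J_-)$ is pseudo-Hermitian if $g$ is pseudo-Riemannian, $J_-$ is a smooth endomorphism of $TM$ with $J_-^2=-\operatorname{Id}$ and $J_-^*g=g$, and $J_-$ is integrable: the tensor $N_{J_-}(x,y)=[x,y]+J_-[J_-x,y]+J_-[x,J_-y]-[J_-x,J_-y]$ vanishes; equivalently, near each point there are local coordinates with $J_-\partial_{u_i}=\partial_{v_i}$ and $J_-\partial_{v_i}=-\partial_{u_i}$.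 It is Hermitian if moreover $g$ is positive definite. The (para-)Kähler form is the $2$-form $\Omega_\pm(x,y)=g(x,J_\pm y)$. $M$ is oriented by $\frac12\Omega_\pm\wedge\Omega_\pm$. The Hodge operator $\star$ is characterized by $\omega_1\wedge\star\omega_2=\langle\omega_1,\omega_2\rangle\,\mu$, where $\mu$ is the oriented volume form and $\langle\cdot,\cdot\rangle$ is the inner product induced by $g$ on forms (with $\langle \alpha_1\wedge\cdots\wedge\alpha_k,\beta_1\wedge\cdots\wedge\beta_k\rangle=\det(\langle\alpha_i,\beta_j\rangle)$). The co-derivative is $\delta\Omega_\pm=-\star d\star\Omega_\pm$ (which does not depend on the choice of orientation). $J_\pm$ acts on $1$-forms by $(J_\pm\psi)(X)=\psi(J_\pm X)$. *)

(* Defs.v *)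
From HB Require Import structures.
From mathcomp Require Import all_boot all_order all_algebra all_fingroup.
From mathcomp Require Import all_classical all_reals all_analysis.

Set Implicit Arguments.
Unset Strict Implicit.
Unset Printing Implicit Defensive.

Import Order.TTheory GRing.Theory Num.Theory numFieldNormedType.Exports.
Local Open Scope classical_set_scope.
Local Open Scope ring_scope.

(* Vectors of R^n are row vectors, linear maps act on the right (v *m A), and
   coordinate indices run over 'I_n. *)

Section Euclidean.
Context {R : realType} {n : nat}.

Fixpoint iter_partial {W : normedModType R} (s : seq 'I_n) (f : 'rV[R]_n -> W) :
    'rV[R]_n -> W :=
  if s is a :: s' then fun x => 'D_(delta_mx 0 a) (iter_partial s' f) x else f.

(* C^oo on an open set U. Asking every iterated partial derivative to be
   (Frechet) differentiable on U is equivalent to asking all of them to exist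
   and to be continuous on U. *)
Definition smooth_on {W : normedModType R} (U : set 'rV[R]_n)
    (f : 'rV[R]_n -> W) : Prop :=
  forall (s : seq 'I_n) x, U x -> differentiable (iter_partial s f) x.

End Euclidean.

(* [chart_inv i] is the inverse of the chart [chart_map i]; its values outside
   [chart_map i @` chart_dom i] are irrelevant. *)
Record manifold (R : realType) (n : nat) := Manifold {
  carrier :> topologicalType;
  mfd_hausdorff : hausdorff_space carrier;
  mfd_second_countable : @second_countable carrier;
  chart : Type;
  chart_dom : chart -> set carrier;
  chart_map : chart -> carrier -> 'rV[R]_n;
  chart_inv : chart -> 'rV[R]_n -> carrier;
  chart_dom_open : forall i, open (chart_dom i);
  chart_cover : forall p, exists i, chart_dom i p;
  chart_mapK : forall i p, chart_dom i p -> chart_inv i (chart_map i p) = p;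
  chart_map_open : forall i, open (chart_map i @` chart_dom i);
  chart_map_continuous : forall i p, chart_dom i p ->
    {for p, continuous (chart_map i)};
  chart_inv_continuous : forall i x, (chart_map i @` chart_dom i) x ->
    {for x, continuous (chart_inv i)};
  transition_smooth : forall i j,
    smooth_on (chart_map i @` (chart_dom i `&` chart_dom j))
      (chart_map j \o chart_inv i)
}.

Arguments chart {R n} m.
Arguments chart_dom {R n m}.
Arguments chart_map {R n m}.
Arguments chart_inv {R n m}.

Section Manifold.
Context {R : realType} {n : nat} {M : manifold R n}.

Definition chart_at (p : M) : chart M := projT1 (cid (chart_cover p)).

(* The tangent space T_pM is 'rV[R]_n, a vector being given by its components
   in the chart [chart_at p]. So a vector field is a function M -> 'rV[R]_n,
   and g or J is a function M -> 'M[R]_n. The matrices [to_chart i p] and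
   [from_chart i p] change components between [chart_at p] and any chart i
   around p; row a of [from_chart i p] is the coordinate vector d/dx^a of i. *)
Definition to_chart (i : chart M) (p : M) : 'M[R]_n :=
  'J (chart_map i \o chart_inv (chart_at p)) (chart_map (chart_at p) p).

Definition from_chart (i : chart M) (p : M) : 'M[R]_n :=
  'J (chart_map (chart_at p) \o chart_inv i) (chart_map i p).

Definition coord_field (i : chart M) (a : 'I_n) (p : M) : 'rV[R]_n :=
  row a (from_chart i p).

Definition chart_components (i : chart M) (X : M -> 'rV[R]_n) (x : 'rV[R]_n) :
    'rV[R]_n :=
  X (chart_inv i x) *m to_chart i (chart_inv i x).

Definition smooth_fun (U : set M) (f : M -> R) : Prop :=
  forall i, smooth_on (chart_map i @` (U `&` chart_dom i)) (f \o chart_inv i).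

Definition smooth_vf (U : set M) (X : M -> 'rV[R]_n) : Prop :=
  forall i, smooth_on (chart_map i @` (U `&` chart_dom i)) (chart_components i X).

Definition smooth_fun_near (p : M) (f : M -> R) : Prop :=
  exists U, [/\ open U, U p & smooth_fun U f].

Definition smooth_vf_near (p : M) (X : M -> 'rV[R]_n) : Prop :=
  exists U, [/\ open U, U p & smooth_vf U X].

(* the derivative v(f) of f along v in T_pM *)
Definition dderiv (p : M) (v : 'rV[R]_n) (f : M -> R) : R :=
  'D_v (f \o chart_inv (chart_at p)) (chart_map (chart_at p) p).

(* [X, Y]^a = X(Y^a) - Y(X^a) in the chart [chart_at p] *)
Definition lie_bracket (X Y : M -> 'rV[R]_n) (p : M) : 'rV[R]_n :=
  let i := chart_at p in
  'D_(X p) (chart_components i Y) (chart_map i p)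
    - 'D_(Y p) (chart_components i X) (chart_map i p).

Definition ip (G : 'M[R]_n) (x y : 'rV[R]_n) : R := (x *m G *m y^T) 0 0.

Definition smooth_metric (g : M -> 'M[R]_n) : Prop :=
  forall i a b,
    smooth_fun (chart_dom i)
      (fun p => ip (g p) (coord_field i a p) (coord_field i b p)).

Definition pseudo_riemannian (g : M -> 'M[R]_n) : Prop :=
  [/\ smooth_metric g, forall p, (g p)^T = g p & forall p, g p \in unitmx].

(* a basis with m timelike and n - m spacelike vectors, i.e. signature
   (m, n - m) *)
Definition has_signature (m : nat) (g : M -> 'M[R]_n) : Prop :=
  forall p, exists2 B : 'M[R]_n, B \in unitmx &
    B *m g p *m B^T = diag_mx (\row_(i < n) if (i < m)%N then -1 else 1).

Definition positive_definite (g : M -> 'M[R]_n) : Prop :=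
  forall p (v : 'rV[R]_n), v != 0 -> 0 < ip (g p) v v.

Definition app_endo (J : M -> 'M[R]_n) (X : M -> 'rV[R]_n) (p : M) : 'rV[R]_n :=
  X p *m J p.

Definition smooth_endo (J : M -> 'M[R]_n) : Prop :=
  forall i a, smooth_vf (chart_dom i) (app_endo J (coord_field i a)).

Definition para_integrable (J : M -> 'M[R]_n) : Prop :=
  forall p X Y, smooth_vf_near p X -> smooth_vf_near p Y ->
    lie_bracket X Y p - lie_bracket (app_endo J X) Y p *m J p
      - lie_bracket X (app_endo J Y) p *m J p
      + lie_bracket (app_endo J X) (app_endo J Y) p = 0.

Definition complex_integrable (J : M -> 'M[R]_n) : Prop :=
  forall p X Y, smooth_vf_near p X -> smooth_vf_near p Y ->
    lie_bracket X Y p + lie_bracket (app_endo J X) Y p *m J p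
      + lie_bracket X (app_endo J Y) p *m J p
      - lie_bracket (app_endo J X) (app_endo J Y) p = 0.

Definition para_hermitian_mfd (g J : M -> 'M[R]_n) : Prop :=
  [/\ pseudo_riemannian g, ~~ odd n /\ has_signature n./2 g,
      smooth_endo J /\ (forall p, J p *m J p = 1%:M),
      (forall p x y, ip (g p) (x *m J p) (y *m J p) = - ip (g p) x y)
    & para_integrable J].

Definition pseudo_hermitian_mfd (g J : M -> 'M[R]_n) : Prop :=
  [/\ pseudo_riemannian g,
      smooth_endo J /\ (forall p, J p *m J p = - 1%:M),
      (forall p x y, ip (g p) (x *m J p) (y *m J p) = ip (g p) x y)
    & complex_integrable J].

Definition hermitian_mfd (g J : M -> 'M[R]_n) : Prop :=
  pseudo_hermitian_mfd g J /\ positive_definite g.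

(* A k-form at p takes its k arguments as the rows of a k x n matrix; a 1-form
   is thus a function of a row vector. *)
Definition alternating_form k (w : 'M[R]_(k, n) -> R) : Prop :=
  (forall (A B C : 'M[R]_(k, n)) i b c,
      row i A = b *: row i B + c *: row i C ->
      row' i B = row' i A -> row' i C = row' i A -> w A = b * w B + c * w C)
  /\ (forall A i j, i != j -> row i A = row j A -> w A = 0).

(* The rows of [v *m from_chart i p] are the vectors with constant components
   v in the chart i. *)
Definition smooth_form k (w : M -> 'M[R]_(k, n) -> R) : Prop :=
  (forall p, alternating_form (w p))
  /\ (forall i v, smooth_fun (chart_dom i) (fun p => w p (v *m from_chart i p))).

Definition wedge_form k l (a : 'M[R]_(k, n) -> R) (b : 'M[R]_(l, n) -> R)
    (v : 'M[R]_(k + l, n)) : R :=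
  (k`! * l`!)%N%:R^-1 *
  \sum_(s : 'S_(k + l))
    (-1) ^+ s * a (usubmx (row_perm s v)) * b (dsubmx (row_perm s v)).

(* The bilinear extension of <dx^I, dx^J> = det (g^(I_a J_b)), through
   w = (1/k!) sum_I w(e_I) dx^I, where I runs over all maps 'I_k -> 'I_n. *)
Definition form_ip (G : 'M[R]_n) k (w e : 'M[R]_(k, n) -> R) : R :=
  (k`!%:R ^+ 2)^-1 *
  \sum_(I : {ffun 'I_k -> 'I_n}) \sum_(J : {ffun 'I_k -> 'I_n})
    w (rowsub I 1%:M) * e (rowsub J 1%:M) * \det (mxsub I J (invmx G)).

(* The volume form of g in the orientation of the nowhere zero n-form th:
   |mu(v)| is the square root of the absolute value of the Gram determinant. *)
Definition volume_form (g : M -> 'M[R]_n) (th : M -> 'M[R]_n -> R)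
    (p : M) (v : 'M[R]_n) : R :=
  Num.sg (th p v) * Num.sqrt `|\det (v *m g p *m v^T)|.

(* To be used with k + l = n: the unique l-form [s] such that
   e /\ s = <e, w> mu for all k-forms e. *)
Definition hodge k l (g : M -> 'M[R]_n) (mu : M -> 'M[R]_(k + l, n) -> R)
    (w : M -> 'M[R]_(k, n) -> R) (p : M) : 'M[R]_(l, n) -> R :=
  xget (fun=> 0) [set s | alternating_form s /\
    forall e, alternating_form e ->
      forall v, wedge_form e s v = form_ip (g p) e (w p) * mu p v].

(* (dw)(v_0, ..., v_k) = sum_j (-1)^j v_j(w(v_0, .. omit v_j .., v_k)), where
   the v_j are extended with constant components in the chart [chart_at p]
   (so that their brackets vanish). *)
Definition ext_deriv k (w : M -> 'M[R]_(k, n) -> R) (p : M)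
    (v : 'M[R]_(k.+1, n)) : R :=
  \sum_(j < k.+1) (-1) ^+ j *
    dderiv p (row j v) (fun q => w q (row' j v *m from_chart (chart_at p) q)).

Definition kahler_form (g J : M -> 'M[R]_n) (p : M) (v : 'M[R]_(2, n)) : R :=
  ip (g p) (row 0 v) (row 1 v *m J p).

Definition endo_form (J : M -> 'M[R]_n) (psi : M -> 'rV[R]_n -> R)
    (p : M) (x : 'rV[R]_n) : R :=
  psi p (x *m J p).

(* A connection is given by its covariant derivatives [nabla p v X] at p, along
   v in T_pM, of the vector fields X that are smooth on a neighbourhood of p;
   its values on other X are irrelevant. No locality axiom is needed: the
   Leibniz rule with f the indicator function of a neighbourhood of p (which
   is smooth near p) shows that [nabla p v X] only depends on the germ of X at
   p. *)
Definition connection (nabla : M -> 'rV[R]_n -> (M -> 'rV[R]_n) -> 'rV[R]_n) :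
    Prop :=
  [/\ forall p X, smooth_vf_near p X -> forall (c : R) u v,
        nabla p (c *: u + v) X = c *: nabla p u X + nabla p v X,
      forall p v X Y, smooth_vf_near p X -> smooth_vf_near p Y ->
        nabla p v (fun q => X q + Y q) = nabla p v X + nabla p v Y,
      forall p v f X, smooth_fun_near p f -> smooth_vf_near p X ->
        nabla p v (fun q => f q *: X q) =
          dderiv p v f *: X p + f p *: nabla p v X
    & forall (U : set M) X Y, open U -> smooth_vf U X -> smooth_vf U Y ->
        smooth_vf U (fun p => nabla p (X p) Y)].

Definition same_connection
    (nabla nabla' : M -> 'rV[R]_n -> (M -> 'rV[R]_n) -> 'rV[R]_n) : Prop :=
  forall p v X, smooth_vf_near p X -> nabla p v X = nabla' p v X.

Definition torsion_free
    (nabla : M -> 'rV[R]_n -> (M -> 'rV[R]_n) -> 'rV[R]_n) : Prop :=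
  forall p X Y, smooth_vf_near p X -> smooth_vf_near p Y ->
    nabla p (X p) Y - nabla p (Y p) X = lie_bracket X Y p.

(* (nabla_v g)(Y, Z) *)
Definition cov_metric
    (nabla : M -> 'rV[R]_n -> (M -> 'rV[R]_n) -> 'rV[R]_n)
    (g : M -> 'M[R]_n) (p : M) (v : 'rV[R]_n) (Y Z : M -> 'rV[R]_n) : R :=
  dderiv p v (fun q => ip (g q) (Y q) (Z q))
    - ip (g p) (nabla p v Y) (Z p) - ip (g p) (Y p) (nabla p v Z).

(* nabla is a Weyl connection for g with associated 1-form phi *)
Definition weyl_with (g : M -> 'M[R]_n) (phi : M -> 'rV[R]_n -> R)
    (nabla : M -> 'rV[R]_n -> (M -> 'rV[R]_n) -> 'rV[R]_n) : Prop :=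
  [/\ connection nabla, torsion_free nabla, smooth_form (k := 1) phi &
      forall p v Y Z, smooth_vf_near p Y -> smooth_vf_near p Z ->
        cov_metric nabla g p v Y Z = - 2 * phi p v * ip (g p) (Y p) (Z p)].

Definition weyl_connection (g : M -> 'M[R]_n)
    (nabla : M -> 'rV[R]_n -> (M -> 'rV[R]_n) -> 'rV[R]_n) : Prop :=
  exists phi, weyl_with g phi nabla.

(* nabla J = 0 *)
Definition parallel (J : M -> 'M[R]_n)
    (nabla : M -> 'rV[R]_n -> (M -> 'rV[R]_n) -> 'rV[R]_n) : Prop :=
  forall p v Y, smooth_vf_near p Y ->
    nabla p v (app_endo J Y) - nabla p v Y *m J p = 0.

(* a Kaehler-Weyl connection if J^2 = -Id, a para-Kaehler-Weyl connection if
   J^2 = Id *)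
Definition kahler_weyl (g J : M -> 'M[R]_n)
    (nabla : M -> 'rV[R]_n -> (M -> 'rV[R]_n) -> 'rV[R]_n) : Prop :=
  weyl_connection g nabla /\ parallel J nabla.

End Manifold.

Section Dimension4.
Context {R : realType} {M : manifold R 4}.

Definition orientation (g J : M -> 'M[R]_4) (p : M) (v : 'M[R]_4) : R :=
  2^-1 * wedge_form (k := 2) (l := 2) (kahler_form g J p) (kahler_form g J p) v.

(* delta Omega = - * d * Omega *)
Definition codiff_kahler (g J : M -> 'M[R]_4) (p : M) (x : 'rV[R]_4) : R :=
  let mu := volume_form g (orientation g J) in
  - hodge (k := 3) (l := 1) g mu
      (ext_deriv (hodge (k := 2) (l := 2) g mu (kahler_form g J))) p x.

(* there is a unique (para-)Kaehler-Weyl connection, and phi is its associated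
   1-form *)
Definition unique_kahler_weyl (g J : M -> 'M[R]_4) (phi : M -> 'rV[R]_4 -> R) :
    Prop :=
  exists nabla, [/\ kahler_weyl g J nabla,
    (forall nabla', kahler_weyl g J nabla' -> same_connection nabla nabla')
    & weyl_with g phi nabla].

End Dimension4.

(* Main.v *)
Require Import Defs.
From mathcomp Require Import all_boot all_order all_algebra all_fingroup.
From mathcomp Require Import all_classical all_reals all_analysis.
From mathcomp Require Import ring lra.

Set Implicit Arguments.
Unset Strict Implicit.
Unset Printing Implicit Defensive.

Import Order.TTheory GRing.Theory Num.Theory numFieldNormedType.Exports.
Local Open Scope classical_set_scope.
Local Open Scope ring_scope.

(* Put kappa = 1 in the para-Hermitian and kappa = -1 in the (pseudo-)Hermitian
   case, so that J^2 = kappa and g(Jx, Jy) = - kappa g(x, y).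

   Uniqueness. If a Weyl connection with 1-form phi is parallel for J, then
   nabla Omega = - 2 phi (x) Omega, hence d Omega = - 2 phi /\ Omega as nabla is
   torsion free. Contracting with the inverse bivector of Omega gives
   - 2 (n - 2) phi in terms of d Omega, so phi is unique (and smooth), and the
   Koszul formula determines nabla from g and phi.

   Existence. In dimension 4 a form phi with d Omega = - 2 phi /\ Omega exists at
   every point. For the Weyl connection of phi, the Kobayashi-Nomizu identity
   expresses 2 g((nabla_x J)y, z) by d Omega(x, y, z), d Omega(x, Jy, Jz) and the
   Nijenhuis tensor, and the terms in phi cancel those in d Omega.

   Hodge star. In an orthogonal frame (b, Jb, c, Jc) one reads off
   star Omega = - kappa Omega, hence delta Omega = kappa (star (d Omega)), and that
   this is 2 phi o J; applying J gives phi = (kappa / 2) J delta Omega. *)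

(** * Smooth functions on open subsets of R^n *)

(** The chart [chart_at p] in which tangent vectors at [p] have their components may jump with [p],
    so nothing written in it is visibly smooth. Computations at [p] are made in that chart, where
    the change of components at [p] is the identity and fields with constant components commute.
    Smoothness is instead drawn from chart-free formulas (commutator of derivations, Koszul formula,
    invariant formula for the exterior derivative) read in a fixed chart. Adapted frames are
    likewise chosen point by point, without any continuity. The contraction that proves uniqueness
    of the Lee form also expresses it through smooth coordinate data, so J delta Omega is smooth
    because it is a Lee form, not because the star is shown to preserve smoothness. Only d (star
    Omega) needs more than one point; hence star Omega is first computed everywhere. As [hodge] is a
    choice, each of its values takes two proofs: the candidate satisfies the defining identity, and
    the wedge pairing is nondegenerate. *)

Section SmoothCalculus.
Context {R : realType}.

(** The difference [g - f] vanishes near x, so it is its value plus the zero map plus a little-o,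
    hence differentiable. This allows functions that are only controlled on an open set to be
    exchanged there. *)
Lemma near_eq_differentiable (V W : normedModType R) (f g : V -> W) x :
  (\near x, f x = g x) -> differentiable f x -> differentiable g x.
Proof.
move=> fg df; have -> : g = f + (g - f) by rewrite addrC subrK.
apply: differentiableD => //; set h := g - f.
have h0 : \near x, h x = 0.
  by apply: filterS fg => y; rewrite /h !fctE => ->; rewrite subrr.
have hE : h \o shift x = cst (h x) + (\0 : {linear V -> W}) +o_0 id.
  apply/eqaddoP => e e0; rewrite (nbhs_singleton h0).
  have : \forall y \near (0 : V), h (y + x) = 0.
    by move: h0; rewrite (near_shift 0) subr0.
  apply: filterS => y hy.
  by rewrite !fctE /= hy addr0 subr0 normr0 mulr_ge0// ltW.
have c0 : continuous (\0 : {linear V -> W}) by move=> y; apply: cst_continuous.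
by apply/diff_locallyP; rewrite (diff_unique c0 hE).
Qed.

Lemma differentiable_mx (V : normedModType R) m k (F : V -> 'M[R]_(m, k)) x :
  (forall i j, differentiable (fun y => F y i j) x) -> differentiable F x.
Proof.
move=> dF.
have -> : F = \sum_(i < m) \sum_(j < k) (fun y => F y i j *: delta_mx i j).
  apply/funext => y; rewrite fct_sumE [LHS]matrix_sum_delta.
  by apply: eq_bigr => i _; rewrite fct_sumE.
apply: differentiable_sum => i; apply: differentiable_sum => j.
exact: differentiableZl.
Qed.

Lemma differentiable_entry (V : normedModType R) m k (F : V -> 'M[R]_(m, k)) x
  i j : differentiable F x -> differentiable (fun y => F y i j) x.
Proof.
move=> dF; apply: (@differentiable_comp _ _ _ _ F (fun A => A i j)) => //.
exact: differentiable_coord.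
Qed.

Lemma derive_entry (V : normedModType R) m k (F : V -> 'M[R]_(m, k)) x v i j :
  differentiable F x -> ('D_v F x) i j = 'D_v (fun y => F y i j) x.
Proof. by move=> dF; rewrite derive_mx ?mxE//; exact: diff_derivable. Qed.

Lemma derive_rV n (W : normedModType R) (f : 'rV[R]_n -> W) x v :
  differentiable f x -> 'D_v f x = \sum_a v 0 a *: 'D_(delta_mx 0 a) f x.
Proof.
move=> df; rewrite deriveE// {1}(row_sum_delta v) linear_sum.
by apply: eq_bigr => a _; rewrite linearZ /= deriveE.
Qed.

Lemma derive_comp_rV n m (W : normedModType R) (h : 'rV[R]_m -> W)
    (F : 'rV[R]_n -> 'rV[R]_m) x v :
  differentiable F x -> differentiable h (F x) ->
  'D_v (h \o F) x = 'D_('D_v F x) h (F x).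
Proof.
move=> dF dh; rewrite deriveE; last exact: differentiable_comp.
by rewrite diff_comp //= -deriveE// -deriveE.
Qed.

Section SmoothOn.
Context {n : nat}.
Implicit Types U : set 'rV[R]_n.

Lemma open_near U (P : 'rV[R]_n -> Prop) x :
  open U -> U x -> (forall y, U y -> P y) -> \near x, P x.
Proof.
by move=> oU Ux UP; apply: filterS UP _; apply: open_nbhs_nbhs.
Qed.

Lemma iter_partial_eq (W : normedModType R) U (f g : 'rV[R]_n -> W) :
  open U -> (forall x, U x -> f x = g x) ->
  forall s x, U x -> iter_partial s f x = iter_partial s g x.
Proof.
move=> oU fg; elim=> [|a s IH] x Ux /=; first exact: fg.
exact/near_eq_derive/(open_near oU Ux IH).
Qed.

(** [iter_partial] exposes the outermost derivative; closure arguments need the innermost one. *)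
Lemma iter_partial_rcons (W : normedModType R) s a (f : 'rV[R]_n -> W) :
  iter_partial (rcons s a) f = iter_partial s ('D_(delta_mx 0 a) f).
Proof. by elim: s => //= b s ->. Qed.

Lemma smooth_on_eq (W : normedModType R) U (f g : 'rV[R]_n -> W) :
  open U -> (forall x, U x -> f x = g x) -> smooth_on U f -> smooth_on U g.
Proof.
move=> oU fg sf s x Ux; apply: near_eq_differentiable (sf s x Ux).
exact/(open_near oU Ux)/iter_partial_eq.
Qed.

(** The induction removes the innermost derivative, because the closure of [P] concerns first
    derivatives of its members. Agreement with a member on U is enough, as U is open. *)
Lemma smooth_on_coind (W : normedModType R) U (P : ('rV[R]_n -> W) -> Prop) :
  open U ->
  (forall f x, P f -> U x -> differentiable f x) ->
  (forall f a, P f ->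
    exists2 g, P g & forall x, U x -> 'D_(delta_mx 0 a) f x = g x) ->
  forall f, P f -> smooth_on U f.
Proof.
move=> oU Pd PD f Pf s; elim/last_ind: s f Pf => [|s a IH] f Pf x Ux.
  exact: Pd.
rewrite iter_partial_rcons; have [g Pg Dg] := PD f a Pf.
apply: near_eq_differentiable (IH g Pg x Ux).
by apply/(open_near oU Ux) => y Uy; apply/esym/iter_partial_eq/Uy.
Qed.

Lemma smooth_on_differentiable (W : normedModType R) U (f : 'rV[R]_n -> W) x :
  smooth_on U f -> U x -> differentiable f x.
Proof. by move=> sf Ux; apply: (sf [::]). Qed.

Lemma smooth_on_partial (W : normedModType R) U (f : 'rV[R]_n -> W) a :
  smooth_on U f -> smooth_on U ('D_(delta_mx 0 a) f).
Proof. by move=> sf s; rewrite -iter_partial_rcons; apply: sf. Qed.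

Lemma smooth_onS (W : normedModType R) U U' (f : 'rV[R]_n -> W) :
  U' `<=` U -> smooth_on U f -> smooth_on U' f.
Proof. by move=> sU sf s x /sU; apply: sf. Qed.

Lemma smooth_on_cst (W : normedModType R) U (c : W) :
  open U -> smooth_on U (fun=> c).
Proof.
move=> oU; apply: (@smooth_on_coind _ _ (fun f => exists c, f = fun=> c)) => //.
- by move=> f x [d ->] _; apply: differentiable_cst.
- move=> f a [d ->]; exists (fun=> 0); first by exists 0.
  by move=> x _; apply: derive_cst.
- by exists c.
Qed.

End SmoothOn.

Section SmoothExpr.
Context {n : nat}.
Implicit Types U : set 'rV[R]_n.

(* One coinduction on this class gives all the closure properties of smooth
   functions at once: its members are differentiable and their partial
   derivatives are members again. *)
Inductive smooth_expr U : ('rV[R]_n -> R) -> Prop :=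
| smooth_base f : smooth_on U f -> smooth_expr U f
| smooth_add f g : smooth_expr U f -> smooth_expr U g ->
    smooth_expr U (fun x => f x + g x)
| smooth_mul f g : smooth_expr U f -> smooth_expr U g ->
    smooth_expr U (fun x => f x * g x)
| smooth_inv f : smooth_expr U f -> (forall x, U x -> f x != 0) ->
    smooth_expr U (fun x => (f x)^-1).

Lemma smooth_expr_differentiable U f x :
  smooth_expr U f -> U x -> differentiable f x.
Proof.
move=> sf Ux; elim: sf => {f}.
- by move=> f /smooth_on_differentiable; apply.
- by move=> f g _ df _ dg; apply: (differentiableD df dg).
- by move=> f g _ df _ dg; apply: (differentiableM df dg).
- by move=> f _ df f0; apply: (differentiableV df (f0 _ Ux)).
Qed.

Lemma smooth_expr_partial U f a : open U -> smooth_expr U f ->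
  exists2 g, smooth_expr U g & forall x, U x -> 'D_(delta_mx 0 a) f x = g x.
Proof.
move=> oU; have D := fun f x sf Ux => diff_derivable
  (@smooth_expr_differentiable U f x sf Ux).
elim=> {f}.
- move=> f sf; exists ('D_(delta_mx 0 a) f) => //.
  exact/smooth_base/smooth_on_partial.
- move=> f g sf [f' sf' Df] sg [g' sg' Dg].
  exists (fun x => f' x + g' x); first exact: smooth_add.
  move=> x Ux; rewrite -Df// -Dg// -deriveD//; exact: D.
- move=> f g sf [f' sf' Df] sg [g' sg' Dg].
  exists (fun x => f x * g' x + g x * f' x).
    by apply: smooth_add; apply: smooth_mul.
  move=> x Ux; rewrite -Df// -Dg// -[f x * _]/(f x *: _) -[g x * _]/(g x *: _).
  rewrite -deriveM//; exact: D.
- move=> f sf [f' sf' Df] f0.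
  exists (fun x => -1 * ((f x)^-1 * (f x)^-1) * f' x).
    apply: smooth_mul => //; apply: smooth_mul.
      exact/smooth_base/smooth_on_cst.
    by apply: smooth_mul; apply: smooth_inv.
  move=> x Ux; rewrite -Df// (@deriveV _ _ f) ?f0//; last exact: D.
  by rewrite mulN1r -expr2 exprVn.
Qed.

Lemma smooth_exprP U f : open U -> smooth_expr U f <-> smooth_on U f.
Proof.
move=> oU; split; last exact: smooth_base.
apply: (smooth_on_coind oU).
  by move=> g x; apply: smooth_expr_differentiable.
by move=> g a; apply: smooth_expr_partial.
Qed.

(** Both claims go through one induction: a matrix function may be differentiated entrywise once it
    is known to be differentiable, and this in turn is read off its entries. *)
Lemma iter_partial_entry U m k (F : 'rV[R]_n -> 'M[R]_(m, k)) s : open U ->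
  (forall i j, smooth_on U (fun x => F x i j)) -> forall x, U x ->
  differentiable (iter_partial s F) x /\
  forall i j, iter_partial s F x i j = iter_partial s (fun x => F x i j) x.
Proof.
move=> oU sF; elim: s => [|a s IH] x Ux /=.
  by split=> //; apply: differentiable_mx => i j; exact: (sF i j [::]).
have E y (Uy : U y) i j : 'D_(delta_mx 0 a) (iter_partial s F) y i j =
    'D_(delta_mx 0 a) (iter_partial s (fun x => F x i j)) y.
  rewrite derive_entry; last by case: (IH _ Uy).
  by apply/near_eq_derive/(open_near oU Uy) => z /IH[].
split; last exact: E.
apply: differentiable_mx => i j.
apply: near_eq_differentiable (sF i j (a :: s) x Ux).
by apply/(open_near oU Ux) => z Uz; rewrite /= E.
Qed.

Lemma smooth_on_mxP U m k (F : 'rV[R]_n -> 'M[R]_(m, k)) : open U ->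
  smooth_on U F <-> forall i j, smooth_on U (fun x => F x i j).
Proof.
move=> oU; split=> sF.
  move=> i j s; elim: {s}(s) {-2}s (erefl s) => [|a s IH] t -> x Ux.
    exact: differentiable_entry (sF [::] x Ux).
  have H y (Uy : U y) : forall t, iter_partial t (fun x => F x i j) y =
      iter_partial t F y i j.
    move=> t'; elim: t' y Uy => //= b t' IHt y Uy.
    rewrite derive_entry; last exact: sF.
    by apply/near_eq_derive/(open_near oU Uy).
  have := differentiable_entry i j (sF (a :: s) x Ux).
  apply: near_eq_differentiable.
  by apply/(open_near oU Ux) => z Uz; rewrite H.
by move=> s x Ux; have [] := iter_partial_entry s oU sF Ux.
Qed.

End SmoothExpr.
End SmoothCalculus.

Section SmoothClosure.
Context {R : realType} {n : nat}.
Implicit Types (U : set 'rV[R]_n) (f g : 'rV[R]_n -> R).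

Lemma smooth_onD U f g : open U -> smooth_on U f -> smooth_on U g ->
  smooth_on U (fun x => f x + g x).
Proof.
by move=> oU sf sg; apply/smooth_exprP => //; apply: smooth_add; exact/smooth_exprP.
Qed.

Lemma smooth_onM U f g : open U -> smooth_on U f -> smooth_on U g ->
  smooth_on U (fun x => f x * g x).
Proof.
by move=> oU sf sg; apply/smooth_exprP => //; apply: smooth_mul; exact/smooth_exprP.
Qed.

Lemma smooth_onV U f : open U -> smooth_on U f -> (forall x, U x -> f x != 0) ->
  smooth_on U (fun x => (f x)^-1).
Proof.
by move=> oU sf f0; apply/smooth_exprP => //; apply: smooth_inv => //;
  exact/smooth_exprP.
Qed.

Lemma smooth_onZ U c f : open U -> smooth_on U f -> smooth_on U (fun x => c * f x).
Proof. by move=> oU; apply: smooth_onM => //; apply: smooth_on_cst. Qed.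

Lemma smooth_onN U f : open U -> smooth_on U f -> smooth_on U (fun x => - f x).
Proof.
by move=> oU /(smooth_onZ (-1) oU); under eq_fun do rewrite mulN1r.
Qed.

Lemma smooth_onB U f g : open U -> smooth_on U f -> smooth_on U g ->
  smooth_on U (fun x => f x - g x).
Proof. by move=> oU sf sg; apply: smooth_onD => //; apply: smooth_onN. Qed.

Lemma smooth_on_sum U (I : Type) (r : seq I) (f : I -> 'rV[R]_n -> R) : open U ->
  (forall i, smooth_on U (f i)) -> smooth_on U (fun x => \sum_(i <- r) f i x).
Proof.
move=> oU sf; elim: r => [|i r IH].
  by under eq_fun do rewrite big_nil; apply: smooth_on_cst.
by under eq_fun do rewrite big_cons; apply: smooth_onD.
Qed.

Lemma smooth_on_prod U (I : Type) (r : seq I) (f : I -> 'rV[R]_n -> R) : open U ->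
  (forall i, smooth_on U (f i)) -> smooth_on U (fun x => \prod_(i <- r) f i x).
Proof.
move=> oU sf; elim: r => [|i r IH].
  by under eq_fun do rewrite big_nil; apply: smooth_on_cst.
by under eq_fun do rewrite big_cons; apply: smooth_onM.
Qed.

Lemma smooth_on_mulmx U m k l (F : 'rV[R]_n -> 'M[R]_(m, k))
    (G : 'rV[R]_n -> 'M[R]_(k, l)) :
  open U -> smooth_on U F -> smooth_on U G -> smooth_on U (fun x => F x *m G x).
Proof.
move=> oU /(smooth_on_mxP _ oU) sF /(smooth_on_mxP _ oU) sG.
apply/smooth_on_mxP => // i j; under eq_fun do rewrite mxE.
by apply: smooth_on_sum => // a; apply: smooth_onM.
Qed.

Lemma smooth_on_tr U m k (F : 'rV[R]_n -> 'M[R]_(m, k)) :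
  open U -> smooth_on U F -> smooth_on U (fun x => (F x)^T).
Proof.
move=> oU /(smooth_on_mxP _ oU) sF.
apply/smooth_on_mxP => // i j; under eq_fun do rewrite mxE.
exact: sF.
Qed.

Lemma smooth_on_det U m (F : 'rV[R]_n -> 'M[R]_m) :
  open U -> smooth_on U F -> smooth_on U (fun x => \det (F x)).
Proof.
move=> oU /(smooth_on_mxP _ oU) sF; rewrite /determinant.
apply: smooth_on_sum => // s.
by apply: smooth_onZ => //; apply: smooth_on_prod.
Qed.

Lemma smooth_on_invmx U m (F : 'rV[R]_n -> 'M[R]_m) :
  open U -> smooth_on U F -> (forall x, U x -> F x \in unitmx) ->
  smooth_on U (fun x => invmx (F x)).
Proof.
(* Cramer's formula, which [invmx] follows at invertible matrices only; hence the passage through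
   equality on U. *)
move=> oU sF F1; apply: (@smooth_on_eq _ _ _ _
  (fun x => \matrix_(i, j) ((\det (F x))^-1 * cofactor (F x) j i))) => //.
  by move=> x Ux; rewrite /invmx F1//; apply/matrixP => i j; rewrite !mxE.
apply/smooth_on_mxP => // i j; under eq_fun do rewrite mxE.
apply: smooth_onM => //.
  apply: smooth_onV => //; first exact: smooth_on_det.
  by move=> x /F1; rewrite unitmxE unitfE.
apply: smooth_onZ => //; apply: smooth_on_det => //.
move/(smooth_on_mxP _ oU): sF => sF.
apply/smooth_on_mxP => // a b; under eq_fun do rewrite !mxE.
exact: sF.
Qed.

(** * Symmetry of second derivatives *)

Lemma is_derive_line (W : normedModType R) (f : 'rV[R]_n -> W) p u (s : R) :
  differentiable f (p + s *: u) ->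
  is_derive s 1 (fun t => f (p + t *: u)) ('D_u f (p + s *: u)).
Proof.
move=> df.
have E : (fun h : R => h^-1 *: (((fun t => f (p + t *: u)) \o shift s) (h *: (1 : R))
    - f (p + s *: u))) =
  (fun h => h^-1 *: ((f \o shift (p + s *: u)) (h *: u) - f (p + s *: u))).
  apply/funext => h /=; congr (_ *: (f _ - _)).
  by rewrite [h *: _]mulr1; apply/rowP => a; rewrite !mxE; ring.
apply: DeriveDef; rewrite /derivable /derive E //.
exact: diff_derivable df.
Qed.

Let second_difference f x u v (h : R) : R :=
  f (x + h *: u + h *: v) - f (x + h *: u) - f (x + h *: v) + f x.

(** Young's argument: the mean value theorem in direction u turns the second difference into h times
    a difference of two values of ['D_u f] near x, and each value is replaced by its first-order
    expansion at x. *)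
Lemma second_difference_derive U f x u v : open U -> U x ->
  (forall y, U y -> differentiable f y) -> differentiable ('D_u f) x ->
  forall e, 0 < e -> exists2 d, 0 < d & forall h, 0 < h < d ->
    `|second_difference f x u v h - h ^+ 2 * 'D_v ('D_u f) x| <= e * h ^+ 2.
Proof.
(* The two points are displaced from x by at most h(|u| + |v|) and h|u|, so the two errors add up to
   at most (e / C) h (2|u| + |v|). The summand 1 makes C positive. *)
move=> oU Ux df dfu e e0; set C := 2 * `|u| + `|v| + 1.
have C0 : 0 < C by rewrite /C ltr_wpDl// addr_ge0// mulr_ge0.
have eC : 0 < e / C by rewrite divr_gt0.
have near1 : \forall k \near (0 : 'rV[R]_n),
    `|'D_u f (k + x) - 'D_u f x - 'd ('D_u f) x k| <= e / C * `|k|.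
  have /eqaddoP/(_ _ eC) := diff_locally dfu.
  by apply: filterS => k; rewrite !fctE /= opprD addrA.
have near2 : \forall k \near (0 : 'rV[R]_n), U (k + x).
  have : \near x, U x by exact: open_nbhs_nbhs.
  by rewrite (near_shift 0) subr0.
have : nbhs (0 : 'rV[R]_n) [set k | U (k + x) /\
    `|'D_u f (k + x) - 'D_u f x - 'd ('D_u f) x k| <= e / C * `|k|].
  exact: filterI near2 near1.
move/nbhs_ballP => [r /= r0 Hr].
have expand k : `|k| < r -> U (k + x) /\
    `|'D_u f (k + x) - 'D_u f x - 'd ('D_u f) x k| <= e / C * `|k|.
  by move=> kr; apply: Hr; rewrite -ball_normE /= sub0r normrN.
exists (r / C); first by rewrite divr_gt0.
move=> h /andP[h0 hr].
have hC : h * C < r by rewrite -ltr_pdivlMr.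
have bound s : 0 <= s <= h ->
    `|s *: u| <= h * `|u| /\ `|s *: u + h *: v| <= h * (`|u| + `|v|).
  move=> /andP[s0 sh]; rewrite normrZ ger0_norm//.
  have su : s * `|u| <= h * `|u| by rewrite ler_wpM2r.
  split=> //; rewrite (le_trans (ler_normD _ _))// !normrZ !ger0_norm ?(ltW h0)//.
  by rewrite mulrDr lerD2r.
have small s : 0 <= s <= h -> `|s *: u| < r /\ `|s *: u + h *: v| < r.
  move=> sh; have [b1 b2] := bound s sh; split.
    by rewrite (le_lt_trans b1)// (le_lt_trans _ hC)// ler_pM2l// /C;
      have := normr_ge0 u; have := normr_ge0 v; lra.
  by rewrite (le_lt_trans b2)// (le_lt_trans _ hC)// ler_pM2l// /C;
    have := normr_ge0 u; have := normr_ge0 v; lra.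
(* [G] compares f on two parallel segments in direction u; [G h - G 0] is the second difference. *)
pose G s := f ((x + h *: v) + s *: u) - f (x + s *: u).
pose G' s := 'D_u f ((x + h *: v) + s *: u) - 'D_u f (x + s *: u).
have dG s : 0 <= s <= h -> is_derive s 1 G (G' s).
  move=> sh; have [s1 s2] := small s sh.
  have [U1 _] := expand _ s1; have [U2 _] := expand _ s2.
  apply: is_deriveB; apply: is_derive_line; apply: df.
    by rewrite addrAC -addrA addrC.
  by rewrite addrC.
have [| |c chi Gc] := @MVT_segment _ G G' 0 h (ltW h0).
- by move=> s; rewrite in_itv /= => /andP[s0 sh]; apply: dG; rewrite !ltW.
- apply: continuous_in_subspaceT => s; rewrite inE /= in_itv /= => sh.
  by apply/differentiable_continuous/derivable1_diffP; case: (dG s sh).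
have ch : 0 <= c <= h by move: chi; rewrite in_itv.
have -> : second_difference f x u v h = G' c * h.
  rewrite -{2}(subr0 h) -Gc /G /second_difference !scale0r !addr0.
  by rewrite [x + h *: v + _]addrAC opprB addrA addrAC.
have [s1 s2] := small c ch; have [b1 b2] := bound c ch.
have [_ e1] := expand _ s1; have [_ e2] := expand _ s2.
rewrite deriveE//; set L := 'd ('D_u f) x v.
have -> : G' c * h - h ^+ 2 * L = h * (G' c - h * L) by ring.
rewrite normrM (gtr0_norm h0) expr2 [leRHS]mulrCA ler_pM2l// {}/L.
have -> : G' c - h * 'd ('D_u f) x v =
  ('D_u f (c *: u + h *: v + x) - 'D_u f x - 'd ('D_u f) x (c *: u + h *: v))
  - ('D_u f (c *: u + x) - 'D_u f x - 'd ('D_u f) x (c *: u)).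
  rewrite /G' [x + c *: u]addrC.
  have -> : x + h *: v + c *: u = c *: u + h *: v + x.
    by apply/rowP => a; rewrite !mxE; ring.
  rewrite [in 'd _ _ (c *: u + _)]linearD /= [in 'd _ _ (h *: v)]linearZ /=.
  by rewrite -[h *: 'd _ _ _]/(h * _); ring.
rewrite (le_trans (ler_normB _ _))// (le_trans (lerD e2 e1))//.
rewrite -mulrDr -mulrA ler_pM2l// ler_pdivrMl//.
rewrite (le_trans (lerD b2 b1))// [C * h]mulrC -mulrDr ler_pM2l// /C; lra.
Qed.

(** The second difference is symmetric in u and v, so h^2 times either mixed derivative is within (e
    / 2) h^2 of the same number. *)
Lemma derive_commute U f x u v : open U -> U x ->
  (forall y, U y -> differentiable f y) ->
  differentiable ('D_u f) x -> differentiable ('D_v f) x ->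
  'D_v ('D_u f) x = 'D_u ('D_v f) x.
Proof.
move=> oU Ux df dfu dfv; apply/eqP; rewrite -subr_eq0 -normr_le0.
apply/ler_addgt0Pr => e e0; rewrite add0r.
have e20 : 0 < e / 2 by rewrite divr_gt0.
have [d1 d10 H1] := second_difference_derive v oU Ux df dfu e20.
have [d2 d20 H2] := second_difference_derive u oU Ux df dfv e20.
pose h := Num.min d1 d2 / 2.
have m0 : 0 < Num.min d1 d2 by rewrite lt_min d10.
have h0 : 0 < h by rewrite divr_gt0.
have hm : h < Num.min d1 d2 by rewrite /h; move: (Num.min d1 d2) m0 => m m0; lra.
have [hd1 hd2] : h < d1 /\ h < d2 by move: hm; rewrite lt_min => /andP[].
have := H1 h; rewrite h0 hd1 => /(_ isT) {}H1.
have := H2 h; rewrite h0 hd2 => /(_ isT) {}H2.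
have E : second_difference f x v u h = second_difference f x u v h.
  by rewrite /second_difference [x + h *: v + _]addrAC; ring.
rewrite E in H2.
have h20 : 0 < h ^+ 2 by rewrite exprn_gt0.
rewrite -(ler_pM2l h20) -[h ^+ 2 in leLHS](gtr0_norm h20) -normrM.
move: (second_difference f x u v h) ('D_v ('D_u f) x) ('D_u ('D_v f) x) H1 H2.
move=> D A B H1 H2.
have -> : h ^+ 2 * (A - B) = (D - h ^+ 2 * B) - (D - h ^+ 2 * A) by ring.
rewrite (le_trans (ler_normB _ _))// (le_trans (lerD H2 H1))//.
by rewrite -mulrDl -splitr mulrC.
Qed.

End SmoothClosure.

(** * Directional derivatives and brackets on manifolds *)

Section ManifoldCalculus.
Context {R : realType} {n : nat} {M : manifold R n}.
Implicit Types (U : set M) (X Y Z : M -> 'rV[R]_n) (f h : M -> R) (p q : M).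
Implicit Types (i j k c : chart M).

Definition chart_image i U := chart_map i @` (U `&` chart_dom i).

Lemma chart_at_dom p : chart_dom (chart_at p) p.
Proof. by rewrite /chart_at; case: cid. Qed.

Lemma mem_chart_image i U p : U p -> chart_dom i p -> chart_image i U (chart_map i p).
Proof. by move=> Up ip; exists p. Qed.

Lemma chart_imageP i U x : chart_image i U x ->
  [/\ U (chart_inv i x), chart_dom i (chart_inv i x)
    & chart_map i (chart_inv i x) = x].
Proof. by case=> p [Up ip] <-; rewrite chart_mapK. Qed.

Lemma open_chart_image i U : open U -> open (chart_image i U).
Proof.
move=> oU; rewrite openE => _ [p [Up ip] <-].
have dx : (chart_map i @` chart_dom i) (chart_map i p) by exists p.
have n1 : nbhs (chart_map i p) (chart_map i @` chart_dom i).
  exact: open_nbhs_nbhs (conj (@chart_map_open _ _ _ i) dx).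
have n2 : nbhs (chart_map i p) (chart_inv i @^-1` (U `&` chart_dom i)).
  apply: (chart_inv_continuous dx); rewrite chart_mapK//.
  by apply: open_nbhs_nbhs; split=> //; apply: openI => //; exact: chart_dom_open.
apply: filterS (filterI n1 n2) => y [[q iq <-]] /=.
by rewrite chart_mapK// => Uq; exists q.
Qed.

Definition transition_jac i j p : 'M[R]_n :=
  'J (chart_map j \o chart_inv i) (chart_map i p).

Lemma smooth_transition i j :
  smooth_on (chart_image i (chart_dom j)) (chart_map j \o chart_inv i).
Proof. by rewrite /chart_image setIC; apply: transition_smooth. Qed.

Arguments smooth_transition : clear implicits.

Local Opaque derive jacobian.

Lemma differentiable_transition i j p : chart_dom i p -> chart_dom j p ->
  differentiable (chart_map j \o chart_inv i) (chart_map i p).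
Proof.
move=> ip jp; apply: (smooth_on_differentiable (smooth_transition i j)).
exact: mem_chart_image.
Qed.

Lemma derive_transition i j p v : chart_dom i p -> chart_dom j p ->
  'D_v (chart_map j \o chart_inv i) (chart_map i p) = v *m transition_jac i j p.
Proof.
by move=> ip jp; rewrite deriveEjacobian//; apply: differentiable_transition.
Qed.

Lemma near_chart_image i U p (P : 'rV[R]_n -> Prop) : open U -> U p ->
  chart_dom i p -> (forall q, U q -> chart_dom i q -> P (chart_map i q)) ->
  \forall x \near chart_map i p, P x.
Proof.
move=> oU Up ip UP; apply: (open_near (open_chart_image (i := i) oU)).
  exact: mem_chart_image.
by move=> _ [q [Uq iq] <-]; apply: UP.
Qed.

Lemma derive_change_chart (W : normedModType R) i j p v (F : M -> W) :
  chart_dom i p -> chart_dom j p ->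
  differentiable (F \o chart_inv j) (chart_map j p) ->
  'D_v (F \o chart_inv i) (chart_map i p) =
  'D_(v *m transition_jac i j p) (F \o chart_inv j) (chart_map j p).
Proof.
move=> ip jp dF; rewrite -derive_transition//.
have E : (chart_map j \o chart_inv i) (chart_map i p) = chart_map j p.
  by rewrite /= chart_mapK.
rewrite -E -[RHS](derive_comp_rV (h := F \o chart_inv j)); last 2 first.
- exact: differentiable_transition.
- by rewrite E.
apply/near_eq_derive/(near_chart_image (@chart_dom_open _ _ _ j) jp ip).
by move=> q jq iq /=; rewrite !(chart_mapK iq) (chart_mapK jq).
Qed.

Lemma transition_jac_comp i j k p :
  chart_dom i p -> chart_dom j p -> chart_dom k p ->
  transition_jac i j p *m transition_jac j k p = transition_jac i k p.
Proof.
move=> ip jp kp; apply/row_matrixP => a; rewrite !rowE mulmxA.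
rewrite -[LHS](derive_transition _ jp kp) -[RHS](derive_transition _ ip kp).
apply/esym/(@derive_change_chart _ i j p _ (chart_map k)) => //.
exact: differentiable_transition.
Qed.

Lemma transition_jac_id i p : chart_dom i p -> transition_jac i i p = 1%:M.
Proof.
move=> ip; apply/row_matrixP => a; rewrite !rowE mulmx1.
rewrite -[LHS](derive_transition _ ip ip) -[RHS](derive_id (chart_map i p)).
apply/near_eq_derive/(near_chart_image openT (I : setT p) ip).
by move=> q _ iq /=; rewrite chart_mapK.
Qed.

Lemma smooth_transition_jac i j :
  smooth_on (chart_image i (chart_dom j)) (fun x => transition_jac i j (chart_inv i x)).
Proof.
have oU := open_chart_image (i := i) (@chart_dom_open _ _ _ j).
apply/smooth_on_mxP => // a b.
have := smooth_on_partial a ((smooth_on_mxP _ oU).1 (smooth_transition i j) 0 b).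
apply: (smooth_on_eq oU) => x /chart_imageP[jx ix ex].
rewrite -derive_entry; last first.
  by rewrite -ex; apply: differentiable_transition.
by rewrite -{1}ex derive_transition// -rowE mxE.
Qed.

Lemma to_chartE i p : to_chart i p = transition_jac (chart_at p) i p.
Proof. by []. Qed.

Lemma to_from_chart i p : chart_dom i p -> to_chart i p *m from_chart i p = 1%:M.
Proof.
move=> ip; have cp := chart_at_dom p.
by rewrite transition_jac_comp// transition_jac_id.
Qed.

Lemma from_to_chart i j p : chart_dom i p -> chart_dom j p ->
  from_chart i p *m to_chart j p = transition_jac i j p.
Proof. by move=> ip jp; apply: transition_jac_comp => //; apply: chart_at_dom. Qed.

Lemma from_to_chart_id i p : chart_dom i p -> from_chart i p *m to_chart i p = 1%:M.
Proof. by move=> ip; rewrite from_to_chart// transition_jac_id. Qed.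

Lemma from_chart_at p : from_chart (chart_at p) p = 1%:M.
Proof. exact/transition_jac_id/chart_at_dom. Qed.

Lemma to_chart_at p : to_chart (chart_at p) p = 1%:M.
Proof. exact/transition_jac_id/chart_at_dom. Qed.

Lemma chart_components_map i X p : chart_dom i p ->
  chart_components i X (chart_map i p) = X p *m to_chart i p.
Proof. by move=> ip; rewrite /chart_components chart_mapK. Qed.

Lemma chart_componentsK i X p : chart_dom i p ->
  chart_components i X (chart_map i p) *m from_chart i p = X p.
Proof.
by move=> ip; rewrite chart_components_map// -mulmxA to_from_chart ?mulmx1.
Qed.

Lemma chart_components_at X p :
  chart_components (chart_at p) X (chart_map (chart_at p) p) = X p.
Proof. by rewrite chart_components_map ?to_chart_at ?mulmx1//; apply: chart_at_dom. Qed.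

Lemma chart_imageS i U U' : U `<=` U' -> chart_image i U `<=` chart_image i U'.
Proof. by move=> sU _ [p [/sU Up ip] <-]; exists p. Qed.

Lemma smooth_funS U U' f : U `<=` U' -> smooth_fun U' f -> smooth_fun U f.
Proof. by move=> sU sf i; apply: smooth_onS (sf i); apply: chart_imageS. Qed.

Lemma smooth_vfS U U' X : U `<=` U' -> smooth_vf U' X -> smooth_vf U X.
Proof. by move=> sU sf i; apply: smooth_onS (sf i); apply: chart_imageS. Qed.

Lemma smooth_fun_eq U f h : open U -> (forall p, U p -> f p = h p) ->
  smooth_fun U f -> smooth_fun U h.
Proof.
move=> oU fh sf i; apply: smooth_on_eq (sf i); first exact: open_chart_image.
by move=> x /chart_imageP[Ux _ _]; apply: fh.
Qed.

Lemma smooth_fun_differentiable U f i p : smooth_fun U f -> U p -> chart_dom i p ->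
  differentiable (f \o chart_inv i) (chart_map i p).
Proof.
move=> sf Up ip; apply: (smooth_on_differentiable (sf i)).
exact: mem_chart_image.
Qed.

Lemma smooth_vf_differentiable U X i p : smooth_vf U X -> U p -> chart_dom i p ->
  differentiable (chart_components i X) (chart_map i p).
Proof.
move=> sf Up ip; apply: (smooth_on_differentiable (sf i)).
exact: mem_chart_image.
Qed.

Section FunctionAlgebra.
Variables (U : set M).
Hypothesis oU : open U.
Let oI i := open_chart_image (i := i) oU.

Lemma smooth_fun_cst (a : R) : smooth_fun U (fun=> a).
Proof. by move=> i; apply: smooth_on_cst; exact: oI. Qed.

Lemma smooth_funD f h : smooth_fun U f -> smooth_fun U h ->
  smooth_fun U (fun p => f p + h p).
Proof. by move=> sf sh i; apply: smooth_onD (sf i) (sh i); exact: oI. Qed.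

Lemma smooth_funM f h : smooth_fun U f -> smooth_fun U h ->
  smooth_fun U (fun p => f p * h p).
Proof. by move=> sf sh i; apply: smooth_onM (sf i) (sh i); exact: oI. Qed.

Lemma smooth_funB f h : smooth_fun U f -> smooth_fun U h ->
  smooth_fun U (fun p => f p - h p).
Proof. by move=> sf sh i; apply: smooth_onB (sf i) (sh i); exact: oI. Qed.

Lemma smooth_funZ a f : smooth_fun U f -> smooth_fun U (fun p => a * f p).
Proof. by move=> sf i; apply: smooth_onZ (sf i); exact: oI. Qed.

Lemma smooth_fun_sum (I : Type) (r : seq I) (F : I -> M -> R) :
  (forall a, smooth_fun U (F a)) -> smooth_fun U (fun p => \sum_(a <- r) F a p).
Proof.
move=> sF i.
apply: (@smooth_on_sum _ _ _ _ r (fun a x => F a (chart_inv i x))) => [|a].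
  exact: oI.
exact: sF.
Qed.

End FunctionAlgebra.

Lemma dderiv_chart U f i p v : smooth_fun U f -> U p -> chart_dom i p ->
  dderiv p v f = 'D_(v *m to_chart i p) (f \o chart_inv i) (chart_map i p).
Proof.
move=> sf Up ip; apply: derive_change_chart => //; first exact: chart_at_dom.
exact: smooth_fun_differentiable sf Up ip.
Qed.

Lemma smooth_dderiv U X f : open U -> smooth_vf U X -> smooth_fun U f ->
  smooth_fun U (fun p => dderiv p (X p) f).
Proof.
move=> oU sX sf i; have oI := open_chart_image (i := i) oU.
apply: (@smooth_on_eq _ _ _ _ (fun x => \sum_a chart_components i X x 0 a *
    'D_(delta_mx 0 a) (f \o chart_inv i) x)) => //.
  move=> x /chart_imageP[Ux ix ex] /=.
  rewrite (dderiv_chart _ sf Ux ix) derive_rV; last first.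
    exact: smooth_fun_differentiable sf Ux ix.
  by rewrite ex.
apply: smooth_on_sum => // a; apply: smooth_onM => //.
  exact: (smooth_on_mxP _ oI).1 (sX i) 0 a.
exact/smooth_on_partial/sf.
Qed.

Definition chart_coord i (a : 'I_n) p : R := chart_map i p 0 a.

Lemma smooth_chart_coord i a : smooth_fun (chart_dom i) (chart_coord i a).
Proof.
move=> j; have oI := open_chart_image (i := j) (@chart_dom_open _ _ _ i).
exact: ((smooth_on_mxP _ oI).1 (smooth_transition j i)).
Qed.

Lemma dderiv_chart_coord i a p v : chart_dom i p ->
  dderiv p v (chart_coord i a) = (v *m to_chart i p) 0 a.
Proof.
move=> ip; have cp := chart_at_dom p.
rewrite to_chartE -derive_transition// derive_entry//.
exact: differentiable_transition.
Qed.

(** The components of a field in a chart are its derivatives of the coordinate functions, and for a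
    bracket these derivatives are accessible through the commutator formula. *)
Lemma smooth_vf_coord U X : open U ->
  (forall i a, smooth_fun (U `&` chart_dom i) (fun p => dderiv p (X p) (chart_coord i a))) ->
  smooth_vf U X.
Proof.
move=> oU sX i; have oI := open_chart_image (i := i) oU.
apply/smooth_on_mxP => // b a; rewrite (ord1 b).
have := sX i a i; rewrite -/(chart_image i _) /chart_image -setIA setIid.
apply: (smooth_on_eq oI) => x /chart_imageP[Ux ix ex] /=.
by rewrite dderiv_chart_coord.
Qed.

(** The second-order parts of XYf and YXf agree by [derive_commute]. Both sides only involve
    [dderiv], which may be read in any chart, whereas [lie_bracket] is tied to [chart_at p]. *)
Lemma lie_bracket_dderiv U X Y f p : open U -> U p ->
  smooth_vf U X -> smooth_vf U Y -> smooth_fun U f ->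
  dderiv p (lie_bracket X Y p) f =
  dderiv p (X p) (fun q => dderiv q (Y q) f) -
  dderiv p (Y p) (fun q => dderiv q (X q) f).
Proof.
move=> oU Up sX sY sf; have cp := chart_at_dom p; set c := chart_at p in cp *.
have oI := open_chart_image (i := c) oU.
have Ux := mem_chart_image Up cp.
have dF := smooth_fun_differentiable sf Up cp.
pose d1 a := 'D_(delta_mx 0 a) (f \o chart_inv c) (chart_map c p).
pose d2 a b := 'D_(delta_mx 0 b) ('D_(delta_mx 0 a) (f \o chart_inv c)) (chart_map c p).
have d2C a b : d2 a b = d2 b a.
  apply: (derive_commute oI Ux).
  - by move=> y; apply: smooth_on_differentiable; exact: sf.
  - apply: (smooth_on_differentiable (smooth_on_partial a (sf c))); exact: Ux.
  - apply: (smooth_on_differentiable (smooth_on_partial b (sf c))); exact: Ux.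
(* Product rule for W(Zf), in terms of the first derivatives [d1] and second derivatives [d2] of f
   in the chart at p. *)
have dXY Z W : smooth_vf U Z ->
    dderiv p W (fun q => dderiv q (Z q) f) =
    \sum_a (('D_W (chart_components c Z) (chart_map c p)) 0 a *
      d1 a + Z p 0 a * \sum_b W 0 b * d2 a b).
  move=> sZ; have dZ := smooth_vf_differentiable sZ Up cp.
  have dFa a : differentiable ('D_(delta_mx 0 a) (f \o chart_inv c)) (chart_map c p).
    exact: (smooth_on_differentiable (smooth_on_partial a (sf c)) Ux).
  transitivity ('D_W (\sum_a ((fun x => chart_components c Z x 0 a) *
      'D_(delta_mx 0 a) (f \o chart_inv c))) (chart_map c p)).
    apply/near_eq_derive/(near_chart_image oU Up cp) => q Uq cq.
    rewrite /= chart_mapK// (dderiv_chart _ sf Uq cq) derive_rV; last first.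
      exact: smooth_fun_differentiable sf Uq cq.
    by rewrite fct_sumE; apply: eq_bigr => a _; rewrite -chart_components_map.
  have dM a : derivable ((fun x => chart_components c Z x 0 a) *
      'D_(delta_mx 0 a) (f \o chart_inv c)) (chart_map c p) W.
    by apply/diff_derivable/differentiableM => //; apply: differentiable_entry.
  rewrite derive_sum//; apply: eq_bigr => a _.
  rewrite deriveM; [|exact/diff_derivable/differentiable_entry
                    |exact/diff_derivable].
  rewrite -derive_entry// addrC (derive_rV W (dFa a)) chart_components_at.
  by congr (_ + _); rewrite [LHS]mulrC.
have -> : dderiv p (lie_bracket X Y p) f = \sum_a lie_bracket X Y p 0 a * d1 a.
  by rewrite /dderiv derive_rV.
rewrite !dXY// !big_split /= /lie_bracket -/c.
move: d1 d2 d2C {dXY} => d1 d2 d2C.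
(* The second-order parts, identified by [d2C] after exchanging the two sums. *)
set S1 := (X in _ = _ + X - _); set S2 := (X in _ = _ - (_ + X)).
have -> : S1 = S2.
  rewrite /S1 /S2; under eq_bigr do rewrite mulr_sumr.
  under [RHS]eq_bigr do rewrite mulr_sumr.
  rewrite exchange_big; apply: eq_bigr => b _; apply: eq_bigr => a _.
  by rewrite mulrCA d2C.
move: S2 => S {S1}; set A := (X in _ = X + _ - _); set B := (X in _ = _ - (X + _)).
transitivity (A - B); last by move: A B => A B; ring.
rewrite -sumrB; apply: eq_bigr => a _.
by rewrite -mulrBl; congr (_ * _); rewrite !mxE.
Qed.

Lemma smooth_lie_bracket U X Y : open U -> smooth_vf U X -> smooth_vf U Y ->
  smooth_vf U (lie_bracket X Y).
Proof.
move=> oU sX sY; apply: smooth_vf_coord => // i a.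
have oUi : open (U `&` chart_dom i) by apply: openI => //; exact: chart_dom_open.
have sf := smooth_funS (@subIsetr _ U (chart_dom i)) (smooth_chart_coord a).
have {}sX := smooth_vfS (@subIsetl _ U (chart_dom i)) sX.
have {}sY := smooth_vfS (@subIsetl _ U (chart_dom i)) sY.
apply: (@smooth_fun_eq _ (fun p =>
  dderiv p (X p) (fun q => dderiv q (Y q) (chart_coord i a)) -
  dderiv p (Y p) (fun q => dderiv q (X q) (chart_coord i a)))) => //.
  by move=> p Up; rewrite (lie_bracket_dderiv oUi).
by apply: smooth_funB => //; apply: smooth_dderiv => //; apply: smooth_dderiv.
Qed.

(** With i the chart at p, this extends a tangent vector at p to a smooth field near p, and two such
    fields commute at p. *)
Definition const_field i (v : 'rV[R]_n) p : 'rV[R]_n := v *m from_chart i p.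

Lemma coord_fieldE i a : coord_field i a = const_field i (delta_mx 0 a).
Proof. by apply/funext => p; rewrite /coord_field rowE. Qed.

Lemma smooth_const_field i v : smooth_vf (chart_dom i) (const_field i v).
Proof.
move=> j; have oI := open_chart_image (i := j) (@chart_dom_open _ _ _ i).
have oI' := open_chart_image (i := i) (@chart_dom_open _ _ _ j).
(* The components in chart j are v times [transition_jac i j], which is known to be smooth in the
   coordinates of i. Its inverse [transition_jac j i] is smooth in those of j. *)
apply: (@smooth_on_eq _ _ _ _ (fun x => v *m (invmx (transition_jac j i (chart_inv j x))))) => //.
  move=> x /chart_imageP[ix jx ex]; rewrite /chart_components -mulmxA from_to_chart//.
  congr (_ *m _).
  have E : transition_jac i j (chart_inv j x) *m transition_jac j i (chart_inv j x) = 1%:M.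
    by rewrite transition_jac_comp// transition_jac_id.
  have [_ u] := mulmx1_unit E.
  move: (transition_jac i j _) (transition_jac j i _) E u => A B AB uB.
  by rewrite -[LHS]mul1mx -AB -mulmxA mulmxV ?mulmx1.
apply: smooth_on_mulmx => //; first exact: smooth_on_cst.
apply: smooth_on_invmx => //; first exact: smooth_transition_jac.
move=> x /chart_imageP[ix jx ex].
apply: (mulmx1_unit (B := transition_jac i j (chart_inv j x)) _).1.
by rewrite transition_jac_comp// transition_jac_id.
Qed.

Lemma chart_components_const i v p : chart_dom i p ->
  chart_components i (const_field i v) (chart_map i p) = v.
Proof.
by move=> ip; rewrite chart_components_map// -mulmxA from_to_chart_id ?mulmx1.
Qed.

Lemma const_field_at p v : const_field (chart_at p) v p = v.
Proof. by rewrite /const_field from_chart_at mulmx1. Qed.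

Lemma derive_const_field p v w :
  'D_w (chart_components (chart_at p) (const_field (chart_at p) v))
    (chart_map (chart_at p) p) = 0.
Proof.
rewrite -[RHS](derive_cst v (chart_map (chart_at p) p) w).
apply/near_eq_derive/(near_chart_image openT (I : setT p) (chart_at_dom p)).
by move=> q _ cq; apply: chart_components_const.
Qed.

Lemma lie_bracket_const p v w :
  lie_bracket (const_field (chart_at p) v) (const_field (chart_at p) w) p = 0.
Proof. by rewrite /lie_bracket !derive_const_field subrr. Qed.

Lemma vf_const_fields i X p : chart_dom i p ->
  X p = \sum_a chart_components i X (chart_map i p) 0 a *: coord_field i a p.
Proof.
move=> ip; rewrite -{1}(chart_componentsK X ip).
rewrite {1}[chart_components _ _ _]row_sum_delta mulmx_suml.
by apply: eq_bigr => a _; rewrite -scalemxAl /coord_field rowE.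
Qed.

End ManifoldCalculus.

(** * Derivatives of matrix products, and bilinear forms given by matrices *)

Section MatrixDerivative.
Context {R : realType} {V : normedModType R}.

Lemma differentiable_mulmx m k l (F : V -> 'M[R]_(m, k)) (G : V -> 'M[R]_(k, l)) x :
  differentiable F x -> differentiable G x -> differentiable (fun y => F y *m G y) x.
Proof.
move=> dF dG; apply: differentiable_mx => i j.
have -> : (fun y => (F y *m G y) i j) =
    \sum_a ((fun y => F y i a) * (fun y => G y a j)).
  by apply/funext => y; rewrite mxE fct_sumE.
by apply: differentiable_sum => a; apply: differentiableM; exact: differentiable_entry.
Qed.

Lemma derive_mulmx m k l (F : V -> 'M[R]_(m, k)) (G : V -> 'M[R]_(k, l)) x v :
  differentiable F x -> differentiable G x ->
  'D_v (fun y => F y *m G y) x = 'D_v F x *m G x + F x *m 'D_v G x.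
Proof.
move=> dF dG; apply/matrixP => i j.
rewrite derive_entry; last exact: differentiable_mulmx.
have -> : (fun y => (F y *m G y) i j) =
    \sum_a ((fun y => F y i a) * (fun y => G y a j)).
  by apply/funext => y; rewrite mxE fct_sumE.
have dFG a : derivable (fun y => F y i a) x v /\ derivable (fun y => G y a j) x v.
  by split; apply/diff_derivable/differentiable_entry.
have dP a : derivable ((fun y => F y i a) * (fun y => G y a j)) x v.
  by have [d1 d2] := dFG a; exact: (derivableM d1 d2).
rewrite (derive_sum dP) !mxE -big_split; apply: eq_bigr => a _; have [d1 d2] := dFG a.
rewrite (deriveM d1 d2) -(derive_entry v i a dF) -(derive_entry v a j dG) addrC.
by congr (_ + _); rewrite [LHS]mulrC.
Qed.

Lemma differentiable_tr m k (F : V -> 'M[R]_(m, k)) x :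
  differentiable F x -> differentiable (fun y => (F y)^T) x.
Proof.
move=> dF; apply: differentiable_mx => i j; under eq_fun do rewrite mxE.
exact: differentiable_entry.
Qed.

Lemma derive_tr m k (F : V -> 'M[R]_(m, k)) x v :
  differentiable F x -> 'D_v (fun y => (F y)^T) x = ('D_v F x)^T.
Proof.
move=> dF; apply/matrixP => i j.
rewrite (derive_entry v i j (differentiable_tr dF)) mxE (derive_entry v j i dF).
by have -> : (fun y => (F y)^T i j) = (fun y => F y j i)
  by apply/funext => y; rewrite mxE.
Qed.

End MatrixDerivative.

Section BilinearAlgebra.
Context {R : realType} {n : nat}.
Implicit Types (G A : 'M[R]_n) (x y z : 'rV[R]_n).

Lemma ipDl G x y z : ip G (x + y) z = ip G x z + ip G y z.
Proof. by rewrite /ip !mulmxDl mxE. Qed.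

Lemma ipDr G x y z : ip G x (y + z) = ip G x y + ip G x z.
Proof. by rewrite /ip linearD mulmxDr mxE. Qed.

Lemma ipZl G a x y : ip G (a *: x) y = a * ip G x y.
Proof. by rewrite /ip -!scalemxAl mxE. Qed.

Lemma ipZr G a x y : ip G x (a *: y) = a * ip G x y.
Proof. by rewrite /ip linearZ -scalemxAr mxE. Qed.

Lemma ipNl G x y : ip G (- x) y = - ip G x y.
Proof. by rewrite -scaleN1r ipZl mulN1r. Qed.

Lemma ipBl G x y z : ip G (x - y) z = ip G x z - ip G y z.
Proof. by rewrite ipDl ipNl. Qed.

Lemma ip0l G x : ip G 0 x = 0.
Proof. by rewrite -(scale0r 0) ipZl mul0r. Qed.

Lemma ip0r G x : ip G x 0 = 0.
Proof. by rewrite -(scale0r 0) ipZr mul0r. Qed.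

Lemma ip_suml G (I : Type) (r : seq I) (F : I -> 'rV[R]_n) y :
  ip G (\sum_(a <- r) F a) y = \sum_(a <- r) ip G (F a) y.
Proof.
by elim/big_rec2: _ => [|a z1 z2 _ <-]; rewrite ?ip0l// ipDl.
Qed.

Lemma ip_sym G x y : G^T = G -> ip G x y = ip G y x.
Proof.
move=> Gs; have E : (x *m G *m y^T)^T = y *m G *m x^T.
  by rewrite !trmx_mul Gs trmxK mulmxA.
by have := congr1 (fun A : 'M[R]_1 => A 0 0) E; rewrite mxE.
Qed.

Lemma ip_mulmx G A x y : ip G (x *m A) (y *m A) = ip (A *m G *m A^T) x y.
Proof. by rewrite /ip trmx_mul !mulmxA. Qed.

Lemma ip_product_rule G A x y dx dy :
  ((dx *m G + x *m A) *m y^T + x *m G *m dy^T) 0 0 =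
  ip A x y + ip G dx y + ip G x dy.
Proof. by rewrite mulmxDl 2![in LHS]mxE [X in X + _]addrC. Qed.

(** [x *m A] holds the coordinates of x in the frame of the rows of F, and [F *m G *m F^T] is the
    Gram matrix of that frame. *)
Lemma ip_row G A (F : 'M[R]_n) x b : A *m F = 1%:M ->
  (x *m A *m (F *m G *m F^T)) 0 b = ip G x (row b F).
Proof.
move=> AF; rewrite !mulmxA -(mulmxA x) AF mulmx1 /ip tr_row [LHS]mxE [RHS]mxE.
by apply: eq_bigr => a _; congr (_ * _); rewrite !mxE.
Qed.

Lemma ip_delta G a b : ip G (delta_mx 0 a) (delta_mx 0 b) = G a b.
Proof. by rewrite /ip -rowE trmx_delta -colE !mxE. Qed.

Lemma ip_inj G x y : G \in unitmx -> (forall z, ip G x z = ip G y z) -> x = y.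
Proof.
move=> uG E; apply: (can_inj (mulmxK uG)); apply/rowP => a.
have := E (delta_mx 0 a); rewrite /ip trmx_delta -!colE !mxE.
by rewrite -!/(_ *m _); under eq_bigr do rewrite ?mxE.
Qed.

Lemma functional0 (l : 'rV[R]_n -> R) :
  (forall a x y, l (a *: x + y) = a * l x + l y) -> l 0 = 0.
Proof. by move=> ll; have := ll (-1) 0 0; rewrite scaler0 addr0 mulN1r addNr. Qed.

Lemma functionalZ (l : 'rV[R]_n -> R) :
  (forall a x y, l (a *: x + y) = a * l x + l y) -> forall a x, l (a *: x) = a * l x.
Proof. by move=> ll a x; rewrite -[a *: x]addr0 ll (functional0 ll) addr0. Qed.

Lemma linear_rV_sum (l : 'rV[R]_n -> R) :
  (forall a x y, l (a *: x + y) = a * l x + l y) ->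
  forall z, l z = \sum_a z 0 a * l (delta_mx 0 a).
Proof.
move=> ll z.
have l0 := functional0 ll.
rewrite {1}(row_sum_delta z); elim: (index_enum _) => [|a r IH].
  by rewrite !big_nil.
by rewrite !big_cons ll IH.
Qed.

(** Riesz representation; it converts Christoffel symbols with a lowered index into vectors. *)
Lemma ip_dual G (l : 'rV[R]_n -> R) :
  G \in unitmx -> (forall a x y, l (a *: x + y) = a * l x + l y) ->
  forall z, ip G ((\row_a l (delta_mx 0 a)) *m invmx G) z = l z.
Proof.
move=> uG ll z; rewrite /ip mulmxKV// mxE (linear_rV_sum ll).
by apply: eq_bigr => a _; rewrite !mxE mulrC.
Qed.

End BilinearAlgebra.

(** * Derivatives of fields, metrics and endomorphisms in the chart at a point *)

Section FlatDerivative.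
Context {R : realType} {n : nat} {M : manifold R n}.
Implicit Types (U : set M) (X Y Z : M -> 'rV[R]_n) (f h : M -> R) (p q : M).
Implicit Types (i j c : chart M) (v w x y z : 'rV[R]_n) (g J : M -> 'M[R]_n).

(* The flat connection of the coordinates [chart_at p], at p *)
Definition flat_deriv p v X : 'rV[R]_n :=
  'D_v (chart_components (chart_at p) X) (chart_map (chart_at p) p).

(** The coordinate frame of [chart_at p] is the identity at p, so the derivative of the Gram matrix
    acts on tangent vectors at p as the covariant derivative of g under [flat_deriv]. The same holds
    for J and [endo_deriv]. *)
Definition metric_deriv g p v : 'M[R]_n :=
  'D_v (fun x => from_chart (chart_at p) (chart_inv (chart_at p) x)
      *m g (chart_inv (chart_at p) x)
      *m (from_chart (chart_at p) (chart_inv (chart_at p) x))^T)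
    (chart_map (chart_at p) p).

Definition endo_deriv J p v : 'M[R]_n :=
  'D_v (fun x => from_chart (chart_at p) (chart_inv (chart_at p) x)
      *m J (chart_inv (chart_at p) x)
      *m to_chart (chart_at p) (chart_inv (chart_at p) x))
    (chart_map (chart_at p) p).

Local Opaque derive jacobian.

Lemma lie_bracket_flat X Y p :
  lie_bracket X Y p = flat_deriv p (X p) Y - flat_deriv p (Y p) X.
Proof. by []. Qed.

Lemma flat_deriv_const p v w : flat_deriv p v (const_field (chart_at p) w) = 0.
Proof. exact: derive_const_field. Qed.

Lemma near_vf_differentiable X p : smooth_vf_near p X ->
  differentiable (chart_components (chart_at p) X) (chart_map (chart_at p) p).
Proof.
by case=> U [oU Up sX]; apply: smooth_vf_differentiable sX Up (chart_at_dom p).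
Qed.

Lemma near_fun_differentiable f p : smooth_fun_near p f ->
  differentiable (f \o chart_inv (chart_at p)) (chart_map (chart_at p) p).
Proof.
by case=> U [oU Up sf]; apply: smooth_fun_differentiable sf Up (chart_at_dom p).
Qed.

Lemma smooth_const_near p v : smooth_vf_near p (const_field (chart_at p) v).
Proof.
exists (chart_dom (chart_at p)); split; [exact: chart_dom_open|exact: chart_at_dom|].
exact: smooth_const_field.
Qed.

Lemma flat_deriv_linear p X (c : R) u v : smooth_vf_near p X ->
  flat_deriv p (c *: u + v) X = c *: flat_deriv p u X + flat_deriv p v X.
Proof.
by move=> /near_vf_differentiable dX; rewrite /flat_deriv !deriveE// linearP.
Qed.

Lemma flat_derivD p v X Y : smooth_vf_near p X -> smooth_vf_near p Y ->
  flat_deriv p v (fun q => X q + Y q) = flat_deriv p v X + flat_deriv p v Y.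
Proof.
move=> /near_vf_differentiable dX /near_vf_differentiable dY.
rewrite /flat_deriv; set c := chart_at p in dX dY *.
have -> : chart_components c (fun q => X q + Y q) =
    chart_components c X + chart_components c Y.
  by apply/funext => x; rewrite /chart_components mulmxDl.
exact: deriveD (diff_derivable dX) (diff_derivable dY).
Qed.

Lemma flat_derivM p v f X : smooth_fun_near p f -> smooth_vf_near p X ->
  flat_deriv p v (fun q => f q *: X q) =
  dderiv p v f *: X p + f p *: flat_deriv p v X.
Proof.
move=> /near_fun_differentiable df /near_vf_differentiable dX.
have E : chart_components (chart_at p) (fun q => f q *: X q) =
    (fun x => (f \o chart_inv (chart_at p)) x *: chart_components (chart_at p) X x).
  by apply/funext => x; rewrite /chart_components -scalemxAl.
have [e1 e2] : (f \o chart_inv (chart_at p)) (chart_map (chart_at p) p) = f p /\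
    chart_components (chart_at p) X (chart_map (chart_at p) p) = X p.
  by rewrite chart_components_at /= chart_mapK//; apply: chart_at_dom.
rewrite /flat_deriv E /dderiv -e1 -e2.
move: (f \o _) (chart_components _ X) df dX => F C dF dC.
apply/rowP => a.
have dCa := differentiable_entry 0 a dC.
have dFC : differentiable (fun x => F x *: C x) (chart_map (chart_at p) p).
  apply: differentiable_mx => i j; under eq_fun do rewrite mxE.
  by apply: (differentiableM dF); apply: differentiable_entry.
rewrite (derive_entry v 0 a dFC); under eq_fun do rewrite mxE.
rewrite !mxE (derive_entry v 0 a dC).
move: (deriveM (diff_derivable (v := v) dF) (diff_derivable (v := v) dCa)) => /= DM.
rewrite [LHS]DM addrC; congr (_ + _); exact: mulrC.
Qed.

Lemma flat_derivZ p v a X : smooth_vf_near p X ->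
  flat_deriv p v (fun q => a *: X q) = a *: flat_deriv p v X.
Proof.
move=> sX; rewrite (flat_derivM v (f := fun=> a)) //.
  by rewrite /dderiv [X in X *: _](derive_cst a) scale0r add0r.
by exists setT; split=> //; [exact: openT|apply: smooth_fun_cst; exact: openT].
Qed.

Lemma ip_chart_components g i X Y p : chart_dom i p ->
  ip (g p) (X p) (Y p) =
  ip (from_chart i p *m g p *m (from_chart i p)^T)
    (chart_components i X (chart_map i p)) (chart_components i Y (chart_map i p)).
Proof. by move=> ip; rewrite -ip_mulmx !chart_componentsK. Qed.

Lemma gramE g i p a b : (from_chart i p *m g p *m (from_chart i p)^T) a b =
  ip (g p) (coord_field i a p) (coord_field i b p).
Proof. by rewrite /coord_field !rowE ip_mulmx ip_delta. Qed.

Lemma smooth_gram g i : smooth_metric g ->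
  smooth_on (chart_image i (chart_dom i)) (fun x => from_chart i (chart_inv i x)
    *m g (chart_inv i x) *m (from_chart i (chart_inv i x))^T).
Proof.
move=> sg; have oI := open_chart_image (i := i) (@chart_dom_open _ _ _ i).
by apply/smooth_on_mxP => // a b; under eq_fun do rewrite gramE; apply: sg.
Qed.

Lemma smooth_ip g U X Y : smooth_metric g -> open U ->
  smooth_vf U X -> smooth_vf U Y -> smooth_fun U (fun p => ip (g p) (X p) (Y p)).
Proof.
move=> sg oU sX sY i; have oI := open_chart_image (i := i) oU.
pose G x := from_chart i (chart_inv i x) *m g (chart_inv i x)
    *m (from_chart i (chart_inv i x))^T.
have sG : smooth_on (chart_image i U) G.
  apply: smooth_onS (smooth_gram (i := i) sg) => _ [p [Up ip] <-].
  by exists p.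
apply: (@smooth_on_eq _ _ _ _ (fun x => (chart_components i X x *m G x
    *m (chart_components i Y x)^T) 0 0)) => //.
  by move=> x /chart_imageP[Ux ix ex]; rewrite /= (ip_chart_components _ _ _ ix) ex.
apply: (smooth_on_mxP _ oI).1; apply: smooth_on_mulmx => //.
  by apply: smooth_on_mulmx => //; exact: (sX i).
by apply: smooth_on_tr => //; exact: (sY i).
Qed.

Lemma chart_components_app J i X p : chart_dom i p ->
  chart_components i (app_endo J X) (chart_map i p) =
  chart_components i X (chart_map i p) *m (from_chart i p *m J p *m to_chart i p).
Proof.
move=> ip; rewrite [LHS]chart_components_map// /app_endo.
rewrite -[in LHS](chart_componentsK X ip).
move: (chart_components i X _) (from_chart i p) (to_chart i p) => C A B.
by rewrite !mulmxA.
Qed.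

Lemma smooth_endo_chart J i : smooth_endo J ->
  smooth_on (chart_image i (chart_dom i)) (fun x => from_chart i (chart_inv i x)
    *m J (chart_inv i x) *m to_chart i (chart_inv i x)).
Proof.
move=> sJ; have oI := open_chart_image (i := i) (@chart_dom_open _ _ _ i).
apply/smooth_on_mxP => // a b.
have := (smooth_on_mxP _ oI).1 (sJ i a i) 0 b.
apply: (smooth_on_eq oI) => x /chart_imageP[ix _ ex].
by rewrite /chart_components /app_endo /coord_field -row_mul -row_mul mxE.
Qed.

Lemma smooth_app_endo J U X : smooth_endo J -> open U -> smooth_vf U X ->
  smooth_vf U (app_endo J X).
Proof.
move=> sJ oU sX i; have oI := open_chart_image (i := i) oU.
apply: (@smooth_on_eq _ _ _ _ (fun x => chart_components i X x *m
   (from_chart i (chart_inv i x) *m J (chart_inv i x) *m to_chart i (chart_inv i x)))) => //.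
  move=> x /chart_imageP[Ux ix ex]; have := chart_components_app J X ix.
  by rewrite ex => /esym.
apply: smooth_on_mulmx => //.
apply: smooth_onS (smooth_endo_chart (i := i) sJ) => _ [p [Up ip] <-].
by exists p.
Qed.

Lemma smooth_app_endo_near J p X : smooth_endo J -> smooth_vf_near p X ->
  smooth_vf_near p (app_endo J X).
Proof.
by move=> sJ [U [oU Up sX]]; exists U; split=> //; apply: smooth_app_endo.
Qed.

Lemma gram_differentiable g p : smooth_metric g ->
  differentiable (fun x => from_chart (chart_at p) (chart_inv (chart_at p) x)
      *m g (chart_inv (chart_at p) x)
      *m (from_chart (chart_at p) (chart_inv (chart_at p) x))^T)
    (chart_map (chart_at p) p).
Proof.
move=> sg; apply: (smooth_on_differentiable (smooth_gram (i := chart_at p) sg)).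
by apply: mem_chart_image; apply: chart_at_dom.
Qed.

Lemma endo_differentiable J p : smooth_endo J ->
  differentiable (fun x => from_chart (chart_at p) (chart_inv (chart_at p) x)
      *m J (chart_inv (chart_at p) x)
      *m to_chart (chart_at p) (chart_inv (chart_at p) x))
    (chart_map (chart_at p) p).
Proof.
move=> sJ; apply: (smooth_on_differentiable (smooth_endo_chart (i := chart_at p) sJ)).
by apply: mem_chart_image; apply: chart_at_dom.
Qed.

Lemma metric_deriv_linear g p (c : R) u v : smooth_metric g ->
  metric_deriv g p (c *: u + v) = c *: metric_deriv g p u + metric_deriv g p v.
Proof.
by move=> /gram_differentiable dg; rewrite /metric_deriv !deriveE// linearP.
Qed.

Lemma endo_deriv_linear J p (c : R) u v : smooth_endo J ->
  endo_deriv J p (c *: u + v) = c *: endo_deriv J p u + endo_deriv J p v.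
Proof.
by move=> /endo_differentiable dJ; rewrite /endo_deriv !deriveE// linearP.
Qed.

Lemma metric_deriv_sym g p v : smooth_metric g -> (forall q, (g q)^T = g q) ->
  (metric_deriv g p v)^T = metric_deriv g p v.
Proof.
move=> sg gs; apply/matrixP => a b; rewrite mxE /metric_deriv.
rewrite !derive_entry; try exact: gram_differentiable.
apply: (congr1 (fun F => derive F _ _)); apply/funext => x.
by rewrite !gramE; exact: ip_sym.
Qed.

Lemma flat_deriv_app J p v X : smooth_endo J -> smooth_vf_near p X ->
  flat_deriv p v (app_endo J X) = flat_deriv p v X *m J p + X p *m endo_deriv J p v.
Proof.
move=> sJ /near_vf_differentiable dX; have dJ := endo_differentiable p sJ.
have cp := chart_at_dom p.
transitivity ('D_v (fun x => chart_components (chart_at p) X x *m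
   (from_chart (chart_at p) (chart_inv (chart_at p) x) *m J (chart_inv (chart_at p) x)
   *m to_chart (chart_at p) (chart_inv (chart_at p) x))) (chart_map (chart_at p) p)).
  apply/near_eq_derive/(near_chart_image openT (I : setT p) cp) => q _ cq.
  by have := chart_components_app J X cq; rewrite /= (chart_mapK cq).
rewrite derive_mulmx// chart_components_at chart_mapK//.
by rewrite from_chart_at to_chart_at mul1mx mulmx1.
Qed.

Lemma dderiv_ip g p v X Y : smooth_metric g ->
  smooth_vf_near p X -> smooth_vf_near p Y ->
  dderiv p v (fun q => ip (g q) (X q) (Y q)) =
  ip (metric_deriv g p v) (X p) (Y p) + ip (g p) (flat_deriv p v X) (Y p)
  + ip (g p) (X p) (flat_deriv p v Y).
Proof.
move=> sg /near_vf_differentiable dX /near_vf_differentiable dY.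
have dg := gram_differentiable p sg.
have cp := chart_at_dom p.
set G := fun x => _ in dg.
have dYT := differentiable_tr dY.
have DYT := derive_tr v dY.
transitivity ('D_v (fun x => (chart_components (chart_at p) X x *m G x
    *m (chart_components (chart_at p) Y x)^T) 0 0) (chart_map (chart_at p) p)).
  apply/near_eq_derive/(near_chart_image openT (I : setT p) cp) => q _ cq.
  by rewrite /= (chart_mapK cq) (ip_chart_components _ _ _ cq) /G (chart_mapK cq).
have dXG := differentiable_mulmx dX dg.
rewrite -[LHS](derive_entry v 0 0 (differentiable_mulmx dXG dYT)).
rewrite (derive_mulmx v dXG dYT) DYT (derive_mulmx v dX dg) !chart_components_at.
have -> : G (chart_map (chart_at p) p) = g p.
  by rewrite /G chart_mapK// from_chart_at trmx1 mulmx1 mul1mx.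
rewrite -/(flat_deriv p v X) -/(flat_deriv p v Y) -/(metric_deriv g p v).
move: (flat_deriv p v X) (flat_deriv p v Y) (metric_deriv g p v) => A B D.
exact: ip_product_rule.
Qed.

End FlatDerivative.

(** * Weyl connections *)

Section OneForms.
Context {R : realType} {n : nat} {M : manifold R n}.
Implicit Types (phi : M -> 'rV[R]_n -> R).

Lemma form1_linear (w : 'rV[R]_n -> R) : alternating_form (k := 1) w ->
  forall a x y, w (a *: x + y) = a * w x + w y.
Proof.
case=> wl _ a x y; rewrite -[w y in RHS]mul1r.
apply: (wl _ x y 0 a 1).
- by rewrite linearP /= scale1r.
- by rewrite [LHS]flatmx0 [RHS]flatmx0.
- by rewrite [LHS]flatmx0 [RHS]flatmx0.
Qed.

Lemma linear_form1 (w : 'rV[R]_n -> R) :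
  (forall a x y, w (a *: x + y) = a * w x + w y) -> alternating_form (k := 1) w.
Proof.
move=> wl; split=> [A B C i b c|A i j]; last by rewrite !ord1 eqxx.
rewrite (ord1 i) => E _ _.
have -> : A = b *: B + c *: C.
  by apply/rowP => k; have := congr1 (fun r : 'rV[R]_n => r 0 k) E; rewrite !mxE.
by rewrite wl (functionalZ wl).
Qed.

Lemma smooth_form_vf phi U X : smooth_form (k := 1) phi -> open U ->
  smooth_vf U X -> smooth_fun U (fun p => phi p (X p)).
Proof.
move=> [al sphi] oU sX i; have oI := open_chart_image (i := i) oU.
apply: (@smooth_on_eq _ _ _ _ (fun x => \sum_a chart_components i X x 0 a *
   phi (chart_inv i x) (delta_mx 0 a *m from_chart i (chart_inv i x)))) => //.
  move=> x /chart_imageP[Ux ix ex] /=; set q := chart_inv i x in ix ex *.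
  have := vf_const_fields X ix; rewrite ex => E.
  pose l v := phi q (v *m from_chart i q).
  have ll a u v : l (a *: u + v) = a * l u + l v.
    by rewrite /l mulmxDl -scalemxAl (form1_linear (al q)).
  rewrite -/(l _) -(linear_rV_sum ll) /l.
  by have := chart_componentsK X ix; rewrite ex => ->.
apply: smooth_on_sum => // a; apply: smooth_onM => //.
  exact: (smooth_on_mxP _ oI).1 (sX i) 0 a.
apply: smooth_onS (sphi i (delta_mx 0 a) i) => _ [p [Up ip] <-].
by exists p.
Qed.

End OneForms.

Section WeylConnections.
Context {R : realType} {n : nat} {M : manifold R n}.
Implicit Types (U : set M) (X Y Z : M -> 'rV[R]_n) (p q : M) (i : chart M).
Implicit Types (u v w x y z : 'rV[R]_n).
Variables (g : M -> 'M[R]_n).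
Hypothesis g_smooth : smooth_metric g.
Hypothesis g_sym : forall p, (g p)^T = g p.
Hypothesis g_unit : forall p, g p \in unitmx.

Local Notation "''g_' p" := (ip (g p)) (at level 8, p at level 2).
Definition dmetric p v x y : R := ip (metric_deriv g p v) x y.

Lemma dmetric_sym p v x y : dmetric p v x y = dmetric p v y x.
Proof. by apply: ip_sym; apply: metric_deriv_sym. Qed.

Lemma dmetric_linear p (a : R) u v x y :
  dmetric p (a *: u + v) x y = a * dmetric p u x y + dmetric p v x y.
Proof.
rewrite /dmetric metric_deriv_linear//.
move: (metric_deriv g p u) (metric_deriv g p v) => A B.
by rewrite /ip mulmxDr mulmxDl mxE -scalemxAr -!scalemxAl mxE.
Qed.

Lemma dmetric_linearl p v (a : R) x y z :
  dmetric p v (a *: x + y) z = a * dmetric p v x z + dmetric p v y z.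
Proof. by rewrite /dmetric ipDl ipZl. Qed.

Lemma dmetric_linearr p v (a : R) x y z :
  dmetric p v z (a *: x + y) = a * dmetric p v z x + dmetric p v z y.
Proof. by rewrite /dmetric ipDr ipZr. Qed.

Definition koszul_rhs (phi : M -> 'rV[R]_n -> R) X Y Z p : R :=
  dderiv p (X p) (fun q => 'g_q (Y q) (Z q))
  + dderiv p (Y p) (fun q => 'g_q (X q) (Z q))
  - dderiv p (Z p) (fun q => 'g_q (X q) (Y q))
  + 'g_p (lie_bracket X Y p) (Z p) - 'g_p (lie_bracket X Z p) (Y p)
  - 'g_p (lie_bracket Y Z p) (X p)
  + 2 * (phi p (X p) * 'g_p (Y p) (Z p) + phi p (Y p) * 'g_p (X p) (Z p)
         - phi p (Z p) * 'g_p (X p) (Y p)).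

(** Add the metric identities along X and Y and subtract the one along Z; vanishing torsion then
    trades differences of covariant derivatives for brackets. *)
Lemma koszul phi nabla p X Y Z : torsion_free nabla ->
  (forall p v Y Z, smooth_vf_near p Y -> smooth_vf_near p Z ->
        cov_metric nabla g p v Y Z = - 2 * phi p v * 'g_p (Y p) (Z p)) ->
  smooth_vf_near p X -> smooth_vf_near p Y -> smooth_vf_near p Z ->
  2 * 'g_p (nabla p (X p) Y) (Z p) = koszul_rhs phi X Y Z p.
Proof.
move=> T G sX sY sZ.
have := G p (X p) Y Z sY sZ; have := G p (Y p) X Z sX sZ; have := G p (Z p) X Y sX sY.
rewrite /koszul_rhs /cov_metric -!T// !ipBl.
rewrite (ip_sym (Y p) (nabla p (X p) Z))// (ip_sym (X p) (nabla p (Y p) Z))//.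
rewrite (ip_sym (X p) (nabla p (Z p) Y))//.
move: (dderiv _ _ _) (dderiv _ _ _) (dderiv _ _ _) ('g_p _ _) ('g_p _ _) ('g_p _ _)
 ('g_p _ _) ('g_p _ _) ('g_p _ _) ('g_p _ _) ('g_p _ _) ('g_p _ _) => *.
lra.
Qed.

Lemma smooth_koszul_rhs phi U X Y Z : smooth_form (k := 1) phi -> open U ->
  smooth_vf U X -> smooth_vf U Y -> smooth_vf U Z ->
  smooth_fun U (koszul_rhs phi X Y Z).
Proof.
move=> sphi oU sX sY sZ.
have sI A B : smooth_vf U A -> smooth_vf U B -> smooth_fun U (fun p => 'g_p (A p) (B p)).
  exact: smooth_ip.
have sP A : smooth_vf U A -> smooth_fun U (fun p => phi p (A p)).
  exact: smooth_form_vf.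
have sL A B : smooth_vf U A -> smooth_vf U B -> smooth_vf U (lie_bracket A B).
  exact: smooth_lie_bracket.
have sD A f : smooth_vf U A -> smooth_fun U f -> smooth_fun U (fun p => dderiv p (A p) f).
  exact: smooth_dderiv.
apply: smooth_funD => //; last first.
  apply: smooth_funZ => //; apply: smooth_funB => //; last by apply: smooth_funM; auto.
  by apply: smooth_funD => //; apply: smooth_funM; auto.
do 2![apply: smooth_funB => //; last by apply: sI; auto].
apply: smooth_funD => //; last by apply: sI; auto.
apply: smooth_funB => //; last by apply: sD; auto.
by apply: smooth_funD => //; apply: sD; auto.
Qed.

Lemma same_weyl_connection phi nabla nabla' :
  weyl_with g phi nabla -> weyl_with g phi nabla' -> same_connection nabla nabla'.
Proof.
move=> [_ T _ G] [_ T' _ G'] p v X sX.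
apply: (ip_inj (g_unit p)) => z.
have sv := smooth_const_near p v; have sz := smooth_const_near p z.
have := koszul T G sv sX sz; rewrite -(koszul T' G' sv sX sz) !const_field_at.
by move=> E; apply: (mulfI _ E); rewrite pnatr_eq0.
Qed.

(** * Existence of the Weyl connection with a given 1-form *)

Section WeylExistence.
Variable phi : M -> 'rV[R]_n -> R.
Hypothesis phi_form : smooth_form (k := 1) phi.

Let phi_linear p a x y : phi p (a *: x + y) = a * phi p x + phi p y.
Proof. by have [al _] := phi_form; apply: form1_linear. Qed.

(** The Koszul formula on fields with constant components in [chart_at p], whose brackets vanish at
    p: the Levi-Civita Christoffel symbol with lowered index, plus the product of z with phi(x)y +
    phi(y)x - g(x,y)phi^#. *)
Definition christoffel_form p x y z : R := 2^-1 *
  (dmetric p x y z + dmetric p y x z - dmetric p z x y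
   + 2 * (phi p x * 'g_p y z + phi p y * 'g_p x z - phi p z * 'g_p x y)).

Definition christoffel p x y : 'rV[R]_n :=
  (\row_a christoffel_form p x y (delta_mx 0 a)) *m invmx (g p).

Lemma ip_christoffel p x y z : 'g_p (christoffel p x y) z = christoffel_form p x y z.
Proof.
apply: (ip_dual (g_unit p)) => a u v.
rewrite /christoffel_form dmetric_linear !dmetric_linearr phi_linear !(ipDr, ipZr).
move: (dmetric p) (phi p) ('g_p) => D f G; ring.
Qed.

Lemma christoffel_sym p x y : christoffel p x y = christoffel p y x.
Proof.
apply: (ip_inj (g_unit p)) => z; rewrite !ip_christoffel /christoffel_form.
rewrite (dmetric_sym p z x y) (ip_sym x y (g_sym p)).
move: (dmetric p) (phi p) ('g_p) => D f G; ring.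
Qed.

Lemma christoffel_linear p a x y z :
  christoffel p (a *: x + y) z = a *: christoffel p x z + christoffel p y z.
Proof.
apply: (ip_inj (g_unit p)) => w; rewrite ipDl ipZl !ip_christoffel /christoffel_form.
rewrite dmetric_linear !dmetric_linearl phi_linear !(ipDl, ipZl).
move: (dmetric p) (phi p) ('g_p) => D f G; ring.
Qed.

Definition weyl_nabla p v X : 'rV[R]_n := flat_deriv p v X + christoffel p v (X p).

Lemma weyl_nabla_torsion_free : torsion_free weyl_nabla.
Proof.
move=> p X Y sX sY; rewrite /weyl_nabla christoffel_sym lie_bracket_flat.
move: (flat_deriv p (X p) Y) (flat_deriv p (Y p) X) => A B.
by rewrite opprD addrACA subrr addr0.
Qed.

Lemma weyl_nabla_metric p v Y Z : smooth_vf_near p Y -> smooth_vf_near p Z ->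
  cov_metric weyl_nabla g p v Y Z = - 2 * phi p v * 'g_p (Y p) (Z p).
Proof.
move=> sY sZ; rewrite /cov_metric dderiv_ip// /weyl_nabla ipDl ipDr.
rewrite ip_christoffel (ip_sym (Y p) (christoffel _ _ _) (g_sym p)) ip_christoffel.
rewrite /christoffel_form -/(dmetric p v (Y p) (Z p)) (dmetric_sym p v (Z p) (Y p)).
rewrite (dmetric_sym p (Y p) v (Z p)) (dmetric_sym p (Z p) v (Y p)).
rewrite (ip_sym (Z p) (Y p) (g_sym p)).
move: (flat_deriv p v Y) (flat_deriv p v Z) (Y p) (Z p) => dy dz y z.
move: (dmetric p) (phi p) ('g_p) => D f G.
by field.
Qed.

(** The definition of [weyl_nabla] uses charts that may jump. Being torsion free and compatible with
    g at each point, it obeys the Koszul formula; this gives its products with the coordinate fields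
    of a fixed chart as smooth functions, and the inverse Gram matrix recovers the components. *)
Lemma weyl_nabla_smooth U X Y : open U -> smooth_vf U X -> smooth_vf U Y ->
  smooth_vf U (fun p => weyl_nabla p (X p) Y).
Proof.
move=> oU sX sY i; have oI := open_chart_image (i := i) oU.
have oUi : open (U `&` chart_dom i) by apply: openI => //; exact: chart_dom_open.
pose G x := from_chart i (chart_inv i x) *m g (chart_inv i x)
    *m (from_chart i (chart_inv i x))^T.
have sG : smooth_on (chart_image i U) G.
  by apply: smooth_onS (smooth_gram (i := i) g_smooth) => _ [p [Up ip] <-]; exists p.
have uG x : chart_image i U x -> G x \in unitmx.
  move=> /chart_imageP[Ux ix ex].
  have [_ u] := mulmx1_unit (to_from_chart ix).
  by rewrite !unitmx_mul unitmx_tr u g_unit.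
apply: (@smooth_on_eq _ _ _ _ (fun x =>
  (\row_b (2^-1 * koszul_rhs phi X Y (coord_field i b) (chart_inv i x)))
  *m invmx (G x))) => //.
  move=> x /[dup] Ix /chart_imageP[Ux ix ex].
  have sXn : smooth_vf_near (chart_inv i x) X by exists U.
  have sYn : smooth_vf_near (chart_inv i x) Y by exists U.
  apply: (can_inj (mulmxK (uG x Ix))); rewrite mulmxKV; last exact: uG.
  apply/rowP => b; rewrite mxE.
  have sc : smooth_vf_near (chart_inv i x) (coord_field i b).
    exists (chart_dom i); rewrite coord_fieldE; split=> //; first exact: chart_dom_open.
    exact: smooth_const_field.
  rewrite -(koszul weyl_nabla_torsion_free weyl_nabla_metric sXn sYn sc).
  rewrite mulKf ?pnatr_eq0//; apply/esym; exact: ip_row (to_from_chart ix).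
apply: smooth_on_mulmx => //; last exact: smooth_on_invmx.
apply/smooth_on_mxP => // a b; under eq_fun do rewrite mxE.
apply: smooth_onZ => //.
have : smooth_fun (U `&` chart_dom i) (koszul_rhs phi X Y (coord_field i b)).
  apply: smooth_koszul_rhs => //.
  - exact: smooth_vfS sX.
  - exact: smooth_vfS sY.
  - apply: smooth_vfS (@subIsetr _ _ _) _; rewrite coord_fieldE.
    exact: smooth_const_field.
by move=> /(_ i); rewrite -setIA setIid.
Qed.

Lemma weyl_nabla_weyl : weyl_with g phi weyl_nabla.
Proof.
split=> //; first split.
- move=> p X sX c u v; rewrite /weyl_nabla flat_deriv_linear// christoffel_linear.
  move: (flat_deriv p u X) (flat_deriv p v X) (christoffel p u _) (christoffel p v _).
  by move=> A B C D; rewrite scalerDr addrACA.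
- move=> p v X Y sX sY; rewrite /weyl_nabla flat_derivD// !(christoffel_sym p v).
  rewrite -[X p in LHS]scale1r christoffel_linear scale1r.
  move: (flat_deriv p v X) (flat_deriv p v Y) (christoffel p _ _) (christoffel p _ _).
  by move=> A B C D; rewrite addrACA.
- move=> p v f X sf sX; rewrite /weyl_nabla flat_derivM// !(christoffel_sym p v).
  have L := christoffel_linear p (f p) (X p) 0 v.
  have C0 : christoffel p 0 v = 0.
    by have := christoffel_linear p (-1) 0 0 v; rewrite scaler0 addr0 scaleN1r addNr.
  move: L; rewrite addr0 C0 addr0 => ->.
  move: (flat_deriv p v X) (christoffel p _ _) (dderiv p v f) => A B d.
  by rewrite scalerDr addrA.
- exact: weyl_nabla_smooth.
- exact: weyl_nabla_torsion_free.
- exact: weyl_nabla_metric.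
Qed.

End WeylExistence.
End WeylConnections.

(** * The Lee form *)

Section AlmostHermitian.
Context {R : realType} {n : nat} {M : manifold R n}.
Implicit Types (U : set M) (X Y Z : M -> 'rV[R]_n) (p q : M) (i : chart M).
Implicit Types (u v w x y z : 'rV[R]_n).
Variables (g J : M -> 'M[R]_n) (kappa : R).
Hypothesis g_smooth : smooth_metric g.
Hypothesis g_sym : forall p, (g p)^T = g p.
Hypothesis g_unit : forall p, g p \in unitmx.
Hypothesis J_smooth : smooth_endo J.
Hypothesis kappa2 : kappa * kappa = 1.
Hypothesis JJ : forall p, J p *m J p = kappa%:M.
Hypothesis gJ : forall p x y, ip (g p) (x *m J p) (y *m J p) = - kappa * ip (g p) x y.

Definition kahler p x y : R := ip (g p) x (y *m J p).

(** This is g((D_v J)x, y), with D the flat connection of [chart_at p]. *)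
Definition dendo p v x y : R := ip (g p) (x *m endo_deriv J p v) y.

Lemma mulJJ p x : x *m J p *m J p = kappa *: x.
Proof. by rewrite -mulmxA JJ mul_mx_scalar. Qed.

Lemma ip_skewJ p x y : ip (g p) (x *m J p) y = - ip (g p) x (y *m J p).
Proof.
have := gJ p x (y *m J p); rewrite mulJJ ipZr mulNr -mulrN => E.
by rewrite -[LHS]mul1r -kappa2 -mulrA E mulrA kappa2 mul1r.
Qed.

Lemma kahler_skew p x y : kahler p x y = - kahler p y x.
Proof. by rewrite /kahler (ip_sym x _ (g_sym p)) ip_skewJ. Qed.

(** The derivative of J^2 = kappa, obtained by differentiating J(JY) for a field Y with constant
    components. *)
Lemma endo_derivJ p v y : y *m J p *m endo_deriv J p v = - (y *m endo_deriv J p v *m J p).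
Proof.
set Y := const_field (chart_at p) y.
have sY : smooth_vf_near p Y by exact: smooth_const_near.
have sJY : smooth_vf_near p (app_endo J Y) by exact: smooth_app_endo_near.
have E1 : flat_deriv p v (app_endo J Y) = y *m endo_deriv J p v.
  by rewrite flat_deriv_app// flat_deriv_const mul0mx add0r /Y const_field_at.
have : flat_deriv p v (app_endo J (app_endo J Y)) = 0.
  have -> : app_endo J (app_endo J Y) = fun q => kappa *: Y q.
    by apply/funext => q; rewrite /app_endo mulJJ.
  by rewrite flat_derivZ// flat_deriv_const scaler0.
rewrite flat_deriv_app// E1 /app_endo /Y const_field_at.
move: (endo_deriv J p v) => A; move=> E.
by apply/eqP; rewrite -addr_eq0 addrC E.
Qed.

Lemma dendoJ p v x y : dendo p v (x *m J p) y = dendo p v x (y *m J p).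
Proof. by rewrite /dendo endo_derivJ ipNl ip_skewJ opprK. Qed.

Lemma dderiv_kahler p v Y Z : smooth_vf_near p Y -> smooth_vf_near p Z ->
  dderiv p v (fun q => kahler q (Y q) (Z q)) =
  dmetric g p v (Y p) (Z p *m J p) + dendo p v (Z p) (Y p)
  + kahler p (flat_deriv p v Y) (Z p) + kahler p (Y p) (flat_deriv p v Z).
Proof.
move=> sY sZ; have sJZ := smooth_app_endo_near J_smooth sZ.
rewrite (dderiv_ip v g_smooth sY sJZ) flat_deriv_app// ipDr.
rewrite (ip_sym (Y p) (Z p *m _) (g_sym p)) -/(dendo p v (Z p) (Y p)).
rewrite -/(dmetric g p v (Y p) (app_endo J Z p)) /app_endo -/(kahler p (Y p) (flat_deriv p v Z)).
rewrite -/(kahler p (flat_deriv p v Y) (Z p)).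
move: (dmetric _ _ _ _ _) (dendo _ _ _ _) (kahler _ _ _) (kahler _ _ _) => a b c d.
ring.
Qed.

(** The derivative of the skew-symmetry of Omega, evaluated on fields with constant components. *)
Lemma dmetricJ p v x y :
  dmetric g p v (x *m J p) y + dmetric g p v x (y *m J p)
  + dendo p v x y + dendo p v y x = 0.
Proof.
set X := const_field (chart_at p) x; set Y := const_field (chart_at p) y.
have sX : smooth_vf_near p X by exact: smooth_const_near.
have sY : smooth_vf_near p Y by exact: smooth_const_near.
have E1 := dderiv_kahler v sX sY; have E2 := dderiv_kahler v sY sX.
have [X0 Y0] : kahler p (flat_deriv p v X) (Y p) = 0 /\ kahler p (flat_deriv p v Y) (X p) = 0.
  by rewrite /kahler /X /Y !flat_deriv_const !ip0l.
have [X1 Y1] : kahler p (Y p) (flat_deriv p v X) = 0 /\ kahler p (X p) (flat_deriv p v Y) = 0.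
  by rewrite /kahler /X /Y !flat_deriv_const !mul0mx !ip0r.
move: E1 E2; rewrite X0 X1 Y0 Y1 /X /Y !const_field_at !addr0 => E1 E2.
have E3 : dderiv p v (fun q => kahler q (X q) (Y q)) = - dderiv p v (fun q => kahler q (Y q) (X q)).
  have dk : derivable ((fun q => kahler q (Y q) (X q)) \o chart_inv (chart_at p)) (chart_map (chart_at p) p) v.
    apply: diff_derivable; apply: near_fun_differentiable.
    exists (chart_dom (chart_at p)); split; [exact: chart_dom_open|exact: chart_at_dom|].
    have oc := @chart_dom_open _ _ M (chart_at p).
    apply: smooth_ip => //; first exact: smooth_const_field.
    apply: (smooth_app_endo (X := X)) => //; exact: smooth_const_field.
  rewrite /dderiv -(deriveN dk); apply: (congr1 (fun F => derive F _ _)).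
  by apply/funext => a; rewrite /= kahler_skew.
move: E3; rewrite E1 E2 (dmetric_sym g_smooth g_sym p v y).
move: (dmetric _ _ _ _ _) (dmetric _ _ _ _ _) (dendo _ _ _ _) (dendo _ _ _ _) => a b c d.
by clear E1 E2 X0 X1 Y0 Y1 sX sY X Y; lra.
Qed.

(** The value of d Omega on constant fields of the chart at p. Each of the three groups has the form
    (D_v Omega)(u, w) = (D_v g)(u, Jw) + g(u, (D_v J)w). *)
Definition dkahler p x y z : R :=
  dmetric g p x y (z *m J p) + dendo p x z y
  - (dmetric g p y x (z *m J p) + dendo p y z x)
  + (dmetric g p z x (y *m J p) + dendo p z y x).

Lemma dderiv_kahler_const p v y z :
  dderiv p v (fun q => kahler q (const_field (chart_at p) y q) (const_field (chart_at p) z q))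
  = dmetric g p v y (z *m J p) + dendo p v z y.
Proof.
rewrite (dderiv_kahler v (smooth_const_near p y) (smooth_const_near p z)).
by rewrite !flat_deriv_const !const_field_at /kahler mul0mx ip0l ip0r !addr0.
Qed.

Lemma ext_deriv_kahler p (v : 'M[R]_(3, n)) :
  ext_deriv (k := 2) (kahler_form g J) p v = dkahler p (row 0 v) (row 1 v) (row 2 v).
Proof.
have alt3 (f : 'I_3 -> R) : \sum_(j < 3) (-1) ^+ j * f j = f 0 - f 1 + f 2.
  rewrite !big_ord_recl big_ord0 addr0 expr0 mul1r /= expr1 mulN1r sqrrN expr1n mul1r.
  rewrite addrA; congr (_ - f _ + f _); exact: val_inj.
rewrite /ext_deriv alt3.
have E j a b : row 0 (row' j v) = a -> row 1 (row' j v) = b ->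
  dderiv p (row j v) (fun q => kahler_form g J q (row' j v *m from_chart (chart_at p) q))
  = dmetric g p (row j v) a (b *m J p) + dendo p (row j v) b a.
  move=> <- <-; rewrite -dderiv_kahler_const; apply: (congr1 (dderiv p _)).
  by apply/funext => q; rewrite /kahler_form !row_mul.
have r01 : row 0 (row' (0 : 'I_3) v) = row 1 v.
  by apply/rowP => a; rewrite !mxE; congr (v _ _); apply: val_inj.
have r02 : row 1 (row' (0 : 'I_3) v) = row 2 v.
  by apply/rowP => a; rewrite !mxE; congr (v _ _); apply: val_inj.
have r11 : row 0 (row' (1 : 'I_3) v) = row 0 v.
  by apply/rowP => a; rewrite !mxE; congr (v _ _); apply: val_inj.
have r12 : row 1 (row' (1 : 'I_3) v) = row 2 v.
  by apply/rowP => a; rewrite !mxE; congr (v _ _); apply: val_inj.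
have r21 : row 0 (row' (2 : 'I_3) v) = row 0 v.
  by apply/rowP => a; rewrite !mxE; congr (v _ _); apply: val_inj.
have r22 : row 1 (row' (2 : 'I_3) v) = row 1 v.
  by apply/rowP => a; rewrite !mxE; congr (v _ _); apply: val_inj.
by rewrite (E 0 _ _ r01 r02) (E 1 _ _ r11 r12) (E 2 _ _ r21 r22).
Qed.

(** The invariant formula for the exterior derivative: derivatives of the fields cancel against the
    brackets. It detaches [dkahler] from the chart at p, which gives its smoothness. *)
Lemma dkahler_fields p X Y Z :
  smooth_vf_near p X -> smooth_vf_near p Y -> smooth_vf_near p Z ->
  dkahler p (X p) (Y p) (Z p) =
  dderiv p (X p) (fun q => kahler q (Y q) (Z q))
  - dderiv p (Y p) (fun q => kahler q (X q) (Z q))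
  + dderiv p (Z p) (fun q => kahler q (X q) (Y q))
  - kahler p (lie_bracket X Y p) (Z p) + kahler p (lie_bracket X Z p) (Y p)
  - kahler p (lie_bracket Y Z p) (X p).
Proof.
move=> sX sY sZ; rewrite !dderiv_kahler// !lie_bracket_flat.
have kB a b c : kahler p (a - b) c = kahler p a c - kahler p b c by apply: ipBl.
have kS := kahler_skew p; rewrite /dkahler.
move: (flat_deriv p) (dmetric g p) (dendo p) (kahler p) kB kS => F d e k kB kS.
move: (X p) (Y p) (Z p) => x y z; rewrite !kB (kS y) (kS x (F y Z)) (kS x (F z Y)).
ring.
Qed.

Lemma smooth_kahler U X Y : open U -> smooth_vf U X -> smooth_vf U Y ->
  smooth_fun U (fun p => kahler p (X p) (Y p)).
Proof.
move=> oU sX sY; apply: smooth_ip => //.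
exact: (smooth_app_endo J_smooth oU sY).
Qed.

Lemma smooth_dkahler U X Y Z : open U ->
  smooth_vf U X -> smooth_vf U Y -> smooth_vf U Z ->
  smooth_fun U (fun p => dkahler p (X p) (Y p) (Z p)).
Proof.
move=> oU sX sY sZ.
have near A p : smooth_vf U A -> U p -> smooth_vf_near p A by exists U.
have sK A B : smooth_vf U A -> smooth_vf U B -> smooth_fun U (fun p => kahler p (A p) (B p)).
  exact: smooth_kahler.
have sL A B : smooth_vf U A -> smooth_vf U B -> smooth_vf U (lie_bracket A B).
  exact: smooth_lie_bracket.
have sD A f : smooth_vf U A -> smooth_fun U f -> smooth_fun U (fun p => dderiv p (A p) f).
  exact: smooth_dderiv.
apply: (smooth_fun_eq oU).
  by move=> p Up; apply/esym/dkahler_fields; apply: near.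
apply: smooth_funB => //; last by apply: sK; auto.
apply: smooth_funD => //; last by apply: sK; auto.
apply: smooth_funB => //; last by apply: sK; auto.
apply: smooth_funD => //; last by apply: sD; auto.
by apply: smooth_funB => //; apply: sD; auto.
Qed.

(* The Lee form: [d Omega = -2 phi /\ Omega] *)
Definition is_lee_form p (phi : 'rV[R]_n -> R) : Prop := forall x y z,
  dkahler p x y z = - 2 * (phi x * kahler p y z - phi y * kahler p x z
                           + phi z * kahler p x y).

Definition kahler_gram p (F : 'M[R]_n) : 'M[R]_n :=
  \matrix_(a, b) kahler p (row a F) (row b F).

Lemma kahler_gramE p F : kahler_gram p F = F *m g p *m (J p)^T *m F^T.
Proof.
apply/matrixP => a b; rewrite mxE /kahler !rowE.
have -> x y : ip (g p) x (y *m J p) = ip (g p *m (J p)^T) x y.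
  by rewrite /ip trmx_mul !mulmxA.
by rewrite ip_mulmx ip_delta !mulmxA.
Qed.

Lemma J_unit p : J p \in unitmx.
Proof.
apply: (mulmx1_unit (B := kappa *: J p) _).1.
by rewrite -scalemxAr JJ scale_scalar_mx kappa2.
Qed.

Lemma kahler_gram_unit p F : F \in unitmx -> kahler_gram p F \in unitmx.
Proof. by move=> uF; rewrite kahler_gramE !unitmx_mul !unitmx_tr uF g_unit J_unit. Qed.

(* Contracting [d Omega = -2 phi /\ Omega] with the bivector inverse to Omega *)
Lemma lee_form_contraction p phi F : F \in unitmx -> is_lee_form p phi ->
  (forall a x y, phi (a *: x + y) = a * phi x + phi y) ->
  forall x, -2 * (n%:R - 2) * phi x =
  \sum_a \sum_b invmx (kahler_gram p F) b a * dkahler p x (row a F) (row b F).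
Proof.
move=> uF lee lphi x; set O := kahler_gram p F; set Q := invmx O.
have uO : O \in unitmx by exact: kahler_gram_unit.
have OT : O^T = - O.
  by apply/matrixP => a b; rewrite !mxE kahler_skew.
have QT a b : Q a b = - Q b a.
  have : Q^T = - Q.
    have E : Q^T *m O = - 1%:M.
      by rewrite -[X in _ *m X]opprK -OT mulmxN -trmx_mul mulmxV// trmx1.
    by rewrite -[LHS]mulmx1 -(mulmxV uO) mulmxA E mulNmx mul1mx.
  by move=> /matrixP/(_ b a); rewrite !mxE.
have [y xy] : exists y, x = y *m F by exists (x *m invmx F); rewrite mulmxKV.
have xE : x = \sum_c y 0 c *: row c F.
  rewrite xy {1}(row_sum_delta y) mulmx_suml.
  by apply: eq_bigr => c _; rewrite -scalemxAl -rowE.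
have kx b : kahler p x (row b F) = (y *m O) 0 b.
  rewrite {1}xE /kahler ip_suml mxE; apply: eq_bigr => c _.
  by rewrite ipZl; congr (_ * _); rewrite mxE.
have phix : phi x = \sum_c y 0 c * phi (row c F).
  pose l v := phi (v *m F).
  have ll a u v : l (a *: u + v) = a * l u + l v.
    by rewrite /l mulmxDl -scalemxAl lphi.
  have -> : phi x = l y by rewrite /l xy.
  by rewrite (linear_rV_sum ll); apply: eq_bigr => c _; rewrite /l -rowE.
have yOQ : y *m O *m Q = y by rewrite mulmxK.
(* Contraction turns the first term of phi /\ Omega into a trace, worth n phi(x), and each of the
   other two terms, with its sign, into -phi(x). Hence the factor n - 2. *)
have S1 : \sum_a \sum_b Q b a * (phi x * kahler p (row a F) (row b F)) = n%:R * phi x.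
  have : \tr (O *m Q) = n%:R by rewrite mulmxV// mxtrace1.
  rewrite /mxtrace => <-; rewrite mulr_suml; apply: eq_bigr => a _.
  rewrite mxE mulr_suml; apply: eq_bigr => b _; rewrite mxE.
  by rewrite mulrCA mulrC; congr (_ * _); rewrite mulrC.
have S2 : \sum_a \sum_b Q b a * (phi (row a F) * kahler p x (row b F)) = phi x.
  rewrite phix; apply: eq_bigr => a _; rewrite -{1}yOQ [in RHS]mxE mulr_suml.
  by apply: eq_bigr => b _; rewrite kx mulrCA mulrC; congr (_ * _); rewrite mulrC.
have S3 : \sum_a \sum_b Q b a * (phi (row b F) * kahler p x (row a F)) = - phi x.
  rewrite exchange_big -[in RHS]S2 -sumrN; apply: eq_bigr => a _.
  by rewrite -sumrN; apply: eq_bigr => b _; rewrite QT mulNr.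
transitivity (-2 * (\sum_a \sum_b Q b a * (phi x * kahler p (row a F) (row b F))
  - \sum_a \sum_b Q b a * (phi (row a F) * kahler p x (row b F))
  + \sum_a \sum_b Q b a * (phi (row b F) * kahler p x (row a F)))).
  by rewrite S1 S2 S3; ring.
rewrite -sumrB -big_split mulr_sumr; apply: eq_bigr => a _.
rewrite -sumrB -big_split mulr_sumr; apply: eq_bigr => b _ /=.
by rewrite lee; move: (Q b a) => c; ring.
Qed.

End AlmostHermitian.

(* The identity of Kobayashi-Nomizu for [2 g((nabla_x J)y, z)], where [a] and [b]
   stand for the derivatives of g and of J in a chart *)
Lemma kobayashi_nomizu_identity (R : realType) (V : Type) (J : V -> V)
    (a b : V -> V -> V -> R) (k : R) :
  k * k = 1 ->
  (forall v x y, a v x y = a v y x) ->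
  (forall v x y, a v (J (J x)) y = k * a v x y) ->
  (forall v x y, b v x (J (J y)) = k * b v x y) ->
  (forall v x y, b v (J x) y = b v x (J y)) ->
  (forall v x y, a v (J x) y + a v x (J y) + b v x y + b v y x = 0) ->
  (forall x y z, b x y (J z) - b y x (J z) + b (J x) y z - b (J y) x z = 0) ->
  let T x y z := a x y (J z) + b x z y - (a y x (J z) + b y z x)
                 + (a z x (J y) + b z y x) in
  forall x y z,
    2 * b x y z + (a x (J y) z + a (J y) x z - a z x (J y))
    + (a x y (J z) + a y x (J z) - a (J z) x y)
    = - (T x y z + k * T x (J y) (J z)).
Proof.
move=> k2 aC aJJ bJJ bJ ab N T x y z; rewrite /T.
have aJJr v u w : a v u (J (J w)) = k * a v u w by rewrite aC aJJ aC.
(* Once double occurrences of J are replaced by the factor k, the difference of the two sides is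
   twice this instance of [ab] minus k times this instance of [N]. *)
have := N y z (J x); have := ab x y z.
rewrite !aJJr !bJ !bJJ.
have -> : forall A B C D E F : R, k * (k * A + k * B - (k * C + D) + (k * E + F))
  = A + B - (C + k * D) + (E + k * F).
  by move=> A B C D E F; rewrite !(mulrDr, mulrN, mulrA) k2 !mul1r.
move: (a _ _ _) (a _ _ _) (a _ _ _) (a _ _ _) (a _ _ _) (a _ _ _).
move: (b _ _ _) (b _ _ _) (b _ _ _) (b _ _ _) (b _ _ _) (b _ _ _).
move=> b1 b2 b3 b4 b5 b6 a1 a2 a3 a4 a5 a6 E1 E2.
clear aC aJJ bJJ bJ ab N T aJJr.
have : k * 0 = 0 by rewrite mulr0. rewrite -{1}E2 !(mulrDr, mulrN, mulrA) k2 !mul1r.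
by move=> E3; lra.
Qed.

(** * Parallel structures and Lee forms *)

Section KahlerWeyl.
Context {R : realType} {n : nat} {M : manifold R n}.
Implicit Types (U : set M) (X Y Z : M -> 'rV[R]_n) (p q : M) (i : chart M).
Implicit Types (u v w x y z : 'rV[R]_n).
Variables (g J : M -> 'M[R]_n) (kappa : R).
Hypothesis g_smooth : smooth_metric g.
Hypothesis g_sym : forall p, (g p)^T = g p.
Hypothesis g_unit : forall p, g p \in unitmx.
Hypothesis J_smooth : smooth_endo J.
Hypothesis kappa2 : kappa * kappa = 1.
Hypothesis JJ : forall p, J p *m J p = kappa%:M.
Hypothesis gJ : forall p x y, ip (g p) (x *m J p) (y *m J p) = - kappa * ip (g p) x y.

Let skew := kahler_skew g_sym kappa2 JJ gJ.

Lemma parallel_lee_form phi nabla p :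
  weyl_with g phi nabla -> parallel J nabla -> is_lee_form g J p (phi p).
Proof.
move=> [_ T _ G] P x y z.
have near v : smooth_vf_near p (const_field (chart_at p) v) by exact: smooth_const_near.
have at_p v : const_field (chart_at p) v p = v by exact: const_field_at.
(* [N] collects the Christoffel symbols of nabla in the chart at p, symmetric because constant
   fields commute at p. *)
have [N NE] : exists N, forall v w, nabla p v (const_field (chart_at p) w) = N v w.
  by eexists.
have C v w : N v w = N w v.
  have := T p _ _ (near v) (near w); rewrite lie_bracket_const !at_p !NE.
  by move/eqP; rewrite subr_eq0 => /eqP.
(* The condition nabla Omega = -2 phi Omega with its Christoffel terms made explicit. In the
   alternating sum over three arguments these terms cancel in pairs by the symmetry of [N]. *)
have D v u w : dmetric g p v u (w *m J p) + dendo g J p v w u =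
    kahler g J p (N v u) w + kahler g J p u (N v w) - 2 * phi p v * kahler g J p u w.
  rewrite -(dderiv_kahler_const g_smooth g_sym J_smooth p v u w).
  have := G p v _ _ (near u) (smooth_app_endo_near J_smooth (near w)).
  have := P p v _ (near w); move/eqP; rewrite subr_eq0 => /eqP E.
  rewrite /cov_metric E !at_p /app_endo !at_p !NE => {}E.
  move: E; rewrite /kahler; move: (dderiv _ _ _) (phi p v) => d l.
  set e := ip _ (N _ _) _; set f := ip _ _ (N _ _ *m _).
  move: e f (ip _ _ _) => e f h E.
  have -> : d = (d - e - f) + e + f by ring.
  by rewrite E; ring.
have := @skew p; rewrite /dkahler => S.
move: (dmetric g p) (dendo g J p) (kahler g J p) (phi p) D S => d e k f D S.
rewrite (D x y z) (D y x z) (D z x y) (C y x) (C z x) (C z y).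
by rewrite (S y (N x z)) (S x (N y z)); ring.
Qed.

Lemma lee_form_inj p phi phi' : (n != 2)%N ->
  (forall a x y, phi (a *: x + y) = a * phi x + phi y) ->
  (forall a x y, phi' (a *: x + y) = a * phi' x + phi' y) ->
  is_lee_form g J p phi -> is_lee_form g J p phi' -> phi = phi'.
Proof.
move=> n2 lphi lphi' lee lee'; apply/funext => x.
have c := lee_form_contraction g_sym g_unit kappa2 JJ gJ (unitmx1 _ n) .
have := c p phi lee lphi x; rewrite -(c p phi' lee' lphi' x).
move/mulfI; apply; rewrite mulf_neq0// ?oppr_eq0 ?pnatr_eq0//.
by rewrite subr_eq0 eqr_nat.
Qed.

(** In the coordinate frame of a chart, the contraction writes phi, up to the nonzero constant -2(n
    - 2), through d Omega and the inverse matrix of Omega. So a Lee form chosen point by point is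
    automatically smooth. *)
Lemma smooth_lee_form phi : (n != 2)%N ->
  (forall p a x y, phi p (a *: x + y) = a * phi p x + phi p y) ->
  (forall p, is_lee_form g J p (phi p)) -> smooth_form (k := 1) phi.
Proof.
move=> n2 lphi lee; split=> [p|i v]; first exact: linear_form1.
have oi := @chart_dom_open _ _ M i.
have n20 : -2 * (n%:R - 2) != 0 :> R.
  by rewrite mulf_neq0// ?oppr_eq0 ?pnatr_eq0// subr_eq0 eqr_nat.
have sc a : smooth_vf (chart_dom i) (coord_field i a).
  by rewrite coord_fieldE; apply: smooth_const_field.
pose Q p := invmx (kahler_gram g J p (from_chart i p)).
have uF p : chart_dom i p -> from_chart i p \in unitmx.
  by move=> /to_from_chart/mulmx1_unit[].
have sQ a b : smooth_fun (chart_dom i) (fun p => Q p a b).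
  move=> j; have oI := open_chart_image (i := j) oi.
  apply: ((smooth_on_mxP _ oI).1 _ a b).
  apply: smooth_on_invmx => //; last first.
    move=> x /chart_imageP[ix _ _].
    exact: (kahler_gram_unit g_unit kappa2 JJ _ (uF _ ix)).
  apply/smooth_on_mxP => // c d.
  have sk : smooth_fun (chart_dom i)
      (fun p => kahler g J p (coord_field i c p) (coord_field i d p)).
    exact: smooth_kahler.
  by apply: smooth_on_eq oI _ (sk j) => x _; rewrite mxE.
apply: (@smooth_fun_eq _ _ _ _ (fun p => (-2 * (n%:R - 2))^-1 *
   \sum_a \sum_b Q p b a * dkahler g J p (const_field i v p)
     (coord_field i a p) (coord_field i b p))) => //.
  move=> p ip; apply: (mulfI n20); rewrite mulVKf//.
  by rewrite (lee_form_contraction g_sym g_unit kappa2 JJ gJ (uF p ip) (lee p) (lphi p)).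
apply: smooth_funZ => //; apply: smooth_fun_sum => // a; apply: smooth_fun_sum => // b.
apply: smooth_funM => //.
apply: (smooth_dkahler g_smooth g_sym J_smooth kappa2 JJ gJ) => //.
exact: smooth_const_field.
Qed.

(** At kappa = 1 and kappa = -1 this is the vanishing of the para-complex and of the complex
    Nijenhuis tensor. *)
Hypothesis J_integrable : forall p X Y, smooth_vf_near p X -> smooth_vf_near p Y ->
  lie_bracket X Y p - kappa *: (lie_bracket (app_endo J X) Y p *m J p)
    - kappa *: (lie_bracket X (app_endo J Y) p *m J p)
    + kappa *: lie_bracket (app_endo J X) (app_endo J Y) p = 0.

(** On constant fields the brackets reduce to derivatives of J, such as [JX, Y] = -(D_Y J)X. The
    left side is then kappa times the Nijenhuis tensor, paired with z. *)
Lemma nijenhuis_dendo p x y z :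
  dendo g J p x y (z *m J p) - dendo g J p y x (z *m J p)
  + dendo g J p (x *m J p) y z - dendo g J p (y *m J p) x z = 0.
Proof.
have near v : smooth_vf_near p (const_field (chart_at p) v) by exact: smooth_const_near.
have at_p v : const_field (chart_at p) v p = v by exact: const_field_at.
have jat w : app_endo J (const_field (chart_at p) w) p = w *m J p.
  by rewrite /app_endo at_p.
have F0 v w : flat_deriv p v (const_field (chart_at p) w) = 0.
  exact: flat_deriv_const.
have F v w : flat_deriv p v (app_endo J (const_field (chart_at p) w))
    = w *m endo_deriv J p v.
  by rewrite (flat_deriv_app _ J_smooth (near w)) F0 mul0mx add0r at_p.
have := J_integrable (near x) (near y).
rewrite lie_bracket_const !lie_bracket_flat !at_p !jat.
have S := ip_skewJ kappa2 JJ gJ p; rewrite /dendo.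
move: (flat_deriv p) (endo_deriv J p) F F0 => fd D F F0.
rewrite !F !F0 !sub0r subr0 => E.
have := congr1 (fun w => ip (g p) (kappa *: w) z) E.
rewrite scaler0 ip0l !(ipZl, ipDl, ipNl, mulNmx).
rewrite !S.
move: (ip _ _ _) (ip _ _ _) (ip _ _ _) (ip _ _ _) => a b c d {}E.
rewrite -[RHS]E; transitivity (kappa * kappa * (c - d + b - a)); last by ring.
by rewrite kappa2 mul1r.
Qed.

Lemma weyl_nabla_parallel phi : smooth_form (k := 1) phi ->
  (forall p, is_lee_form g J p (phi p)) -> parallel J (weyl_nabla g phi).
Proof.
move=> sphi lee p v Y sY; rewrite /weyl_nabla flat_deriv_app// mulmxDl.
have jat : app_endo J Y p = Y p *m J p by [].
rewrite jat; move: (flat_deriv p v Y) (Y p) => fy y.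
have alg (a b c d : 'rV[R]_n) : a + b + c - (a + d) = b + (c - d).
  by apply/rowP => k; rewrite !mxE; ring.
rewrite alg.
apply: (ip_inj (g_unit p)) => z; rewrite ip0l ipDl ipBl.
rewrite (ip_skewJ kappa2 JJ gJ p _ z) !(ip_christoffel g_smooth g_unit sphi).
have dJJ a u w : dmetric g p a (u *m J p *m J p) w = kappa * dmetric g p a u w.
  by rewrite (mulJJ JJ) /dmetric ipZl.
have eJJ a u w : dendo g J p a u (w *m J p *m J p) = kappa * dendo g J p a u w.
  by rewrite (mulJJ JJ) /dendo ipZr.
(* The left side is 2 g((nabla_v J)y, z) without the terms in phi. *)
have KN : 2 * dendo g J p v y z + (dmetric g p v (y *m J p) z
    + dmetric g p (y *m J p) v z - dmetric g p z v (y *m J p))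
    + (dmetric g p v y (z *m J p) + dmetric g p y v (z *m J p) - dmetric g p (z *m J p) v y)
    = - (dkahler g J p v y z + kappa * dkahler g J p v (y *m J p) (z *m J p)).
  exact: (kobayashi_nomizu_identity kappa2 (dmetric_sym g_smooth g_sym p) dJJ eJJ
  (dendoJ J_smooth kappa2 JJ gJ p)
  (fun a x y => dmetricJ g_smooth g_sym J_smooth kappa2 JJ gJ p a x y)
  (nijenhuis_dendo p) v y z).
have kJ x w : kahler g J p x (w *m J p) = kappa * ip (g p) x w.
  by rewrite /kahler (mulJJ JJ) ipZr.
rewrite (lee p v y z) (lee p v (y *m J p) (z *m J p)) !kJ in KN.
rewrite /christoffel_form -/(dendo g J p v y z).
have skewJ := ip_skewJ kappa2 JJ gJ p.
move: KN; rewrite /kahler (skewJ y z).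
move: (dmetric g p) (dendo g J p) (ip (g p)) (phi p) => d e G f KN.
move: (y *m J p) (z *m J p) KN => y' z' KN.
(* [W] and [W'] are the contributions of phi to twice the Christoffel forms at (v, Jy, z) and (v, y,
   Jz). *)
set W := 2 * (f v * - G y z' + f y' * G v z - f z * G v y').
set W' := 2 * (f v * G y z' + f y * G v z' - f z' * G v y).
transitivity (2^-1 * (2 * e v y z + (d v y' z + d y' v z - d z v y')
  + (d v y z' + d y v z' - d z' v y) + W + W')); first by field.
rewrite KN; transitivity (2^-1 * (W + W' + 2 * (f v * G y z' - f y * G v z' + f z * G v y')
  + (kappa * kappa) * 2 * (- f v * G y z' - f y' * G v z + f z' * G v y))).
  by rewrite /W /W'; ring.
by rewrite kappa2 /W /W'; ring.
Qed.

End KahlerWeyl.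

(** The Lee form is prescribed at each point separately. As 4 differs from 2, the contraction makes
    it smooth and forces any other parallel Weyl connection to have the same 1-form. *)
Lemma unique_kahler_weyl_lee_form (R : realType) (M : manifold R 4)
    (g J : M -> 'M[R]_4) (kappa : R) (phi : M -> 'rV[R]_4 -> R) :
  smooth_metric g -> (forall p, (g p)^T = g p) -> (forall p, g p \in unitmx) ->
  smooth_endo J -> kappa * kappa = 1 -> (forall p, J p *m J p = kappa%:M) ->
  (forall p x y, ip (g p) (x *m J p) (y *m J p) = - kappa * ip (g p) x y) ->
  (forall p X Y, smooth_vf_near p X -> smooth_vf_near p Y ->
    lie_bracket X Y p - kappa *: (lie_bracket (app_endo J X) Y p *m J p)
    - kappa *: (lie_bracket X (app_endo J Y) p *m J p)
    + kappa *: lie_bracket (app_endo J X) (app_endo J Y) p = 0) ->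
  (forall p a x y, phi p (a *: x + y) = a * phi p x + phi p y) ->
  (forall p, is_lee_form g J p (phi p)) ->
  unique_kahler_weyl g J phi.
Proof.
move=> sg gs gu sJ k2 JJ gJ NJ lphi lee.
have sphi : smooth_form (k := 1) phi.
  exact: (smooth_lee_form sg gs gu sJ k2 JJ gJ (isT : (4 != 2)%N) lphi lee).
have W := weyl_nabla_weyl sg gs gu sphi.
exists (weyl_nabla g phi); split=> //.
- split; first by exists phi.
  exact: (weyl_nabla_parallel sg gs gu sJ k2 JJ gJ NJ sphi lee).
- move=> nabla' [[phi' W'] P'].
  have E : phi' = phi.
    apply/funext => p; have [_ _ [al _] _] := W'.
    apply: (lee_form_inj gs gu k2 JJ gJ (isT : (4 != 2)%N) _ (lphi p) _ (lee p)).
      exact: form1_linear (al p).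
    exact: (parallel_lee_form sg gs sJ k2 JJ gJ p W' P').
  by apply: (same_weyl_connection gs gu W); rewrite -E.
Qed.

(** * Alternating forms *)

Section AlternatingForms.
Context {R : realType}.

(** The first clause of [alternating_form], with the unchanged rows compared one at a time instead
    of through [row']. *)
Definition multilinear k n (w : 'M[R]_(k, n) -> R) : Prop :=
  forall (A B C : 'M[R]_(k, n)) i b c,
    row i A = b *: row i B + c *: row i C ->
    (forall j, j != i -> row j B = row j A) ->
    (forall j, j != i -> row j C = row j A) -> w A = b * w B + c * w C.

Lemma row'_eq k n (i : 'I_k) (A B : 'M[R]_(k, n)) :
  (forall j, j != i -> row j A = row j B) -> row' i A = row' i B.
Proof.
move=> E; apply/matrixP => a b; rewrite !mxE.
have ne : lift i a != i by rewrite eq_sym neq_lift.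
by have /rowP/(_ b) := E _ ne; rewrite !mxE.
Qed.

Lemma eq_row'_row k n (i j : 'I_k) (A B : 'M[R]_(k, n)) :
  row' i A = row' i B -> j != i -> row j A = row j B.
Proof.
rewrite eq_sym => E /unlift_some[a -> _]; apply/rowP => b.
by have /matrixP/(_ a b) := E; rewrite !mxE.
Qed.

Lemma alternating_multilinear k n (w : 'M[R]_(k, n) -> R) :
  alternating_form w -> multilinear w.
Proof. by case=> wl _ A B C i b c E1 E2 E3; apply: (wl A B C i) => //; apply: row'_eq. Qed.

Lemma multilinear_alternating k n (w : 'M[R]_(k, n) -> R) : multilinear w ->
  (forall A i j, i != j -> row i A = row j A -> w A = 0) -> alternating_form w.
Proof.
move=> wl w0; split=> // A B C i b c E1 E2 E3; apply: (wl A B C i) => // j ji.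
  exact: eq_row'_row E2 ji.
exact: eq_row'_row E3 ji.
Qed.

Lemma sum_ffun_recl k (T : finType) (F : {ffun 'I_k.+1 -> T} -> R) :
  \sum_I F I =
  \sum_c \sum_(I : {ffun 'I_k -> T}) F [ffun i => if unlift ord0 i is Some j then I j else c].
Proof.
rewrite pair_big /=.
rewrite (reindex (fun cI : T * {ffun 'I_k -> T} =>
  [ffun i => if unlift ord0 i is Some j then cI.2 j else cI.1])) //=.
exists (fun I : {ffun 'I_k.+1 -> T} => (I ord0, [ffun j => I (lift ord0 j)])).
  move=> [c I] _ /=; rewrite ffunE unlift_none; congr pair.
  by apply/ffunP => j; rewrite !ffunE liftK.
move=> I _ /=; apply/ffunP => i; rewrite ffunE.
by case: unliftP => [j ->|->] //=; rewrite ffunE.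
Qed.

Definition cons_mx k n (x : 'rV[R]_n) (X : 'M[R]_(k, n)) : 'M[R]_(k.+1, n) :=
  \matrix_i (if unlift ord0 i is Some j then row j X else x).

Lemma row_cons0 k n x (X : 'M[R]_(k, n)) : row ord0 (cons_mx x X) = x.
Proof. by rewrite rowK unlift_none. Qed.

Lemma row_consS k n x (X : 'M[R]_(k, n)) i : row (lift ord0 i) (cons_mx x X) = row i X.
Proof. by rewrite rowK liftK. Qed.

Lemma cons_mx_mul k m n x (X : 'M[R]_(k, m)) (B : 'M[R]_(m, n)) :
  cons_mx x X *m B = cons_mx (x *m B) (X *m B).
Proof.
apply/row_matrixP => i; rewrite row_mul.
by case: (unliftP ord0 i) => [j ->|->]; rewrite ?row_consS ?row_cons0 ?row_mul.
Qed.

Lemma cons_mxE k n (X : 'M[R]_(k.+1, n)) : X = cons_mx (row ord0 X) (row' ord0 X).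
Proof.
apply/row_matrixP => i; case: (unliftP ord0 i) => [j ->|->]; last by rewrite row_cons0.
by rewrite row_consS; apply/rowP => a; rewrite !mxE.
Qed.

(** The rows of [A *m B] are combinations of rows of B: the first one is expanded by linearity, the
    others by induction on k. *)
Lemma multilinear_mulmx k m n (w : 'M[R]_(k, n) -> R) (A : 'M[R]_(k, m)) (B : 'M[R]_(m, n)) :
  multilinear w ->
  w (A *m B) = \sum_(I : {ffun 'I_k -> 'I_m}) (\prod_i A i (I i)) * w (rowsub I B).
Proof.
elim: k w A => [|k IH] w A wl.
  have I0 : {ffun 'I_0 -> 'I_m} by exact: (finfun (fun i : 'I_0 => match notF (ltn_ord i) with end)).
  rewrite (big_pred1 I0); last by move=> I; apply/esym/eqP/ffunP => -[].
  by rewrite big_ord0 mul1r; congr w; apply/matrixP => -[].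
have l_lin (X : 'M[R]_(k, n)) (a : R) x y : w (cons_mx ((a *: x + y) *m B) X)
    = a * w (cons_mx (x *m B) X) + w (cons_mx (y *m B) X).
  rewrite -[w (cons_mx (y *m B) X) in RHS]mul1r; apply: (wl _ _ _ ord0).
  - by rewrite !row_cons0 mulmxDl scalemxAl scale1r.
  - by move=> j; rewrite eq_sym => /unlift_some[i -> _]; rewrite !row_consS.
  - by move=> j; rewrite eq_sym => /unlift_some[i -> _]; rewrite !row_consS.
rewrite {1}(cons_mxE A) cons_mx_mul.
rewrite (@linear_rV_sum _ _ (fun x => w (cons_mx (x *m B) (row' ord0 A *m B)))) //.
rewrite sum_ffun_recl; apply: eq_bigr => c _.
rewrite (IH (fun X => w (cons_mx (delta_mx 0 c *m B) X))); last first.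
  have ne j i : j != lift ord0 i -> (exists2 a, j = lift ord0 a & a != i) \/ j = ord0.
    case: (unliftP ord0 j) => [a ->|->]; last by right.
    by rewrite (inj_eq lift_inj) => ai; left; exists a.
  move=> X Y Z i b d E1 E2 E3; apply: (wl _ _ _ (lift ord0 i)).
  - by rewrite !row_consS.
  - by move=> j /ne[[a -> ai]|->]; rewrite ?row_consS ?row_cons0 ?E2.
  - by move=> j /ne[[a -> ai]|->]; rewrite ?row_consS ?row_cons0 ?E3.
rewrite mulr_sumr; apply: eq_bigr => I _; rewrite mulrA; congr (_ * w _).
  rewrite big_ord_recl ffunE unlift_none mxE; congr (_ * _).
  by apply: eq_bigr => i _; rewrite ffunE liftK mxE.
apply/row_matrixP => i; case: (unliftP ord0 i) => [j ->|->].
  by rewrite row_consS; apply/rowP => a; rewrite !mxE ffunE liftK.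
by rewrite row_cons0 -rowE; apply/rowP => a; rewrite !mxE ffunE unlift_none.
Qed.

Lemma multilinear_ext k n (w w' : 'M[R]_(k, n) -> R) (B : 'M[R]_(n, n)) :
  multilinear w -> multilinear w' -> B \in unitmx ->
  (forall I : {ffun 'I_k -> 'I_n}, w (rowsub I B) = w' (rowsub I B)) -> w = w'.
Proof.
move=> wl wl' uB E; apply/funext => v; rewrite -(mulmxKV uB v) !multilinear_mulmx//.
by apply: eq_bigr => I _; rewrite E.
Qed.

Lemma alternating_tperm k n (w : 'M[R]_(k, n) -> R) A i j : alternating_form w ->
  i != j -> w (row_perm (tperm i j) A) = - w A.
Proof.
move=> aw ij; have wl := alternating_multilinear aw; have [_ w0] := aw.
(* The matrix A with rows i and j replaced by x and y. The sign comes from expanding w with the sum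
   of the two rows in both places, where it vanishes. *)
pose mk x y := \matrix_(a < k) (if a == i then x else if a == j then y else row a A).
have rmk x y a : row a (mk x y) = if a == i then x else if a == j then y else row a A.
  by rewrite rowK.
have ji : (j == i) = false by rewrite eq_sym (negbTE ij).
have lx x x' y : w (mk (x + x') y) = w (mk x y) + w (mk x' y).
  rewrite -[w (mk x y)]mul1r -[w (mk x' y)]mul1r; apply: (wl _ _ _ i).
  - by rewrite !rmk eqxx !scale1r.
  - by move=> a /negbTE ai; rewrite !rmk ai.
  - by move=> a /negbTE ai; rewrite !rmk ai.
have ly x y y' : w (mk x (y + y')) = w (mk x y) + w (mk x y').
  rewrite -[w (mk x y)]mul1r -[w (mk x y')]mul1r; apply: (wl _ _ _ j).
  - by rewrite !rmk ji eqxx !scale1r.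
  - by move=> a /negbTE aj; rewrite !rmk aj.
  - by move=> a /negbTE aj; rewrite !rmk aj.
have d x : w (mk x x) = 0.
  by apply: (w0 _ i j ij); rewrite !rmk eqxx ji eqxx.
have -> : row_perm (tperm i j) A = mk (row j A) (row i A).
  apply/row_matrixP => a; rewrite rmk; apply/rowP => b; rewrite !mxE.
  case: tpermP => [->|->|/eqP/negbTE ai /eqP/negbTE aj]; rewrite ?eqxx ?ji ?mxE//.
  by rewrite ai aj mxE.
have AE : A = mk (row i A) (row j A).
  apply/row_matrixP => a; rewrite rmk.
  by case: eqP => [->|_] //; case: eqP => [->|_].
apply/eqP; rewrite -addr_eq0; apply/eqP.
have := d (row i A + row j A); rewrite lx !ly !d add0r addr0 => E.
by rewrite [in X in _ + X]AE addrC.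
Qed.

Lemma alternating_row_perm k n (w : 'M[R]_(k, n) -> R) A (s : 'S_k) :
  alternating_form w -> w (row_perm s A) = (-1) ^+ s * w A.
Proof.
move=> aw; have [ts -> dts] := prod_tpermP s.
elim: ts dts => [_|t ts IH] /=.
  by rewrite big_nil odd_perm1 expr0 mul1r row_perm1.
move=> /andP[t12 dts]; rewrite big_cons row_permM alternating_tperm//.
by rewrite IH// odd_permM odd_tperm t12 signr_addb expr1 mulN1r mulNr.
Qed.

(** Leibniz expansion: a non-injective choice of rows repeats a row and contributes zero, and the
    other choices are permutations. *)
Lemma alternating_det n (w : 'M[R]_n -> R) (A B : 'M[R]_n) : alternating_form w ->
  w (A *m B) = \det A * w B.
Proof.
move=> aw; have [_ w0] := aw.
rewrite (multilinear_mulmx _ _ (alternating_multilinear aw)).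
rewrite (bigID (fun f : {ffun 'I_n -> 'I_n} => injectiveb f)) /= addrC big1 ?add0r => [|f Uf].
  rewrite (reindex (@pval _)) /=; last first.
    pose in_Sn := insubd (1%g : 'S_n).
    by exists in_Sn => /= f Uf; first apply: val_inj; apply: insubdK.
  rewrite /(\det _) mulr_suml.
  apply: eq_big => /= [s | s _]; rewrite ?(valP s) //.
  have -> : rowsub (pval s) B = row_perm s B by apply/matrixP => i j; rewrite !mxE pvalE.
  rewrite alternating_row_perm// mulrA [_ * (-1) ^+ s]mulrC; congr (_ * _ * _).
  by apply: eq_bigr => i _; rewrite pvalE.
case/injectivePn: Uf => i1 [i2 Di12 Ef12].
by rewrite (w0 _ i1 i2 Di12) ?mulr0//; apply/rowP => j; rewrite !mxE Ef12.
Qed.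

End AlternatingForms.

(** * Inner products, wedge products and volume forms relative to a frame *)

Section FormInnerProduct.
Context {R : realType}.

(** All permutations in the expansion of the determinant contribute equally, since w absorbs the
    sign when its arguments are permuted. *)
Lemma sum_minors k n (w : 'M[R]_(k, n) -> R) (H : 'M[R]_n) (I : 'I_k -> 'I_n) :
  alternating_form w ->
  \sum_(J : {ffun 'I_k -> 'I_n}) w (rowsub J 1%:M) * \det (mxsub I J H) =
  k`!%:R * w (rowsub I H).
Proof.
move=> aw.
under eq_bigr do rewrite mulr_sumr.
rewrite exchange_big /=.
have E (s : 'S_k) : \sum_(J : {ffun 'I_k -> 'I_n})
    w (rowsub J 1%:M) * ((-1) ^+ s * \prod_i (mxsub I J H) i (s i)) = w (rowsub I H).
  rewrite (reindex_inj (h := fun J : {ffun 'I_k -> 'I_n} => [ffun i => J (s^-1%g i)])) /=; last first.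
    move=> J J' /ffunP E; apply/ffunP => i; have := E (s i); by rewrite !ffunE permK.
  rewrite -[rowsub I H in RHS]mulmx1 (multilinear_mulmx _ _ (alternating_multilinear aw)).
  apply: eq_bigr => J _.
  have -> : rowsub [ffun i => J (s^-1%g i)] (1%:M : 'M[R]_n) =
      row_perm s^-1 (rowsub J (1%:M : 'M[R]_n)).
    by apply/matrixP => i j; rewrite !mxE ffunE.
  rewrite alternating_row_perm// odd_permV mulrACA -expr2 sqrr_sign mul1r mulrC.
  by congr (_ * _); apply: eq_bigr => i _; rewrite !mxE ffunE permK.
under eq_bigr do rewrite E.
by rewrite sumr_const card_Sn mulr_natl.
Qed.

(** The inverse metric is B^T diag(1/d) B. By [sum_minors] the sum over J costs one of the two
    factors k!, and multilinearity in the frame B makes the remaining double sum diagonal. *)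
Lemma form_ip_frame k n (G B : 'M[R]_n) (d : 'rV[R]_n) (e w : 'M[R]_(k, n) -> R) :
  multilinear e -> alternating_form w -> G \in unitmx -> B \in unitmx ->
  (forall a, d 0 a != 0) -> B *m G *m B^T = diag_mx d ->
  form_ip G e w = (k`!%:R)^-1 * \sum_(I : {ffun 'I_k -> 'I_n})
    e (rowsub I B) * w (rowsub I B) * \prod_i (d 0 (I i))^-1.
Proof.
move=> el aw uG uB d0 BGB; have wl := alternating_multilinear aw.
set d' := \row_a (d 0 a)^-1.
have HE : invmx G = B^T *m diag_mx d' *m B.
  have uBT : B^T \in unitmx by rewrite unitmx_tr.
  suff E : B^T *m diag_mx d' *m B *m G = 1%:M by rewrite -[RHS]mulmx1 -(mulmxV uG) mulmxA E mul1mx.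
  rewrite -[LHS](mulmxK uBT) -!mulmxA (mulmxA B) (mulmxA (B *m G)) BGB.
  rewrite (mulmxA (diag_mx d')) mulmx_diag.
  have -> : diag_mx (\row_j (d' 0 j * d 0 j)) = 1%:M :> 'M[R]_n.
    apply/matrixP => i j; rewrite !mxE mulVf//.
  by rewrite mul1mx mulmxV.
rewrite /form_ip.
have -> : \sum_(I : {ffun 'I_k -> 'I_n}) \sum_(J : {ffun 'I_k -> 'I_n})
    e (rowsub I 1%:M) * w (rowsub J 1%:M) * \det (mxsub I J (invmx G)) =
  k`!%:R * \sum_(I : {ffun 'I_k -> 'I_n}) e (rowsub I 1%:M) * w (rowsub I (invmx G)).
  rewrite mulr_sumr; apply: eq_bigr => I _.
  under eq_bigr do rewrite -mulrA.
  by rewrite -mulr_sumr (sum_minors _ _ aw) mulrCA.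
have k0 : k`!%:R != 0 :> R by rewrite pnatr_eq0 -lt0n fact_gt0.
rewrite expr2 invfM -mulrA mulKf//; congr (_ * _).
transitivity (\sum_(I : {ffun 'I_k -> 'I_n}) \sum_(L : {ffun 'I_k -> 'I_n})
   (\prod_i B (L i) (I i) * e (rowsub I 1%:M)) * (w (rowsub L B) * \prod_i (d 0 (L i))^-1)).
  apply: eq_bigr => I _; rewrite HE.
  have -> : rowsub I (B^T *m diag_mx d' *m B) = rowsub I (B^T *m diag_mx d') *m B.
    by rewrite mxsub_mul; congr (_ *m _); apply/matrixP => i j; rewrite !mxE.
  rewrite (multilinear_mulmx _ _ wl) mulr_sumr; apply: eq_bigr => L _.
  have -> : \prod_i (rowsub I (B^T *m diag_mx d')) i (L i) =
      \prod_i B (L i) (I i) * \prod_i (d 0 (L i))^-1.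
    by rewrite -big_split; apply: eq_bigr => i _; rewrite mxE mul_mx_diag !mxE.
  by move: (\prod_i _) (\prod_i _) => a b; ring.
rewrite exchange_big; apply: eq_bigr => L _; rewrite -mulr_suml.
have -> : e (rowsub L B) = e (rowsub L B *m 1%:M) by rewrite mulmx1.
rewrite (multilinear_mulmx _ _ el) mulrA; congr (_ * _ * _).
by apply: eq_bigr => I _; congr (_ * _); apply: eq_bigr => i _; rewrite mxE.
Qed.

Lemma wedge_alternating k l n (a : 'M[R]_(k, n) -> R) (b : 'M[R]_(l, n) -> R) :
  multilinear a -> multilinear b -> alternating_form (wedge_form a b).
Proof.
move=> al bl; apply: multilinear_alternating.
  move=> A B C i x y E1 E2 E3; rewrite /wedge_form.
  rewrite mulrCA [y * _]mulrCA -mulrDr; congr (_ * _).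
  rewrite !mulr_sumr -big_split; apply: eq_bigr => s _ /=.
  (* The position of row i after permuting; it decides which of the two factors is varied. *)
  pose j := s^-1%g i; have sj : s j = i by rewrite permKV.
  have rp (X : 'M[R]_(k + l, n)) c : row c (row_perm s X) = row (s c) X.
    by apply/rowP => r; rewrite !mxE.
  have ru (X : 'M[R]_(k + l, n)) c : row c (usubmx (row_perm s X)) = row (s (lshift l c)) X.
    by apply/rowP => r; rewrite !mxE.
  have rd (X : 'M[R]_(k + l, n)) c : row c (dsubmx (row_perm s X)) = row (s (rshift k c)) X.
    by apply/rowP => r; rewrite !mxE.
  have neq c : c != j -> s c != i by apply: contra => /eqP sc; rewrite /j -sc permK.
  case: (splitP j) => c jc.
    have {}jc : j = lshift l c by apply: val_inj.
    have -> : a (usubmx (row_perm s A)) =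
        x * a (usubmx (row_perm s B)) + y * a (usubmx (row_perm s C)).
      apply: (al _ _ _ c); first by rewrite !ru -jc sj.
      - by move=> r rc; rewrite !ru E2// neq// jc eq_shift.
      - by move=> r rc; rewrite !ru E3// neq// jc eq_shift.
    have -> : dsubmx (row_perm s B) = dsubmx (row_perm s A).
      by apply/row_matrixP => r; rewrite !rd E2// neq// jc eq_shift.
    have -> : dsubmx (row_perm s C) = dsubmx (row_perm s A).
      by apply/row_matrixP => r; rewrite !rd E3// neq// jc eq_shift.
    by move: (_ ^+ _) (a _) (a _) (b _) => ? ? ? ?; ring.
  have {}jc : j = rshift k c by apply: val_inj.
  have -> : b (dsubmx (row_perm s A)) =
      x * b (dsubmx (row_perm s B)) + y * b (dsubmx (row_perm s C)).
    apply: (bl _ _ _ c); first by rewrite !rd -jc sj.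
    - by move=> r rc; rewrite !rd E2// neq// jc eq_shift.
    - by move=> r rc; rewrite !rd E3// neq// jc eq_shift.
  have -> : usubmx (row_perm s B) = usubmx (row_perm s A).
    by apply/row_matrixP => r; rewrite !ru E2// neq// jc eq_shift.
  have -> : usubmx (row_perm s C) = usubmx (row_perm s A).
    by apply/row_matrixP => r; rewrite !ru E3// neq// jc eq_shift.
  by move: (_ ^+ _) (a _) (b _) (b _) => ? ? ? ?; ring.
move=> A i j ij E; rewrite /wedge_form; set S := \sum_s _.
(* Composing with the transposition of the two equal rows leaves the factors unchanged and flips the
   sign. *)
suff : S = - S by move/eqP; rewrite -addr_eq0 -mulr2n mulrn_eq0 /= => /eqP ->; rewrite mulr0.
rewrite {1}/S (reindex_inj (mulIg (tperm i j))) /= -sumrN; apply: eq_bigr => s _.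
rewrite odd_permM odd_tperm ij signr_addb expr1 mulrN1 !mulNr.
have -> // : row_perm (s * tperm i j)%g A = row_perm s A.
apply/row_matrixP => c; apply/rowP => r; rewrite !mxE permM.
have /rowP/(_ r) := E; rewrite !mxE => Er.
by case: tpermP => [->|->|].
Qed.

(** The sign of th scales by the sign of det A and the square root by its absolute value. So the
    volume form, though not defined linearly, behaves as a form of top degree and is determined by
    one frame. *)
Lemma volume_form_mulmx n (G : 'M[R]_n) (th : 'M[R]_n -> R) (A B : 'M[R]_n) :
  alternating_form th ->
  Num.sg (th (A *m B)) * Num.sqrt `|\det (A *m B *m G *m (A *m B)^T)| =
  \det A * (Num.sg (th B) * Num.sqrt `|\det (B *m G *m B^T)|).
Proof.
move=> ath; rewrite (alternating_det _ _ ath) sgrM.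
have -> : A *m B *m G *m (A *m B)^T = A *m (B *m G *m B^T) *m A^T.
  by rewrite trmx_mul !mulmxA.
rewrite (det_mulmx _ A^T) (det_mulmx A) det_tr.
set D := \det (B *m G *m B^T).
have -> : \det A * D * \det A = \det A ^+ 2 * D by ring.
rewrite normrM [`|_ ^+ 2|]ger0_norm ?sqr_ge0// sqrtrM ?sqr_ge0//.
rewrite sqrtr_sqr mulrACA; congr (_ * _).
by rewrite -numEsg.
Qed.

End FormInnerProduct.

(** * Explicit wedge and inner products in dimension four *)

Section DimensionFour.
Context {R : realType}.

(** Permutations are split by the image of 0, as in the cofactor expansion along the first row. *)
Lemma sum_perm_lift n (F : 'S_n.+1 -> R) :
  \sum_s F s = \sum_i \sum_(s : 'S_n) F (lift_perm ord0 i s).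
Proof.
rewrite (partition_big (fun s : 'S_n.+1 => s ord0) predT) //=.
apply: eq_bigr => j0 _; rewrite (reindex (lift_perm ord0 j0)); last first.
  pose ulsf (s : 'S_n.+1) k := odflt k (unlift (s ord0) (s (lift ord0 k))).
  have ulsfK (s : 'S_n.+1) k : lift (s ord0) (ulsf s k) = s (lift ord0 k).
    rewrite /ulsf; have := neq_lift ord0 k.
    by rewrite -(can_eq (permK s)) => /unlift_some[] ? ? ->.
  have inj_ulsf (s : 'S_n.+1) : injective (ulsf s).
    by move=> k k' E; apply: (@lift_inj _ ord0); apply: (@perm_inj _ s); rewrite -!ulsfK E.
  exists (fun s => perm (@inj_ulsf s)) => [s _ | s].
    by apply/permP=> k'; rewrite permE /ulsf lift_perm_lift lift_perm_id liftK.
  move/(s _ =P _) => si0; apply/permP=> k.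
  case: (unliftP ord0 k) => [k'|] ->; rewrite ?lift_perm_id //.
  by rewrite lift_perm_lift -si0 permE ulsfK.
by apply: eq_bigl => s; rewrite lift_perm_id eqxx.
Qed.

(** [h] takes natural numbers so that the iterated lifts reduce to numerals. *)
Lemma sum_S4 (h : nat -> nat -> nat -> nat -> R) :
  \sum_(s : 'S_4) (-1) ^+ s *
    h (s ord0) (s (lift ord0 ord0)) (s (lift ord0 (lift ord0 ord0)))
      (s (lift ord0 (lift ord0 (lift ord0 ord0)))) =
    h 0%N 1%N 2%N 3%N - h 0%N 1%N 3%N 2%N - h 0%N 2%N 1%N 3%N + h 0%N 2%N 3%N 1%N
    + h 0%N 3%N 1%N 2%N - h 0%N 3%N 2%N 1%N
  - h 1%N 0%N 2%N 3%N + h 1%N 0%N 3%N 2%N + h 1%N 2%N 0%N 3%N - h 1%N 2%N 3%N 0%N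
    - h 1%N 3%N 0%N 2%N + h 1%N 3%N 2%N 0%N
  + h 2%N 0%N 1%N 3%N - h 2%N 0%N 3%N 1%N - h 2%N 1%N 0%N 3%N + h 2%N 1%N 3%N 0%N
    + h 2%N 3%N 0%N 1%N - h 2%N 3%N 1%N 0%N
  - h 3%N 0%N 1%N 2%N + h 3%N 0%N 2%N 1%N + h 3%N 1%N 0%N 2%N - h 3%N 1%N 2%N 0%N
    - h 3%N 2%N 0%N 1%N + h 3%N 2%N 1%N 0%N.
Proof.
rewrite sum_perm_lift.
under eq_bigr do rewrite sum_perm_lift.
under eq_bigr => i _ do under eq_bigr do rewrite sum_perm_lift.
have S1 (F : 'S_1 -> R) : \sum_s F s = F 1%g.
  by rewrite (big_pred1 1%g)// => s; apply/esym/eqP/permP => i; rewrite !ord1.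
under eq_bigr => i _ do under eq_bigr => j _ do under eq_bigr => k _ do
  rewrite S1 !odd_lift_perm odd_perm1 !lift_perm_lift !lift_perm_id !perm1.
rewrite !big_ord_recl !big_ord0 /= /bump /= ?addn0 ?add0n ?addn1 ?add1n.
move: h => h.
rewrite !(expr0, expr1, mul1r, mulN1r, addr0, addrA).
ring.
Qed.

End DimensionFour.

Section FrameValues.
Context {R : realType}.
Implicit Types (B : 'M[R]_4).

(* The indices are natural numbers, so that concrete ones compute. *)
Definition frows k B (s : seq nat) : 'M[R]_(k, 4) :=
  rowsub (fun i : 'I_k => inord (nth 0%N s i) : 'I_4) B.

Lemma row_frows k B s i : row i (frows k B s) = row (inord (nth 0%N s i)) B.
Proof. by apply/rowP => j; rewrite !mxE. Qed.

Lemma rowsub_frows3 B (I : 'I_3 -> 'I_4) :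
  rowsub I B = frows 3 B [:: I ord0 : nat; I (lift ord0 ord0) : nat;
                             I (lift ord0 (lift ord0 ord0)) : nat].
Proof.
apply/matrixP => i j; rewrite !mxE; congr (B _ _); apply: val_inj.
by case: i => [[|[|[|//]]] hi] /=; rewrite inord_val; congr (nat_of_ord (I _)); apply: val_inj.
Qed.

Lemma rowsub_frows2 B (I : 'I_2 -> 'I_4) :
  rowsub I B = frows 2 B [:: I ord0 : nat; I (lift ord0 ord0) : nat].
Proof.
apply/matrixP => i j; rewrite !mxE; congr (B _ _); apply: val_inj.
by case: i => [[|[|//]] hi] /=; rewrite inord_val; congr (nat_of_ord (I _)); apply: val_inj.
Qed.

Lemma rowsub_frows1 B (I : 'I_1 -> 'I_4) : rowsub I B = frows 1 B [:: I ord0 : nat].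
Proof.
apply/matrixP => i j; rewrite !mxE; congr (B _ _); apply: val_inj.
by rewrite !ord1 /= inord_val.
Qed.

Lemma frows3_values (w : 'M[R]_(3, 4) -> R) B (f := fun a b c => w (frows 3 B [:: a; b; c])) :
  alternating_form w ->
  [/\ forall a b c, f b a c = - f a b c, forall a b c, f a c b = - f a b c
    & forall a c, f a a c = 0].
Proof.
move=> aw; split=> [a b c|a b c|a c].
- rewrite /f -(alternating_tperm _ aw (isT : (ord0 : 'I_3) != lift ord0 ord0)).
  congr w; apply/row_matrixP => i; apply/rowP => j; rewrite !mxE; congr (B (inord _) _).
  by case: tpermP => [->|->|] //; case: i => [[|[|[|//]]] hi] //= H1 H2;
    [case: H1|case: H2]; apply: val_inj.
- rewrite /f -(alternating_tperm _ aw (isT : (lift ord0 ord0 : 'I_3) != lift ord0 (lift ord0 ord0))).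
  congr w; apply/row_matrixP => i; apply/rowP => j; rewrite !mxE; congr (B (inord _) _).
  by case: tpermP => [->|->|] //; case: i => [[|[|[|//]]] hi] //= H1 H2;
    [case: H1|case: H2]; apply: val_inj.
- have [_ w0] := aw; apply: (w0 _ ord0 (lift ord0 ord0)) => //.
  by rewrite !row_frows.
Qed.

Lemma frows2_values (w : 'M[R]_(2, 4) -> R) B (f := fun a b => w (frows 2 B [:: a; b])) :
  alternating_form w -> (forall a b, f b a = - f a b) /\ (forall a, f a a = 0).
Proof.
move=> aw; split=> [a b|a].
- rewrite /f -(alternating_tperm _ aw (isT : (ord0 : 'I_2) != lift ord0 ord0)).
  congr w; apply/row_matrixP => i; apply/rowP => j; rewrite !mxE; congr (B (inord _) _).
  by case: tpermP => [->|->|] //; case: i => [[|[|//]] hi] //= H1 H2;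
    [case: H1|case: H2]; apply: val_inj.
- have [_ w0] := aw; apply: (w0 _ ord0 (lift ord0 ord0)) => //.
  by rewrite !row_frows.
Qed.

(** Each choice of three frame vectors for e comes from 3! permutations with equal contributions,
    which cancels the normalization. *)
Lemma wedge31_frame (e : 'M[R]_(3, 4) -> R) (t : 'M[R]_(1, 4) -> R) B
    (E := fun a b c => e (frows 3 B [:: a; b; c])) (T := fun a => t (frows 1 B [:: a])) :
  alternating_form e ->
  wedge_form (k := 3) (l := 1) e t B =
  E 0%N 1%N 2%N * T 3%N - E 0%N 1%N 3%N * T 2%N
  + E 0%N 2%N 3%N * T 1%N - E 1%N 2%N 3%N * T 0%N.
Proof.
move=> ae.
have [s1 s2] : (forall a b c, E b a c = - E a b c) /\ (forall a b c, E a c b = - E a b c).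
  by have [] := frows3_values B ae.
rewrite /wedge_form.
have -> : \sum_(s : 'S_(3 + 1)) (-1) ^+ s * e (usubmx (row_perm s (B : 'M[R]_(3 + 1, 4))))
    * t (dsubmx (row_perm s (B : 'M[R]_(3 + 1, 4)))) =
  \sum_(s : 'S_4) (-1) ^+ s * (fun a b c d => E a b c * T d) (s ord0) (s (lift ord0 ord0))
      (s (lift ord0 (lift ord0 ord0))) (s (lift ord0 (lift ord0 (lift ord0 ord0)))).
  apply: eq_bigr => s _; rewrite -mulrA; congr (_ * (e _ * t _)).
    apply/matrixP => i j; rewrite !mxE; congr (B _ _); apply: val_inj.
    by case: i => [[|[|[|//]]] hi] /=; rewrite inord_val; congr (nat_of_ord (s _)); apply: val_inj.
  apply/matrixP => i j; rewrite !mxE; congr (B _ _); apply: val_inj.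
  by rewrite !ord1 /= inord_val; congr (nat_of_ord (s _)); apply: val_inj.
rewrite (sum_S4 (fun a b c d => E a b c * T d)); clearbody E T.
have P a b c : [/\ E a c b = - E a b c, E b a c = - E a b c, E b c a = E a b c,
    E c a b = E a b c & E c b a = - E a b c].
  split; [exact: s2|exact: s1| | |].
  - by rewrite s2 s1 opprK.
  - by rewrite s1 s2 opprK.
  - by rewrite s1 s2 s1 opprK.
have [-> -> -> -> ->] := P 0%N 1%N 2%N; have [-> -> -> -> ->] := P 0%N 1%N 3%N.
have [-> -> -> -> ->] := P 0%N 2%N 3%N; have [-> -> -> -> ->] := P 1%N 2%N 3%N.
have -> : (3`! * 1`!)%N = 6%N by [].
move: E T {s1 s2 P} => E T; by field.
Qed.

Lemma wedge22_frame (e t : 'M[R]_(2, 4) -> R) B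
    (E := fun a b => e (frows 2 B [:: a; b])) (T := fun a b => t (frows 2 B [:: a; b])) :
  alternating_form e -> alternating_form t ->
  wedge_form (k := 2) (l := 2) e t B =
  E 0%N 1%N * T 2%N 3%N - E 0%N 2%N * T 1%N 3%N + E 0%N 3%N * T 1%N 2%N
  + E 1%N 2%N * T 0%N 3%N - E 1%N 3%N * T 0%N 2%N + E 2%N 3%N * T 0%N 1%N.
Proof.
move=> ae at_.
have s1 a b : E b a = - E a b by have [H _] := frows2_values B ae; exact: H.
have s2 a b : T b a = - T a b by have [H _] := frows2_values B at_; exact: H.
rewrite /wedge_form.
have -> : \sum_(s : 'S_(2 + 2)) (-1) ^+ s * e (usubmx (row_perm s (B : 'M[R]_(2 + 2, 4))))
    * t (dsubmx (row_perm s (B : 'M[R]_(2 + 2, 4)))) =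
  \sum_(s : 'S_4) (-1) ^+ s * (fun a b c d => E a b * T c d) (s ord0) (s (lift ord0 ord0))
      (s (lift ord0 (lift ord0 ord0))) (s (lift ord0 (lift ord0 (lift ord0 ord0)))).
  apply: eq_bigr => s _; rewrite -mulrA; congr (_ * (e _ * t _)).
    apply/matrixP => i j; rewrite !mxE; congr (B _ _); apply: val_inj.
    by case: i => [[|[|//]] hi] /=; rewrite inord_val; congr (nat_of_ord (s _)); apply: val_inj.
  apply/matrixP => i j; rewrite !mxE; congr (B _ _); apply: val_inj.
  by case: i => [[|[|//]] hi] /=; rewrite inord_val; congr (nat_of_ord (s _)); apply: val_inj.
rewrite (sum_S4 (fun a b c d => E a b * T c d)); clearbody E T.
rewrite !(s1 0%N 1%N, s1 0%N 2%N, s1 0%N 3%N, s1 1%N 2%N, s1 1%N 3%N, s1 2%N 3%N).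
rewrite !(s2 0%N 1%N, s2 0%N 2%N, s2 0%N 3%N, s2 1%N 2%N, s2 1%N 3%N, s2 2%N 3%N).
have -> : (2`! * 2`!)%N = 4%N by [].
move: E T {s1 s2} => E T; by field.
Qed.

Lemma sum_ffun_ord0 (T : finType) (F : {ffun 'I_0 -> T} -> R) c :
  (forall I, F I = c) -> \sum_I F I = c.
Proof.
by move=> Fc; under eq_bigr do rewrite Fc; rewrite sumr_const card_ffun card_ord expn0.
Qed.

Lemma sum_ffun3 (h : nat -> nat -> nat -> R) :
  \sum_(I : {ffun 'I_3 -> 'I_4}) h (I ord0) (I (lift ord0 ord0)) (I (lift ord0 (lift ord0 ord0)))
  = \sum_(a < 4) \sum_(b < 4) \sum_(c < 4) h a b c.
Proof.
rewrite sum_ffun_recl; apply: eq_bigr => a _.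
rewrite sum_ffun_recl; apply: eq_bigr => b _.
rewrite sum_ffun_recl; apply: eq_bigr => c _.
by apply: sum_ffun_ord0 => I; rewrite !ffunE !(unlift_none, liftK) !ffunE
  !(unlift_none, liftK) !ffunE !(unlift_none, liftK).
Qed.

Lemma sum_ffun2 (h : nat -> nat -> R) :
  \sum_(I : {ffun 'I_2 -> 'I_4}) h (I ord0) (I (lift ord0 ord0))
  = \sum_(a < 4) \sum_(b < 4) h a b.
Proof.
rewrite sum_ffun_recl; apply: eq_bigr => a _.
rewrite sum_ffun_recl; apply: eq_bigr => b _.
by apply: sum_ffun_ord0 => I; rewrite !ffunE !(unlift_none, liftK) !ffunE
  !(unlift_none, liftK).
Qed.

Lemma sum3_symmetric (F : nat -> nat -> nat -> R) :
  (forall a b c, F b a c = F a b c) -> (forall a b c, F a c b = F a b c) ->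
  (forall a c, F a a c = 0) ->
  \sum_(a < 4) \sum_(b < 4) \sum_(c < 4) F a b c =
  6 * (F 0%N 1%N 2%N + F 0%N 1%N 3%N + F 0%N 2%N 3%N + F 1%N 2%N 3%N).
Proof.
move=> s1 s2 z1.
have z2 a c : F a c c = 0 by rewrite s1 s2 z1.
have z3 a c : F a c a = 0 by rewrite s2 z1.
have P a b c : [/\ F a c b = F a b c, F b a c = F a b c, F b c a = F a b c,
    F c a b = F a b c & F c b a = F a b c].
  split; [exact: s2|exact: s1| | |].
  - by rewrite s2 s1.
  - by rewrite s1 s2.
  - by rewrite s1 s2 s1.
rewrite !big_ord_recl !big_ord0 /= /bump /= ?addn0 ?add0n ?addn1 ?add1n.
rewrite !(z1, z2, z3) !(add0r, addr0).
have [-> -> -> -> ->] := P 0%N 1%N 2%N; have [-> -> -> -> ->] := P 0%N 1%N 3%N.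
have [-> -> -> -> ->] := P 0%N 2%N 3%N; have [-> -> -> -> ->] := P 1%N 2%N 3%N.
by clear; ring.
Qed.

Lemma sum2_symmetric (F : nat -> nat -> R) :
  (forall a b, F b a = F a b) -> (forall a, F a a = 0) ->
  \sum_(a < 4) \sum_(b < 4) F a b =
  2 * (F 0%N 1%N + F 0%N 2%N + F 0%N 3%N + F 1%N 2%N + F 1%N 3%N + F 2%N 3%N).
Proof.
move=> s z; rewrite !big_ord_recl !big_ord0 /= /bump /= ?addn0 ?add0n ?addn1 ?add1n.
rewrite !z !(add0r, addr0).
rewrite !(s 0%N 1%N, s 0%N 2%N, s 0%N 3%N, s 1%N 2%N, s 1%N 3%N, s 2%N 3%N).
by clear; ring.
Qed.

Section FrameInnerProduct.
Variables (G B : 'M[R]_4) (d : 'rV[R]_4).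
Hypotheses (uG : G \in unitmx) (uB : B \in unitmx) (d0 : forall a, d 0 a != 0).
Hypothesis BGB : B *m G *m B^T = diag_mx d.
Let D (a : nat) := (d 0 (inord a))^-1.

Lemma form_ip3_frame (e w : 'M[R]_(3, 4) -> R)
    (E := fun a b c => e (frows 3 B [:: a; b; c])) (W := fun a b c => w (frows 3 B [:: a; b; c])) :
  alternating_form e -> alternating_form w ->
  form_ip G e w = E 0%N 1%N 2%N * W 0%N 1%N 2%N * (D 0 * D 1 * D 2)
    + E 0%N 1%N 3%N * W 0%N 1%N 3%N * (D 0 * D 1 * D 3)
    + E 0%N 2%N 3%N * W 0%N 2%N 3%N * (D 0 * D 2 * D 3)
    + E 1%N 2%N 3%N * W 1%N 2%N 3%N * (D 1 * D 2 * D 3).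
Proof.
move=> ae aw; rewrite (form_ip_frame (alternating_multilinear ae) aw uG uB d0 BGB).
have [e1 e2 e3] : [/\ forall a b c, E b a c = - E a b c,
    forall a b c, E a c b = - E a b c & forall a c, E a a c = 0] := frows3_values B ae.
have [w1 w2 w3] : [/\ forall a b c, W b a c = - W a b c,
    forall a b c, W a c b = - W a b c & forall a c, W a a c = 0] := frows3_values B aw.
pose F a b c := E a b c * W a b c * (D a * D b * D c).
transitivity ((3`!%:R)^-1 * \sum_(I : {ffun 'I_3 -> 'I_4})
    F (I ord0) (I (lift ord0 ord0)) (I (lift ord0 (lift ord0 ord0)))).
  congr (_ * _); apply: eq_bigr => I _; rewrite rowsub_frows3 /F; congr (_ * _).
  by rewrite !big_ord_recl big_ord0 mulr1 /D !inord_val mulrA.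
rewrite sum_ffun3 sum3_symmetric.
- rewrite (_ : 3`! = 6)%N// mulrA mulVf ?mul1r ?pnatr_eq0//.
- by move=> a b c; rewrite /F e1 w1; ring.
- by move=> a b c; rewrite /F e2 w2; ring.
- by move=> a c; rewrite /F e3 !mul0r.
Qed.

Lemma form_ip2_frame (e w : 'M[R]_(2, 4) -> R)
    (E := fun a b => e (frows 2 B [:: a; b])) (W := fun a b => w (frows 2 B [:: a; b])) :
  alternating_form e -> alternating_form w ->
  form_ip G e w = E 0%N 1%N * W 0%N 1%N * (D 0 * D 1)
    + E 0%N 2%N * W 0%N 2%N * (D 0 * D 2) + E 0%N 3%N * W 0%N 3%N * (D 0 * D 3)
    + E 1%N 2%N * W 1%N 2%N * (D 1 * D 2) + E 1%N 3%N * W 1%N 3%N * (D 1 * D 3)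
    + E 2%N 3%N * W 2%N 3%N * (D 2 * D 3).
Proof.
move=> ae aw; rewrite (form_ip_frame (alternating_multilinear ae) aw uG uB d0 BGB).
have [e1 e2] : (forall a b, E b a = - E a b) /\ (forall a, E a a = 0) := frows2_values B ae.
have [w1 w2] : (forall a b, W b a = - W a b) /\ (forall a, W a a = 0) := frows2_values B aw.
pose F a b := E a b * W a b * (D a * D b).
transitivity ((2`!%:R)^-1 * \sum_(I : {ffun 'I_2 -> 'I_4})
    F (I ord0) (I (lift ord0 ord0))).
  congr (_ * _); apply: eq_bigr => I _; rewrite rowsub_frows2 /F; congr (_ * _).
  by rewrite !big_ord_recl big_ord0 mulr1 /D !inord_val.
rewrite sum_ffun2 sum2_symmetric.
- rewrite (_ : 2`! = 2)%N// mulrA mulVf ?mul1r ?pnatr_eq0//.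
- by move=> a b; rewrite /F e1 w1; ring.
- by move=> a; rewrite /F e2 !mul0r.
Qed.

End FrameInnerProduct.

Lemma alternating2 (f : 'rV[R]_4 -> 'rV[R]_4 -> R) :
  (forall a b x x' y, f (a *: x + b *: x') y = a * f x y + b * f x' y) ->
  (forall a b x y y', f x (a *: y + b *: y') = a * f x y + b * f x y') ->
  (forall x, f x x = 0) ->
  alternating_form (fun v : 'M[R]_(2, 4) => f (row 0 v) (row 1 v)).
Proof.
move=> l1 l2 a1; have I2 (i : 'I_2) : i = 0 \/ i = 1.
  by case: i => [[|[|//]] hi]; [left|right]; apply: val_inj.
have a2 x y : f x y = - f y x.
  have := a1 (1 *: x + 1 *: y); rewrite l1 !l2 !a1 !mul1r add0r addr0 => E.
  by apply/eqP; rewrite -addr_eq0 E.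
apply: multilinear_alternating => [A B C i b c E1 E2 E3|A i j ij E].
  case: (I2 i) E1 E2 E3 => -> E1 E2 E3.
  - by rewrite E1 (E2 1)// (E3 1)// l1.
  - by rewrite E1 (E2 0)// (E3 0)// l2.
by case: (I2 i) (I2 j) ij E => -> [] -> // _ ->.
Qed.

Lemma alternating3 (f : 'rV[R]_4 -> 'rV[R]_4 -> 'rV[R]_4 -> R) :
  (forall a b x x' y z, f (a *: x + b *: x') y z = a * f x y z + b * f x' y z) ->
  (forall a b x y y' z, f x (a *: y + b *: y') z = a * f x y z + b * f x y' z) ->
  (forall a b x y z z', f x y (a *: z + b *: z') = a * f x y z + b * f x y z') ->
  (forall x z, f x x z = 0) -> (forall x z, f x z z = 0) -> (forall x z, f x z x = 0) ->
  alternating_form (fun v : 'M[R]_(3, 4) => f (row 0 v) (row 1 v) (row 2 v)).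
Proof.
move=> l1 l2 l3 a1 a2 a3; have I3 (i : 'I_3) : [\/ i = 0, i = 1 | i = 2].
  by case: i => [[|[|[|//]]] hi]; [apply: Or31|apply: Or32|apply: Or33]; apply: val_inj.
apply: multilinear_alternating => [A B C i b c E1 E2 E3|A i j ij E].
  case: (I3 i) E1 E2 E3 => -> E1 E2 E3.
  - by rewrite E1 (E2 1)// (E2 2)// (E3 1)// (E3 2)// l1.
  - by rewrite E1 (E2 0)// (E2 2)// (E3 0)// (E3 2)// l2.
  - by rewrite E1 (E2 0)// (E2 1)// (E3 0)// (E3 1)// l3.
by case: (I3 i) (I3 j) ij E => -> [] -> // _ ->.
Qed.

(** * Nondegeneracy of the wedge pairing *)

Section Uniqueness.
Variable B : 'M[R]_4.
Hypothesis uB : B \in unitmx.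
Let X (x : 'rV[R]_4) (a : nat) : R := (x *m invmx B) 0 (inord a).

Let X_lin a b x y k : X (a *: x + b *: y) k = a * X x k + b * X y k.
Proof. by rewrite /X mulmxDl -!scalemxAl !mxE. Qed.

Let X_frame i a : (i < 4)%N -> (a < 4)%N -> X (row (inord i) B) a = (i == a)%:R.
Proof.
move=> i4 a4; rewrite /X -row_mul mulmxV// !mxE -val_eqE /= !inordK//.
Qed.

(** The difference of t and t' is tested against a 3-form built from its own frame values, with
    signs that make the wedge the sum of their squares. *)
Lemma wedge31_inj (t t' : 'M[R]_(1, 4) -> R) :
  alternating_form t -> alternating_form t' ->
  (forall e, alternating_form e -> wedge_form (k := 3) (l := 1) e t B
     = wedge_form (k := 3) (l := 1) e t' B) -> t = t'.
Proof.
move=> at_ at' E.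
pose T a := t (frows 1 B [:: a]) - t' (frows 1 B [:: a]).
(* The 3 x 3 minors of the coordinates in the frame B, that is, the basis 3-forms of the dual
   frame. *)
pose det3 a b c x y z := X x a * (X y b * X z c - X y c * X z b)
  - X x b * (X y a * X z c - X y c * X z a) + X x c * (X y a * X z b - X y b * X z a).
pose f x y z := T 3%N * det3 0%N 1%N 2%N x y z - T 2%N * det3 0%N 1%N 3%N x y z
  + T 1%N * det3 0%N 2%N 3%N x y z - T 0%N * det3 1%N 2%N 3%N x y z.
have af : alternating_form (fun v : 'M[R]_(3, 4) => f (row 0 v) (row 1 v) (row 2 v)).
  apply: alternating3; rewrite /f /det3.
  - move=> a b x x' y z; rewrite !X_lin; ring.
  - move=> a b x y y' z; rewrite !X_lin; ring.
  - move=> a b x y z z'; rewrite !X_lin; ring.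
  - by move=> x z; ring.
  - by move=> x z; ring.
  - by move=> x z; ring.
have := E _ af; rewrite !wedge31_frame// !row_frows /=.
have fE a b c : (a < 4)%N -> (b < 4)%N -> (c < 4)%N ->
  f (row (inord a) B) (row (inord b) B) (row (inord c) B) =
  T 3%N * (((a == 0%N)%:R * ((b == 1%N)%:R * (c == 2%N)%:R - (b == 2%N)%:R * (c == 1%N)%:R)
   - (a == 1%N)%:R * ((b == 0%N)%:R * (c == 2%N)%:R - (b == 2%N)%:R * (c == 0%N)%:R)
   + (a == 2%N)%:R * ((b == 0%N)%:R * (c == 1%N)%:R - (b == 1%N)%:R * (c == 0%N)%:R)))
  - T 2%N * (((a == 0%N)%:R * ((b == 1%N)%:R * (c == 3%N)%:R - (b == 3%N)%:R * (c == 1%N)%:R)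
   - (a == 1%N)%:R * ((b == 0%N)%:R * (c == 3%N)%:R - (b == 3%N)%:R * (c == 0%N)%:R)
   + (a == 3%N)%:R * ((b == 0%N)%:R * (c == 1%N)%:R - (b == 1%N)%:R * (c == 0%N)%:R)))
  + T 1%N * (((a == 0%N)%:R * ((b == 2%N)%:R * (c == 3%N)%:R - (b == 3%N)%:R * (c == 2%N)%:R)
   - (a == 2%N)%:R * ((b == 0%N)%:R * (c == 3%N)%:R - (b == 3%N)%:R * (c == 0%N)%:R)
   + (a == 3%N)%:R * ((b == 0%N)%:R * (c == 2%N)%:R - (b == 2%N)%:R * (c == 0%N)%:R)))
  - T 0%N * (((a == 1%N)%:R * ((b == 2%N)%:R * (c == 3%N)%:R - (b == 3%N)%:R * (c == 2%N)%:R)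
   - (a == 2%N)%:R * ((b == 1%N)%:R * (c == 3%N)%:R - (b == 3%N)%:R * (c == 1%N)%:R)
   + (a == 3%N)%:R * ((b == 1%N)%:R * (c == 2%N)%:R - (b == 2%N)%:R * (c == 1%N)%:R))).
  by move=> a4 b4 c4; rewrite /f /det3 !X_frame.
rewrite !fE// /= !(mul0r, mulr0, mul1r, mulr1, subr0, sub0r, addr0, add0r, oppr0).
move=> S.
have S2 : T 0%N ^+ 2 + T 1%N ^+ 2 + T 2%N ^+ 2 + T 3%N ^+ 2 = 0.
  apply/eqP; rewrite -subr_eq0 subr0; apply/eqP; move/eqP: S; rewrite -subr_eq0 => /eqP <-.
  rewrite /T; ring.
have T0 : [/\ T 0%N = 0, T 1%N = 0, T 2%N = 0 & T 3%N = 0].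
  move/eqP: S2; rewrite !paddr_eq0 ?addr_ge0 ?sqr_ge0// !sqrf_eq0.
  by move=> /andP[/andP[/andP[/eqP-> /eqP->] /eqP->] /eqP->].
apply: (multilinear_ext (alternating_multilinear at_) (alternating_multilinear at') uB) => I.
rewrite rowsub_frows1; apply/eqP; rewrite -subr_eq0 -/(T (I ord0)).
by have [t0 t1 t2 t3] := T0; case: (I ord0) => [[|[|[|[|//]]]] hi] /=; apply/eqP.
Qed.

Lemma wedge22_inj (t t' : 'M[R]_(2, 4) -> R) :
  alternating_form t -> alternating_form t' ->
  (forall e, alternating_form e -> wedge_form (k := 2) (l := 2) e t B
     = wedge_form (k := 2) (l := 2) e t' B) -> t = t'.
Proof.
move=> at_ at' E.
pose T a b := t (frows 2 B [:: a; b]) - t' (frows 2 B [:: a; b]).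
pose det2 a b x y := X x a * X y b - X x b * X y a.
(* The coefficients mirror [wedge22_frame], so that the wedge with the difference of t and t' is
   again a sum of squares. *)
pose f x y := T 2%N 3%N * det2 0%N 1%N x y - T 1%N 3%N * det2 0%N 2%N x y
  + T 1%N 2%N * det2 0%N 3%N x y + T 0%N 3%N * det2 1%N 2%N x y
  - T 0%N 2%N * det2 1%N 3%N x y + T 0%N 1%N * det2 2%N 3%N x y.
have af : alternating_form (fun v : 'M[R]_(2, 4) => f (row 0 v) (row 1 v)).
  apply: alternating2; rewrite /f /det2.
  - by move=> a b x x' y; rewrite !X_lin; ring.
  - by move=> a b x y y'; rewrite !X_lin; ring.
  - by move=> x; ring.
have := E _ af; rewrite !wedge22_frame// !row_frows /=.
have fE a b : (a < 4)%N -> (b < 4)%N -> f (row (inord a) B) (row (inord b) B) =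
  T 2%N 3%N * ((a == 0%N)%:R * (b == 1%N)%:R - (a == 1%N)%:R * (b == 0%N)%:R)
  - T 1%N 3%N * ((a == 0%N)%:R * (b == 2%N)%:R - (a == 2%N)%:R * (b == 0%N)%:R)
  + T 1%N 2%N * ((a == 0%N)%:R * (b == 3%N)%:R - (a == 3%N)%:R * (b == 0%N)%:R)
  + T 0%N 3%N * ((a == 1%N)%:R * (b == 2%N)%:R - (a == 2%N)%:R * (b == 1%N)%:R)
  - T 0%N 2%N * ((a == 1%N)%:R * (b == 3%N)%:R - (a == 3%N)%:R * (b == 1%N)%:R)
  + T 0%N 1%N * ((a == 2%N)%:R * (b == 3%N)%:R - (a == 3%N)%:R * (b == 2%N)%:R).
  by move=> a4 b4; rewrite /f /det2 !X_frame.
rewrite !fE// /= !(mul0r, mulr0, mul1r, mulr1, subr0, sub0r, addr0, add0r, oppr0).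
move=> S.
have S2 : T 0%N 1%N ^+ 2 + T 0%N 2%N ^+ 2 + T 0%N 3%N ^+ 2 + T 1%N 2%N ^+ 2
    + T 1%N 3%N ^+ 2 + T 2%N 3%N ^+ 2 = 0.
  apply/eqP; rewrite -subr_eq0 subr0; apply/eqP; move/eqP: S; rewrite -subr_eq0 => /eqP <-.
  by rewrite /T; ring.
have [[t01 t02 t03] [t12 t13 t23]] : [/\ T 0%N 1%N = 0, T 0%N 2%N = 0 & T 0%N 3%N = 0]
    /\ [/\ T 1%N 2%N = 0, T 1%N 3%N = 0 & T 2%N 3%N = 0].
  move: S2; clear; move: (T 0%N 1%N) (T 0%N 2%N) (T 0%N 3%N) (T 1%N 2%N) (T 1%N 3%N) (T 2%N 3%N).
  move=> a b c d e f /eqP; rewrite !paddr_eq0 ?addr_ge0 ?sqr_ge0// !sqrf_eq0.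
  by move=> /andP[/andP[/andP[/andP[/andP[/eqP-> /eqP->] /eqP->] /eqP->] /eqP->] /eqP->].
have [t1 t2] : (forall a b, T b a = - T a b) /\ (forall a, T a a = 0).
  have [s1 s2] := frows2_values B at_; have [s1' s2'] := frows2_values B at'.
  split=> [a b|a]; first by rewrite /T (s1 a b) (s1' a b); ring.
  by rewrite /T (s2 a) (s2' a) subr0.
apply: (multilinear_ext (alternating_multilinear at_) (alternating_multilinear at') uB) => I.
rewrite rowsub_frows2; apply/eqP; rewrite -subr_eq0 -/(T (I ord0) (I (lift ord0 ord0))).
case: (I ord0) (I (lift ord0 ord0)) => [[|[|[|[|//]]]] hi] [[|[|[|[|//]]]] hj] /=;
  by rewrite ?t2 ?t01 ?t02 ?t03 ?t12 ?t13 ?t23 // t1 ?t01 ?t02 ?t03 ?t12 ?t13 ?t23 ?oppr0.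
Qed.

End Uniqueness.

End FrameValues.

(** * Orthogonal frames adapted to J *)

Section AdaptedFrame.
Context {R : realType}.
Variables (G J : 'M[R]_4) (kappa : R).
Hypotheses (Gs : G^T = G) (uG : G \in unitmx) (kappa2 : kappa * kappa = 1).
Hypothesis JJ : J *m J = kappa%:M.
Hypothesis GJ : forall x y, ip G (x *m J) (y *m J) = - kappa * ip G x y.

Let mulJJ (x : 'rV[R]_4) : x *m J *m J = kappa *: x.
Proof. by rewrite -mulmxA JJ mul_mx_scalar. Qed.

Let kappa_neq0 : kappa != 0.
Proof. by apply: contra_eq_neq kappa2 => ->; rewrite mul0r eq_sym oner_eq0. Qed.

Let skewJ x y : ip G (x *m J) y = - ip G x (y *m J).
Proof.
have := GJ x (y *m J); rewrite mulJJ ipZr mulNr -mulrN => E.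
by rewrite -[LHS]mul1r -kappa2 -mulrA E mulrA kappa2 mul1r.
Qed.

Let ipJ x : ip G x (x *m J) = 0.
Proof.
have := skewJ x x; rewrite (ip_sym _ _ Gs) => /eqP.
by rewrite -addr_eq0 -mulr2n mulrn_eq0 /= => /eqP.
Qed.

(** Applied to the identity and to the projection onto an orthogonal complement, to produce non-null
    vectors. *)
Lemma polarization (P : 'rV[R]_4 -> 'rV[R]_4) :
  (forall x y, P (x + y) = P x + P y) -> (forall x, ip G (P x) (P x) = 0) ->
  forall x y, ip G (P x) (P y) = 0.
Proof.
move=> PD P0 x y; have := P0 (x + y); rewrite PD ipDl !ipDr !P0 add0r addr0.
by rewrite (ip_sym (P y) _ Gs) => /eqP; rewrite -mulr2n mulrn_eq0 /= => /eqP.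
Qed.

(** A non-null b0 exists as G is not zero, and J b0 is orthogonal to it and non-null too. The
    complement of their span is preserved by J and again contains a non-null vector b2. *)
Lemma exists_adapted_frame : exists B d0 d2,
  [/\ d0 != 0, d2 != 0,
      row (inord 1) B = row (inord 0) B *m J /\ row (inord 3) B = row (inord 2) B *m J
    & B *m G *m B^T =
        diag_mx (\row_(i < 4) nth 0 [:: d0; - kappa * d0; d2; - kappa * d2] i)].
Proof.
have [b0 b00] : exists x, ip G x x != 0.
  apply: contrapT => /forallNP N; have N0 x : ip G x x = 0.
    by apply/eqP/negP => /negP /N.
  have Z := polarization (P := id) (fun _ _ => erefl) N0.
  have : (const_mx 1 : 'rV[R]_4) = 0.
    by apply: (ip_inj uG) => z; rewrite ip0l; exact: Z.
  by move/rowP/(_ 0); rewrite !mxE => /eqP; rewrite oner_eq0.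
set d0 := ip G b0 b0 in b00; pose b1 := b0 *m J.
have b11 : ip G b1 b1 = - kappa * d0 by exact: GJ.
have b01 : ip G b0 b1 = 0 by exact: ipJ.
have b10 : ip G b1 b0 = 0 by rewrite (ip_sym _ _ Gs).
have d1_neq0 : - kappa * d0 != 0 by rewrite mulf_neq0// oppr_eq0.
(* Orthogonal projection onto the complement of b0 and b1. *)
pose P x := x - (ip G x b0 / d0) *: b0 - (ip G x b1 / (- kappa * d0)) *: b1.
have PD x y : P (x + y) = P x + P y.
  rewrite /P !ipDl !mulrDl !scalerDl; move: (_ *: b0) (_ *: b1) (_ *: b0) (_ *: b1) => a b c e.
  by apply/rowP => j; rewrite !mxE; ring.
have P0 x : ip G (P x) b0 = 0.
  by rewrite /P !(ipBl, ipZl) b10 mulr0 subr0 divfK// subrr.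
have P1 x : ip G (P x) b1 = 0.
  by rewrite /P !(ipBl, ipZl) b01 b11 mulr0 subr0 divfK// subrr.
have [b2 [b22 b20 b21]] : exists x, [/\ ip G x x != 0, ip G x b0 = 0 & ip G x b1 = 0].
  apply: contrapT => /forallNP N; have N0 x : ip G (P x) (P x) = 0.
    by apply/eqP/negP => /negP Px; apply: (N (P x)).
  have Z := polarization PD N0.
  have PZ x : P x = 0.
    apply: (ip_inj uG) => z; rewrite ip0l.
    have -> : z = P z + (ip G z b0 / d0) *: b0 + (ip G z b1 / (- kappa * d0)) *: b1.
      by rewrite /P; move: (_ *: b0) (_ *: b1) => a b; apply/rowP => j; rewrite !mxE; ring.
    by rewrite (ipDr _ _ (P z + _)) (ipDr _ _ (P z)) !ipZr Z P0 P1 !mulr0 !addr0.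
  (* With P zero, every standard basis vector is a combination of b0 and b1, so the 4 x 4 identity
     would factor through dimension 2. *)
  pose A := \matrix_(i < 4) row_mx (const_mx (ip G (delta_mx 0 i) b0 / d0) : 'rV[R]_1)
     (const_mx (ip G (delta_mx 0 i) b1 / (- kappa * d0)) : 'rV[R]_1).
  have : A *m col_mx b0 b1 = 1%:M.
    apply/row_matrixP => i; rewrite row_mul rowK mul_row_col rowE mulmx1.
    have /eqP := PZ (delta_mx 0 i); rewrite /P -addrA -opprD subr_eq0 => /eqP {3}->.
    by congr (_ + _); apply/rowP => j; rewrite !mxE big_ord1 !mxE.
  by move/mulmx1_min.
set d2 := ip G b2 b2 in b22; pose b3 := b2 *m J.
have b33 : ip G b3 b3 = - kappa * d2 by exact: GJ.
have b23 : ip G b2 b3 = 0 by exact: ipJ.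
have b30 : ip G b3 b0 = 0 by rewrite skewJ b21 oppr0.
have b31 : ip G b3 b1 = 0 by rewrite /b3 /b1 GJ b20 mulr0.
pose b (i : 'I_4) := nth 0 [:: b0; b1; b2; b3] i.
exists (\matrix_i b i), d0, d2; split=> //.
  by split; rewrite !rowK /b !inordK.
apply/matrixP => i j.
have -> : ((\matrix_i b i) *m G *m (\matrix_i b i)^T) i j = ip G (b i) (b j).
  by rewrite -[LHS]ip_delta -ip_mulmx -!rowE !rowK.
have [b02 b12] : ip G b0 b2 = 0 /\ ip G b1 b2 = 0 by rewrite !(ip_sym _ b2 Gs).
have [b03 b13] : ip G b0 b3 = 0 /\ ip G b1 b3 = 0 by rewrite !(ip_sym _ b3 Gs).
have b32 : ip G b3 b2 = 0 by rewrite (ip_sym _ _ Gs).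
rewrite !mxE -val_eqE /b.
by case: i j => [[|[|[|[|//]]]] hi] [[|[|[|[|//]]]] hj] /=;
  rewrite ?mulr1n ?mulr0n.
Qed.

End AdaptedFrame.

(** * The Hodge star and the co-derivative *)

Section HodgeStar.
Context {R : realType} {M : manifold R 4}.
Implicit Types (X Y Z : M -> 'rV[R]_4) (p q : M) (x y z : 'rV[R]_4).
Variables (g J : M -> 'M[R]_4) (kappa : R).
Hypothesis g_smooth : smooth_metric g.
Hypothesis g_sym : forall p, (g p)^T = g p.
Hypothesis g_unit : forall p, g p \in unitmx.
Hypothesis J_smooth : smooth_endo J.
Hypothesis kappa2 : kappa * kappa = 1.
Hypothesis JJ : forall p, J p *m J p = kappa%:M.
Hypothesis gJ : forall p x y, ip (g p) (x *m J p) (y *m J p) = - kappa * ip (g p) x y.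

Let mu := volume_form g (orientation g J).

Lemma kahler_form_alternating p : alternating_form (kahler_form g J p).
Proof.
apply: (@alternating2 R (kahler g J p)) => [a b x x' y|a b x y y'|x].
- by rewrite /kahler ipDl !ipZl.
- by rewrite /kahler mulmxDl -!scalemxAl ipDr !ipZr.
- have := kahler_skew g_sym kappa2 JJ gJ p x x => /eqP.
  by rewrite -addr_eq0 -mulr2n mulrn_eq0 /= => /eqP.
Qed.

(** Vanishing on repeated arguments comes from [dmetricJ], the derivative of the skew-symmetry of
    Omega. *)
Lemma dkahler_alternating p :
  alternating_form (fun v : 'M[R]_(3, 4) => dkahler g J p (row 0 v) (row 1 v) (row 2 v)).
Proof.
have dl v a b u u' w : dmetric g p v (a *: u + b *: u') w =
    a * dmetric g p v u w + b * dmetric g p v u' w by rewrite /dmetric ipDl !ipZl.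
have dr v a b u u' w : dmetric g p v w (a *: u + b *: u') =
    a * dmetric g p v w u + b * dmetric g p v w u' by rewrite /dmetric ipDr !ipZr.
have dv a b u u' v w : dmetric g p (a *: u + b *: u') v w =
    a * dmetric g p u v w + b * dmetric g p u' v w.
  have L c x y : dmetric g p (c *: x + y) v w = c * dmetric g p x v w + dmetric g p y v w.
    exact: dmetric_linear.
  by rewrite L (functionalZ (l := fun x => dmetric g p x v w) L).
have el v a b u u' w : dendo g J p v (a *: u + b *: u') w =
    a * dendo g J p v u w + b * dendo g J p v u' w.
  by rewrite /dendo mulmxDl -!scalemxAl ipDl !ipZl.
have er v a b u u' w : dendo g J p v w (a *: u + b *: u') =
    a * dendo g J p v w u + b * dendo g J p v w u' by rewrite /dendo ipDr !ipZr.
have ev a b u u' v w : dendo g J p (a *: u + b *: u') v w =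
    a * dendo g J p u v w + b * dendo g J p u' v w.
  have L c x y : dendo g J p (c *: x + y) v w = c * dendo g J p x v w + dendo g J p y v w.
    rewrite /dendo (endo_deriv_linear _ _ _ _ J_smooth).
    move: (endo_deriv J p x) (endo_deriv J p y) => A B.
    by rewrite mulmxDr -scalemxAr ipDl ipZl.
  by rewrite L (functionalZ (l := fun x => dendo g J p x v w) L).
have J_lin a b u u' : (a *: u + b *: u') *m J p = a *: (u *m J p) + b *: (u' *m J p).
  by rewrite mulmxDl -!scalemxAl.
have dC := dmetric_sym g_smooth g_sym p.
have dJ := dmetricJ g_smooth g_sym J_smooth kappa2 JJ gJ p.
rewrite /dkahler; move: (dmetric g p) (dendo g J p) dl dr dv el er ev dC dJ.
move=> d e dl dr dv el er ev dC dJ.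
apply: (@alternating3 R (fun x y z => d x y (z *m J p) + e x z y
  - (d y x (z *m J p) + e y z x) + (d z x (y *m J p) + e z y x))) => [a b x x' y z|a b x y y' z|a b x y z z'|x z|x z|x z].
- by rewrite dv ev !dl !er; ring.
- by rewrite !J_lin dl er dv ev dr el; ring.
- by rewrite !J_lin dr el dr el dv ev; ring.
- by have := dJ z x x; rewrite (dC z (x *m J p)) => E; lra.
- by have := dJ x z z; rewrite (dC x (z *m J p)) => E; lra.
- have := dJ x x z; have := dJ z x x.
  by rewrite (dC x (x *m J p)) (dC z (x *m J p)) => E1 E2; lra.
Qed.

Lemma dderivZ p v c f : smooth_fun_near p f ->
  dderiv p v (fun q => c * f q) = c * dderiv p v f.
Proof.
move=> /near_fun_differentiable df.
have D : derivable (f \o chart_inv (chart_at p)) (chart_map (chart_at p) p) v.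
  exact: diff_derivable.
exact: (deriveZ c D).
Qed.

Lemma ext_deriv_scaled_kahler p c (v : 'M[R]_(3, 4)) :
  ext_deriv (k := 2) (fun q u => c * kahler_form g J q u) p v =
  c * dkahler g J p (row 0 v) (row 1 v) (row 2 v).
Proof.
rewrite -(ext_deriv_kahler g_smooth g_sym J_smooth) /ext_deriv mulr_sumr.
apply: eq_bigr => j _; rewrite mulrCA; congr (_ * _).
apply: dderivZ; exists (chart_dom (chart_at p)).
split; [exact: chart_dom_open|exact: chart_at_dom|].
have oc := @chart_dom_open _ _ M (chart_at p).
have S : smooth_fun (chart_dom (chart_at p)) (fun q => kahler g J q
    (const_field (chart_at p) (row 0 (row' j v)) q)
    (const_field (chart_at p) (row 1 (row' j v)) q)).
  by apply: smooth_kahler => //; apply: smooth_const_field.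
apply: smooth_fun_eq oc _ S => q _.
by rewrite /kahler_form !row_mul.
Qed.

Section AtPoint.
Variables (p : M) (B : 'M[R]_4) (d0 d2 : R).
Hypotheses (d0_neq0 : d0 != 0) (d2_neq0 : d2 != 0).
Hypothesis B1 : row (inord 1%N) B = row (inord 0%N) B *m J p.
Hypothesis B3 : row (inord 3%N) B = row (inord 2%N) B *m J p.
Hypothesis BgB : B *m g p *m B^T =
  diag_mx (\row_(i < 4) nth 0 [:: d0; - kappa * d0; d2; - kappa * d2] i).

Let kappa_neq0 : kappa != 0.
Proof. by apply: contra_eq_neq kappa2 => ->; rewrite mul0r eq_sym oner_eq0. Qed.

Let d := \row_(i < 4) nth 0 [:: d0; - kappa * d0; d2; - kappa * d2] i.

Let d_neq0 a : d 0 a != 0.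
Proof.
rewrite mxE; case: a => [[|[|[|[|//]]]] ha] //=; by rewrite mulf_neq0// oppr_eq0.
Qed.

Let det_d : \det (B *m g p *m B^T) = (d0 * d2) ^+ 2.
Proof.
rewrite BgB det_diag !big_ord_recl big_ord0 !mxE /=.
transitivity (kappa * kappa * (d0 * d2) ^+ 2); first by ring.
by rewrite kappa2 mul1r.
Qed.

Let uB : B \in unitmx.
Proof.
rewrite unitmxE unitfE; apply: contra_eq_neq det_d => B0.
by rewrite !det_mulmx B0 !mul0r eq_sym expf_neq0// mulf_neq0.
Qed.

Let ipB (i j : nat) : (i < 4)%N -> (j < 4)%N -> ip (g p) (row (inord i) B) (row (inord j) B) =
  if i == j then nth 0 [:: d0; - kappa * d0; d2; - kappa * d2] i else 0.
Proof.
move=> i4 j4; rewrite !rowE ip_mulmx ip_delta BgB !mxE -val_eqE /= !inordK//.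
by case: (i == j); rewrite ?mulr1n ?mulr0n.
Qed.

Let kahlerB (a b : nat) : (a < 4)%N -> (b < 4)%N ->
  kahler_form g J p (frows 2 B [:: a; b]) =
  kahler g J p (row (inord a) B) (row (inord b) B).
Proof. by move=> a4 b4; rewrite /kahler_form !row_frows. Qed.

Let kB01 : kahler g J p (row (inord 0%N) B) (row (inord 1%N) B) = kappa * d0.
Proof. by rewrite /kahler B1 (mulJJ JJ) ipZr ipB. Qed.
Let kB02 : kahler g J p (row (inord 0%N) B) (row (inord 2%N) B) = 0.
Proof. by rewrite /kahler -B3 ipB. Qed.
Let kB03 : kahler g J p (row (inord 0%N) B) (row (inord 3%N) B) = 0.
Proof. by rewrite /kahler B3 (mulJJ JJ) ipZr ipB ?mulr0. Qed.
Let kB12 : kahler g J p (row (inord 1%N) B) (row (inord 2%N) B) = 0.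
Proof. by rewrite /kahler -B3 ipB. Qed.
Let kB13 : kahler g J p (row (inord 1%N) B) (row (inord 3%N) B) = 0.
Proof. by rewrite /kahler B3 (mulJJ JJ) ipZr ipB ?mulr0. Qed.
Let kB23 : kahler g J p (row (inord 2%N) B) (row (inord 3%N) B) = kappa * d2.
Proof. by rewrite /kahler B3 (mulJJ JJ) ipZr ipB. Qed.

(** On B the orientation form has the value d0 d2 and the square root of the Gram determinant is |d0
    d2|. The product of sign and root is therefore d0 d2, whichever sign it has. *)
Let mu_frame (A : 'M[R]_4) : mu p (A *m B) = \det A * (d0 * d2).
Proof.
have aK := kahler_form_alternating p.
have ath : alternating_form (orientation g J p).
  have := wedge_alternating (alternating_multilinear aK) (alternating_multilinear aK).
  move=> [wl w0]; split=> [C D E i b c h1 h2 h3|C i j ij h].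
    by rewrite /orientation (wl C D E i b c h1 h2 h3); ring.
  by rewrite /orientation (w0 C i j ij h) mulr0.
rewrite /mu /volume_form (volume_form_mulmx _ _ _ ath); congr (_ * _).
have W := wedge22_frame B aK aK.
rewrite det_d /orientation W !kahlerB// kB01 kB02 kB03 kB12 kB13 kB23.
rewrite !(mul0r, mulr0, subr0, addr0).
have -> : 2^-1 * (kappa * d0 * (kappa * d2) + kappa * d2 * (kappa * d0)) = d0 * d2.
  transitivity (kappa * kappa * (d0 * d2)); first by field.
  by rewrite kappa2 mul1r.
by rewrite ger0_norm ?sqr_ge0// sqrtr_sqr -numEsg.
Qed.

(** On frame vectors Omega only has the values kappa d0 and kappa d2, on the pairs 0, 1 and 2, 3.
    The star exchanges these pairs, and the squared norm of either pair of dual covectors carries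
    the factor -kappa. *)
Lemma hodge_kahler_form :
  hodge (k := 2) (l := 2) g mu (kahler_form g J) p = fun v => - kappa * kahler_form g J p v.
Proof.
have aK := kahler_form_alternating p.
apply: xget_subset1; last first.
  move=> s s' [as_ Hs] [as' Hs']; apply: (wedge22_inj uB) => // e ae.
  by rewrite Hs// Hs'.
have aK' : alternating_form (fun v => - kappa * kahler_form g J p v).
  case: aK => wl w0; split=> [C D E i b c h1 h2 h3|C i j ij h].
    by rewrite (wl C D E i b c h1 h2 h3); ring.
  by rewrite (w0 C i j ij h) mulr0.
(* Both sides are multiplied by the same determinant under a change of arguments, so they are
   compared on the frame B only. *)
split=> // e ae v; rewrite -(mulmxKV uB v) mu_frame.
rewrite (alternating_det _ _ (wedge_alternating (alternating_multilinear ae)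
  (alternating_multilinear aK'))).
rewrite [RHS]mulrCA; apply: (congr1 (fun r => \det _ * r)).
have W := wedge22_frame B ae aK'; have F := form_ip2_frame (g_unit p) uB d_neq0 BgB ae aK.
rewrite W F !kahlerB// kB01 kB02 kB03 kB12 kB13 kB23 !mxE !inordK//=.
rewrite !(mul0r, mulr0, subr0, addr0, add0r).
move: (e _) (e _) => E01 E23.
transitivity (- (kappa * kappa) * (E23 * d2 + E01 * d0)); first by ring.
by rewrite kappa2; field; rewrite kappa_neq0 d0_neq0 d2_neq0.
Qed.

Let X x (a : nat) : R := (x *m invmx B) 0 (inord a).

Let X_frame i a : (i < 4)%N -> (a < 4)%N -> X (row (inord i) B) a = (i == a)%:R.
Proof.
by move=> i4 a4; rewrite /X -row_mul mulmxV// !mxE -val_eqE /= !inordK.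
Qed.

Let T a b c : R := dkahler g J p (row (inord a) B) (row (inord b) B) (row (inord c) B).

(* As Omega only pairs the frame vectors 0, 1 and 2, 3, each of the equations
   [T = - 2 phi /\ Omega] on three frame vectors determines one value of phi *)
Let phi x : R := - (kappa / 2) * (X x 0%N * (T 0%N 2%N 3%N / d2) + X x 1%N * (T 1%N 2%N 3%N / d2)
  + X x 2%N * (T 0%N 1%N 2%N / d0) + X x 3%N * (T 0%N 1%N 3%N / d0)).

Let phi_linear a x y : phi (a *: x + y) = a * phi x + phi y.
Proof.
have XD k : X (a *: x + y) k = a * X x k + X y k.
  by rewrite /X mulmxDl -scalemxAl !mxE.
by rewrite /phi !XD; move: T X => t r; ring.
Qed.

Let phiB : [/\ phi (row (inord 0%N) B) = - (kappa / 2) * (T 0%N 2%N 3%N / d2),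
  phi (row (inord 1%N) B) = - (kappa / 2) * (T 1%N 2%N 3%N / d2),
  phi (row (inord 2%N) B) = - (kappa / 2) * (T 0%N 1%N 2%N / d0)
  & phi (row (inord 3%N) B) = - (kappa / 2) * (T 0%N 1%N 3%N / d0)].
Proof.
have X0 a b : (a < 4)%N -> (b < 4)%N -> a != b -> X (row (inord a) B) b = 0.
  by move=> a4 b4 /negbTE ab; rewrite X_frame// ab.
have X1 a : (a < 4)%N -> X (row (inord a) B) a = 1.
  by move=> a4; rewrite X_frame// eqxx.
rewrite /phi; move: T => t; split.
- by rewrite (X1 0%N)// (X0 0%N 1%N)// (X0 0%N 2%N)// (X0 0%N 3%N)//; ring.
- by rewrite (X1 1%N)// (X0 1%N 0%N)// (X0 1%N 2%N)// (X0 1%N 3%N)//; ring.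
- by rewrite (X1 2%N)// (X0 2%N 0%N)// (X0 2%N 1%N)// (X0 2%N 3%N)//; ring.
- by rewrite (X1 3%N)// (X0 3%N 0%N)// (X0 3%N 1%N)// (X0 3%N 2%N)//; ring.
Qed.

Let phi_lee : is_lee_form g J p phi.
Proof.
pose f x y z := phi x * kahler g J p y z - phi y * kahler g J p x z + phi z * kahler g J p x y.
(* [u] is d Omega + 2 phi /\ Omega, an alternating form, which vanishes once it does on the four
   increasing triples of frame vectors. *)
pose u (v : 'M[R]_(3, 4)) := dkahler g J p (row 0 v) (row 1 v) (row 2 v)
  + 2 * f (row 0 v) (row 1 v) (row 2 v).
have k0 x : kahler g J p x x = 0.
  have := kahler_skew g_sym kappa2 JJ gJ p x x => /eqP.
  by rewrite -addr_eq0 -mulr2n mulrn_eq0 /= => /eqP.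
have kC := kahler_skew g_sym kappa2 JJ gJ p.
have phiD a b x y : phi (a *: x + b *: y) = a * phi x + b * phi y.
  by rewrite phi_linear (functionalZ phi_linear).
have kl a b x y z : kahler g J p (a *: x + b *: y) z = a * kahler g J p x z + b * kahler g J p y z.
  by rewrite /kahler ipDl !ipZl.
have kr a b x y z : kahler g J p z (a *: x + b *: y) = a * kahler g J p z x + b * kahler g J p z y.
  by rewrite /kahler mulmxDl -!scalemxAl ipDr !ipZr.
have af : alternating_form (fun v : 'M[R]_(3, 4) => f (row 0 v) (row 1 v) (row 2 v)).
  rewrite /f; move: (kahler g J p) kl kr k0 kC phi phiD => k kl kr k0 kC h hD.
  apply: (@alternating3 R (fun x y z => h x * k y z - h y * k x z + h z * k x y))
    => [a b x x' y z|a b x y y' z|a b x y z z'|x z|x z|x z].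
  - by rewrite !hD !kl; ring.
  - by rewrite !hD kl kr; ring.
  - by rewrite !hD !kr; ring.
  - by rewrite k0; ring.
  - by rewrite k0; ring.
  - by rewrite k0 (kC z x); ring.
have au : alternating_form u.
  have [wl w0] := dkahler_alternating p; have [fl f0] := af.
  split=> [C D E i b c h1 h2 h3|C i j ij h].
    by rewrite /u (wl C D E i b c h1 h2 h3) (fl C D E i b c h1 h2 h3); ring.
  by rewrite /u (w0 C i j ij h) (f0 C i j ij h) mulr0 addr0.
pose U a b c := u (frows 3 B [:: a; b; c]).
have [U1 U2 U3] : [/\ forall a b c, U b a c = - U a b c,
    forall a b c, U a c b = - U a b c & forall a c, U a a c = 0] := frows3_values B au.
have half r s : s != 0 -> r + 2 * (- (kappa / 2) * (r / s) * (kappa * s)) = 0.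
  move=> s0; transitivity (r - (kappa * kappa) * r); last by rewrite kappa2; ring.
  by field.
have [u012 u013 u023 u123] : [/\ U 0%N 1%N 2%N = 0, U 0%N 1%N 3%N = 0,
    U 0%N 2%N 3%N = 0 & U 1%N 2%N 3%N = 0].
  pose P a := phi (row (inord a) B).
  pose K a b := kahler g J p (row (inord a) B) (row (inord b) B).
  have UE a b c : U a b c = T a b c + 2 * (P a * K b c - P b * K a c + P c * K a b).
    by rewrite /U /u /f !row_frows.
  have [P0 P1 P2 P3] : [/\ P 0%N = - (kappa / 2) * (T 0%N 2%N 3%N / d2),
    P 1%N = - (kappa / 2) * (T 1%N 2%N 3%N / d2),
    P 2%N = - (kappa / 2) * (T 0%N 1%N 2%N / d0)
    & P 3%N = - (kappa / 2) * (T 0%N 1%N 3%N / d0)] := phiB.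
  have [K01 K23] : K 0%N 1%N = kappa * d0 /\ K 2%N 3%N = kappa * d2 := conj kB01 kB23.
  have [K02 K03 K12 K13] : [/\ K 0%N 2%N = 0, K 0%N 3%N = 0, K 1%N 2%N = 0 & K 1%N 3%N = 0].
    by split.
  rewrite !UE; move: (T) P K P0 P1 P2 P3 K01 K23 K02 K03 K12 K13 {UE U1 U2 U3}.
  move=> t P K P0 P1 P2 P3 K01 K23 K02 K03 K12 K13.
  rewrite P0 P1 P2 P3 K01 K23 K02 K03 K12 K13 !mulr0 !subr0 !addr0 !add0r.
  by split; apply: half.
(* The squares of [U] are symmetric in the indices, so their total is six times the sum over
   increasing triples, hence zero; being nonnegative, they all vanish. *)
have UZ a b c : (a < 4)%N -> (b < 4)%N -> (c < 4)%N -> U a b c = 0.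
  have S : \sum_(a < 4) \sum_(b < 4) \sum_(c < 4) U a b c ^+ 2 = 0.
    rewrite (sum3_symmetric (F := fun a b c => U a b c ^+ 2)).
    - by rewrite u012 u013 u023 u123 expr0n /= !addr0 mulr0.
    - by move=> x y z; rewrite U1 sqrrN.
    - by move=> x y z; rewrite U2 sqrrN.
    - by move=> x z; rewrite U3 expr0n.
  move=> a4 b4 c4; apply/eqP; rewrite -sqrf_eq0; apply/eqP.
  have S1 (i : 'I_4) : \sum_(j < 4) \sum_(k < 4) U i j k ^+ 2 = 0.
    apply: (psumr_eq0P _ S) => // i' _; apply: sumr_ge0 => j _; apply: sumr_ge0 => k _.
    exact: sqr_ge0.
  have S2 (i j : 'I_4) : \sum_(k < 4) U i j k ^+ 2 = 0.
    by apply: (psumr_eq0P _ (S1 i)) => // j' _; apply: sumr_ge0 => k _; exact: sqr_ge0.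
  have S3 (i j k : 'I_4) : U i j k ^+ 2 = 0.
    by apply: (psumr_eq0P _ (S2 i j)) => // k' _; exact: sqr_ge0.
  exact: (S3 (Ordinal a4) (Ordinal b4) (Ordinal c4)).
have u0 : u = fun=> 0.
  apply: (multilinear_ext (alternating_multilinear au) _ uB) => [C D E i b c _ _ _|I].
    by rewrite !mulr0 addr0.
  by rewrite rowsub_frows3 -/(U _ _ _) UZ.
move=> x y z.
pose v : 'M[R]_(3, 4) := \matrix_(i < 3) nth 0 [:: x; y; z] i.
have := congr1 (fun w => w v) u0; rewrite /u /f !rowK /= => /eqP.
by rewrite addr_eq0 mulNr => /eqP.
Qed.

(** By construction phi at a frame vector is a value of d Omega on that vector and the opposite
    pair. Composing with J, which exchanges 0 with 1 and 2 with 3 up to kappa, moves this value to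
    the vector missing from the triple, as the star requires. *)
Lemma hodge_dkahler (w : M -> 'M[R]_(3, 4) -> R) :
  w p = (fun v => - kappa * dkahler g J p (row 0 v) (row 1 v) (row 2 v)) ->
  hodge (k := 3) (l := 1) g mu w p = fun x : 'M[R]_(1, 4) => -2 * phi (x *m J p).
Proof.
move=> wE.
have aw : alternating_form (w p).
  have [wl w0] := dkahler_alternating p; rewrite wE.
  split=> [C D E i b c h1 h2 h3|C i j ij h].
    by rewrite (wl C D E i b c h1 h2 h3); ring.
  by rewrite (w0 C i j ij h) mulr0.
apply: xget_subset1; last first.
  move=> s s' [as_ Hs] [as' Hs']; apply: (wedge31_inj uB) => // e ae.
  by rewrite Hs// Hs'.
have as_ : alternating_form (fun x : 'M[R]_(1, 4) => -2 * phi (x *m J p)).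
  apply: linear_form1 => a x y.
  by rewrite mulmxDl -scalemxAl phi_linear; ring.
split=> // e ae v; rewrite -(mulmxKV uB v) mu_frame.
rewrite (alternating_det _ _ (wedge_alternating (alternating_multilinear ae)
  (alternating_multilinear as_))).
rewrite [RHS]mulrCA; apply: (congr1 (fun r => \det _ * r)).
have W := wedge31_frame (fun x : 'M[R]_(1, 4) => -2 * phi (x *m J p)) B ae.
have F := form_ip3_frame (g_unit p) uB d_neq0 BgB ae aw.
have row1 a : (frows 1 B [:: a]) = row (inord a) B.
  by apply/rowP => j; rewrite !mxE.
have [ph0 ph1 ph2 ph3] := phiB.
have phiZ := functionalZ phi_linear.
rewrite W F !row1 -B1 -B3 [in row (inord 1%N) _ *m _]B1 [in row (inord 3%N) _ *m _]B3.
rewrite !(mulJJ JJ) !phiZ ph0 ph1 ph2 ph3 wE !row_frows /= -!/(T _ _ _) !mxE !inordK//=.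
move: (T 0%N 1%N 2%N) (T 0%N 1%N 3%N) (T 0%N 2%N 3%N) (T 1%N 2%N 3%N) => t012 t013 t023 t123.
move: (e _) (e _) (e _) (e _) => E012 E013 E023 E123.
(* The inner product of 3-forms involves the inverses of -kappa d0 and -kappa d2. *)
have kV : kappa^-1 = kappa by rewrite -[LHS]mul1r -kappa2 mulfK.
transitivity (kappa * kappa * (E123 * (t012 / d0) + E013 * (t023 / d2))
  - kappa * (E023 * (t013 / d0) + E012 * (t123 / d2))); first by field; rewrite d0_neq0 d2_neq0.
rewrite kappa2 -{1}kV; by field; rewrite kappa_neq0 d0_neq0 d2_neq0.
Qed.

(** The existential hides the frame from which the Lee form is built. The last clause is conditional
    because d (star Omega) at p depends on star Omega near p, while the frame is given at p only. *)
Lemma codiff_kahler_lee_form : exists phi : 'rV[R]_4 -> R,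
  [/\ forall a x y, phi (a *: x + y) = a * phi x + phi y, is_lee_form g J p phi
    & (hodge (k := 2) (l := 2) g mu (kahler_form g J) = fun q v => - kappa * kahler_form g J q v) ->
      forall x, kappa * 2^-1 * endo_form J (codiff_kahler g J) p x = phi x].
Proof.
exists phi; split=> [||H x]; [exact: phi_linear|exact: phi_lee|].
rewrite /endo_form /codiff_kahler -/mu H hodge_dkahler; last first.
  by apply/funext => v; rewrite ext_deriv_scaled_kahler.
have phiZ := functionalZ phi_linear.
rewrite (mulJJ JJ) phiZ; move: (phi x) => r.
transitivity (kappa * kappa * r); first by field.
by rewrite kappa2 mul1r.
Qed.

End AtPoint.

Lemma unique_kahler_weyl_codiff :
  (forall p X Y, smooth_vf_near p X -> smooth_vf_near p Y ->
    lie_bracket X Y p - kappa *: (lie_bracket (app_endo J X) Y p *m J p)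
    - kappa *: (lie_bracket X (app_endo J Y) p *m J p)
    + kappa *: lie_bracket (app_endo J X) (app_endo J Y) p = 0) ->
  unique_kahler_weyl g J (fun p x => kappa * 2^-1 * endo_form J (codiff_kahler g J) p x).
Proof.
move=> NJ.
(* The equality of fields comes first, so that star Omega can be differentiated; the adapted frame
   is chosen anew at each point. *)
have H2 : hodge (k := 2) (l := 2) g mu (kahler_form g J) =
    fun q v => - kappa * kahler_form g J q v.
  apply/funext => q.
  have [B [d0 [d2 [h0 h2 [B1 B3] BgB]]]] :=
    exists_adapted_frame (g_sym q) (g_unit q) kappa2 (JJ q) (gJ q).
  exact: hodge_kahler_form h0 h2 B1 B3 BgB.
have L p : exists phi : 'rV[R]_4 -> R,
    [/\ forall a x y, phi (a *: x + y) = a * phi x + phi y, is_lee_form g J p phi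
    & forall x, kappa * 2^-1 * endo_form J (codiff_kahler g J) p x = phi x].
  have [B [d0 [d2 [h0 h2 [B1 B3] BgB]]]] :=
    exists_adapted_frame (g_sym p) (g_unit p) kappa2 (JJ p) (gJ p).
  have [phi [h3 h4 h5]] := codiff_kahler_lee_form h0 h2 B1 B3 BgB.
  by exists phi; split=> //; exact: h5.
apply: (unique_kahler_weyl_lee_form g_smooth g_sym g_unit J_smooth kappa2 JJ gJ NJ).
  by move=> p a x y; have [phi [h3 _ h5]] := L p; rewrite !h5 h3.
move=> p x y z; have [phi [_ h4 h5]] := L p; rewrite !h5; exact: h4.
Qed.

End HodgeStar.

Theorem theorem1p2 (R : realType) (M : manifold R 4) (g : M -> 'M[R]_4)
    (hg : pseudo_riemannian g) :
  (forall J : M -> 'M[R]_4,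
     para_hermitian_mfd g J -> has_signature 2 g ->
     unique_kahler_weyl g J
       (fun p x => 2^-1 * endo_form J (codiff_kahler g J) p x))
  /\ (forall J : M -> 'M[R]_4,
     pseudo_hermitian_mfd g J -> has_signature 2 g ->
     unique_kahler_weyl g J
       (fun p x => - 2^-1 * endo_form J (codiff_kahler g J) p x))
  /\ (forall J : M -> 'M[R]_4,
     hermitian_mfd g J -> has_signature 0 g ->
     unique_kahler_weyl g J
       (fun p x => - 2^-1 * endo_form J (codiff_kahler g J) p x)).
Proof.
have [sg gs gu] := hg.
(* The case kappa = -1, which covers the pseudo-Hermitian and the Hermitian statement together. *)
have C (J : M -> 'M[R]_4) : pseudo_hermitian_mfd g J -> unique_kahler_weyl g J
    (fun p x => - 2^-1 * endo_form J (codiff_kahler g J) p x).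
  move=> [_ [sJ JJ] gJ NJ].
  have -> : (fun p x => - 2^-1 * endo_form J (codiff_kahler g J) p x) =
      (fun p x => -1 * 2^-1 * endo_form J (codiff_kahler g J) p x).
    by apply/funext => p; apply/funext => x; rewrite mulN1r.
  apply: unique_kahler_weyl_codiff => //.
  - by rewrite mulN1r opprK.
  - by move=> p; rewrite JJ raddfN.
  - by move=> p x y; rewrite opprK mul1r gJ.
  - move=> p X Y sX sY; have := NJ p X Y sX sY.
    move: (lie_bracket X Y p) (lie_bracket _ Y p) (lie_bracket X _ p) (lie_bracket _ _ p).
    by move=> a b c d; rewrite !scaleN1r !opprK.
split; last by split=> J; [move=> H _; exact: C|move=> [H _] _; exact: C].
move=> J [_ _ [sJ JJ] gJ NJ] _.
have -> : (fun p x => 2^-1 * endo_form J (codiff_kahler g J) p x) =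
    (fun p x => 1 * 2^-1 * endo_form J (codiff_kahler g J) p x).
  by apply/funext => p; apply/funext => x; rewrite mul1r.
apply: unique_kahler_weyl_codiff => //.
- by rewrite mul1r.
- by move=> p x y; rewrite gJ mulN1r.
- move=> p X Y sX sY; have := NJ p X Y sX sY.
  move: (lie_bracket X Y p) (lie_bracket _ Y p) (lie_bracket X _ p) (lie_bracket _ _ p).
  by move=> a b c d; rewrite !scale1r.
Qed.
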